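(* Let $(\epsilon_y)_{y\in\mathbb{Z}}$ be i.i.d. $\{-1,1\}$-valued Rademacher random variables. Let $Q>1$ be an even integer and $f:\mathbb{Z}\to\{-1,1\}$ a $Q$-periodic function with $\sum_{k=0}^{Q-1}f(k)=0$. Let $\lambda=(\lambda_y)_{y\in\mathbb{Z}}$ be a sequence of independent $\{0,1\}$-valued random variables, independent of $\epsilon$, such that for every $y\neq 0$ $$\mathbb{P}(\lambda_y=1)=\frac{c}{|y|^\beta},$$ where $c>0$ and $\beta\in\mathbb{R}$ are constants such that the right-hand side lies in $[0,1]$ for all $y\ne0$ (the law of $\lambda_0$ is arbitrary). For $y\in\mathbb{Z}$ set $$\overline\epsilon_y:=(1-\lambda_y)f(y)+\lambda_y\epsilon_y ,$$ and let $\mathbf{H}_{\overline\epsilon,\lambda}$ be the honeycomb lattice in which all horizontal edges with ordinate $y$ are right-directed if $\overline\epsilon_y=1$ and left-directed if $\overline\epsilon_y=-1$, the vertical edges being undirected. Then: (i) If $\beta<1$, then for almost every realization of $(\epsilon,\lambda)$ the simple random walk $(M_n)_{n\ge0}$ on $\mathbf{H}_{\overline\epsilon,\lambda}$ is transient. (ii) If $\beta>1$, then for almost every realization of $(\epsilon,\lambda)$ the simple random walk $(M_n)_{n\ge0}$ on $\mathbf{H}_{\overline\epsilon,\lambda}$ is recurrent.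
   Context: The honeycomb lattice is the graph with vertex set $\mathbb{Z}^2$ obtained from the nearest-neighbour square lattice by deleting, for all $j,k\in\mathbb{Z}$, the vertical edges between $(2j,2k)$ and $(2j,2k+1)$ and between $(2j+1,2k+1)$ and $(2j+1,2k+2)$. Thus all horizontal nearest-neighbour edges are kept, and the vertical edge between $(x,y)$ and $(x,y+1)$ is kept exactly when $x+y$ is odd. In a partially oriented version each horizontal edge is given one direction and vertical edges can be traversed both ways, so every vertex has exactly two outgoing edges (one horizontal, one vertical). The simple random walk $(M_n)_{n\ge0}$ starts at $(0,0)$ and at each step follows one of the two outgoing edges of its current vertex with probability $1/2$ each, independently of the past. For a given orientation, the walk is transient if $\sum_{l\ge 0}\mathbb{P}_0(M_l=(0,0))<\infty$ and recurrent if this sum is infinite (equivalently, if the walk returns to the origin infinitely often almost surely). *)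

(* Defs.v *)
From HB Require Import structures.
From mathcomp Require Import all_boot all_order all_algebra.
From mathcomp Require Import all_classical all_reals all_analysis.

Set Implicit Arguments.
Unset Strict Implicit.
Unset Printing Implicit Defensive.

Import Order.TTheory GRing.Theory Num.Theory.
Import numFieldNormedType.Exports.

Local Open Scope classical_set_scope.
Local Open Scope ring_scope.

Section Independence.
Context (d : measure_display) (T : measurableType d) (R : realType).
Context (P : probability T R).

Definition mutually_independent (I : eqType) (X : I -> {RV P >-> R}) : Prop :=
  forall (J : seq I) (A : I -> set R),
    uniq J -> (forall i, measurable (A i)) ->
    P (\bigcap_(i in [set` J]) (X i @^-1` A i)) =
    (\prod_(i <- J) P (X i @^-1` A i))%E.

Definition sigma_of_family (I : Type) (X : I -> {RV P >-> R}) : set (set T) :=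
  <<s [set E | exists i (B : set R), measurable B /\ E = X i @^-1` B] >>.

Definition independent_families (I J : Type)
    (X : I -> {RV P >-> R}) (Y : J -> {RV P >-> R}) : Prop :=
  forall E F : set T, sigma_of_family X E -> sigma_of_family Y F ->
    P (E `&` F) = (P E * P F)%E.

Definition rademacher (X : {RV P >-> R}) : Prop :=
  [/\ forall w, X w = -1 \/ X w = 1,
      P (X @^-1` [set -1]) = (2^-1)%:E &
      P (X @^-1` [set 1]) = (2^-1)%:E].

End Independence.

Definition vertex : Type := (int * int)%type.

Definition origin : vertex := (0, 0).

(* The vertical edge from (x, y) to (x, y + 1) is deleted from the square
   lattice when (x, y) is (2j, 2k) or (2j + 1, 2k + 1), i.e. x + y is even. *)
Definition vertical_edge_above (x y : int) : bool := ~~ (2 %| x + y)%Z.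

Definition vertical_arc (u v : vertex) : bool :=
  (u.1 == v.1) &&
  ((v.2 == u.2 + 1) && vertical_edge_above u.1 u.2 ||
   (u.2 == v.2 + 1) && vertical_edge_above v.1 v.2).

Definition horizontal_arc (R : realType) (dir : int -> R) (u v : vertex)
    : bool :=
  (u.2 == v.2) &&
  ((dir u.2 == 1) && (v.1 == u.1 + 1) ||
   (dir u.2 == -1) && (v.1 == u.1 - 1)).

(* Arcs of the honeycomb lattice whose horizontal edges at ordinate y point
   right if dir y = 1 and left if dir y = -1. *)
Definition honeycomb (R : realType) (dir : int -> R) : rel vertex :=
  fun u v => horizontal_arc dir u v || vertical_arc u v.

Section Walk.
Context (R : realType) (H : rel vertex).

Definition step_prob (u v : vertex) : R := if H u v then 2^-1 else 0.

Definition history d (T : measurableType d)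
    (M : nat -> T -> vertex) (x : nat -> vertex) (n : nat) : set T :=
  [set w | forall i, (i <= n)%N -> M i w = x i].

(* The last clause is the Markov property, written without conditional
   probabilities: given M_0 = x_0, ..., M_n = x_n, the next position is each
   out-neighbour of x_n with probability 1/2. *)
Definition simple_random_walk d (T : measurableType d) (P : probability T R)
    (M : nat -> T -> vertex) : Prop :=
  [/\ forall n v, measurable (M n @^-1` [set v]),
      forall w, M 0%N w = origin &
      forall (x : nat -> vertex) (n : nat),
        P (history M x n.+1) =
        (P (history M x n) * (step_prob (x n) (x n.+1))%:E)%E].

(* The sum depends only on the law of the walk, hence the quantification over
   all its realizations; one exists whenever every vertex has exactly two
   out-neighbours (drive it by the binary digits of a uniform variable). *)
Definition transient : Prop :=
  forall d (T : measurableType d) (P : probability T R)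
    (M : nat -> T -> vertex), simple_random_walk P M ->
    (\sum_(0 <= l <oo) P (M l @^-1` [set origin]) < +oo)%E.

Definition recurrent : Prop :=
  forall d (T : measurableType d) (P : probability T R)
    (M : nat -> T -> vertex), simple_random_walk P M ->
    (\sum_(0 <= l <oo) P (M l @^-1` [set origin]) = +oo)%E.

End Walk.

Definition perturbed_orientation (R : realType) (f eps lam : int -> R)
    : int -> R :=
  fun y => (1 - lam y) * f y + lam y * eps y.

(* Main.v *)
(* Along the walk the parity of x + y alternates, so s = 2y + [x + y odd] is a
   simple random walk on Z and the abscissa changes exactly when s crosses an
   edge (2y, 2y + 1).  Fourier transform in the abscissa therefore turns the
   expected number of returns into the average over t of Re g_0(t), where
   g = (1 - r A_t)^-1 delta_0 and A_t is the simple random walk on Z with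
   the complex edge weights e^{i t dir(y)}.

   A_t is symmetric with complex entries, so Re g_0 equals the Dirichlet energy
   of g.  Testing the real and imaginary parts of the resolvent equation
   against a function chi and using Cauchy-Schwarz bounds this energy:
   - if the partial sums of dir are bounded, a hat of width 1/t gives
     Re g_0 >= c / t, whose integral diverges; this applies when beta > 1, as
     by Borel-Cantelli only finitely many lines are then perturbed;
   - if chi is a tent on [0, L] and m = sum_y chi(y) dir(y), with partial sums P_y,
     then Re g_0 <= C (L + (L / t^2 + L^3 + sum_y P_y^2) / m^2).

   When beta < 1 the orientation is f flipped on a random set of independent lines.
   At the scale L = M^j the sum m exceeds L^{1 + (1 - beta)/2} 4^-j outside an
   event of probability O(2^-j), by a small ball estimate, and a second moment
   bound controls sum_y P_y^2.  Choosing L slightly below 1/t then gives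
   Re g_0 <= C t^{-1 + eta} for some eta > 0, which is integrable. *)
Require Import Defs.
From HB Require Import structures.
From mathcomp Require Import all_boot all_order all_algebra.
From mathcomp Require Import all_classical all_reals all_analysis.
From mathcomp Require Import ring lra zify.

Set Implicit Arguments.
Unset Strict Implicit.
Unset Printing Implicit Defensive.

Import Order.TTheory GRing.Theory Num.Theory.
Import numFieldNormedType.Exports.

Local Open Scope classical_set_scope.
Local Open Scope ring_scope.

(** * Energy estimates on a chain *)

(** Two devices keep everything finite. The resolvent is replaced by its Neumann series cut at [n],
    which has finite support and solves the same equation up to [r ^ n A ^ n delta_0]; as [A] is a
    contraction, [r ^ n <= 1 - r] makes that error harmless. The average over t becomes a finite
    sum: over roots of unity for recurrence, where [n] steps are too few for aliasing, and over a
    Fejer kernel for transience, where a nonnegative majorant of the indicator of abscissa 0 is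
    enough. The damping satisfies [1 - r = h ^ 2], with [h] at most every frequency where a sharp
    estimate is used, so that it costs no more than order [t ^ 2]. The constants of the random part
    come from one balance. Scales are powers of [M], with [sig = M^((1 - beta) / 2)] at least 64.
    Making the small ball event summable costs [4 ^ j], hence [16 ^ j] after squaring; the second
    moment event costs [2 ^ j]. The bound at scale [j] thus has ratio [32 M], and frequencies are
    cut at powers of [K = 64 M] so that this ratio is [K / 2]: the spare factor [2 ^ -j] makes the
    sum over scales converge. *)

Section ZSum.
Context {R : realFieldType}.
Implicit Types (F G : int -> R) (N : nat).

(** The window runs from [-N] to [N - 1], so that [j] can also stand for the edge between [j] and
    [j + 1]; the pairing lets inductions grow both ends at once. *)
Definition zsum N F : R := \sum_(k < N) (F k%:Z + F (- k.+1%:Z)).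

Lemma zsumS N F : zsum N.+1 F = zsum N F + (F N%:Z + F (- N.+1%:Z)).
Proof. by rewrite /zsum big_ord_recr. Qed.

Lemma eq_zsum N F G : F =1 G -> zsum N F = zsum N G.
Proof. by move=> FG; apply: eq_bigr => k _; rewrite !FG. Qed.

Lemma zsumD N F G : zsum N (fun j => F j + G j) = zsum N F + zsum N G.
Proof. by rewrite /zsum -big_split; apply: eq_bigr => k _ /=; ring. Qed.

Lemma zsumB N F G : zsum N (fun j => F j - G j) = zsum N F - zsum N G.
Proof. by rewrite /zsum -sumrB; apply: eq_bigr => k _ /=; ring. Qed.

Lemma zsumZ N (a : R) F : zsum N (fun j => a * F j) = a * zsum N F.
Proof. by rewrite /zsum mulr_sumr; apply: eq_bigr => k _ /=; ring. Qed.

Lemma ler_zsum N F G : (forall j, F j <= G j) -> zsum N F <= zsum N G.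
Proof. by move=> FG; apply: ler_sum => k _; apply: lerD. Qed.

Lemma ler_zsum_lincomb N F G H (a b : R) : (forall j, F j <= a * G j + b * H j) ->
  zsum N F <= a * zsum N G + b * zsum N H.
Proof. by move=> h; rewrite -!zsumZ -zsumD; exact: ler_zsum. Qed.

Lemma zsum_ge0 N F : (forall j, 0 <= F j) -> 0 <= zsum N F.
Proof. by move=> F0; apply: sumr_ge0 => k _; apply: addr_ge0. Qed.

Lemma zsum_sum N n (F : nat -> int -> R) :
  zsum N (fun j => \sum_(l < n) F l j) = \sum_(l < n) zsum N (F l).
Proof.
rewrite /zsum exchange_big /=; apply: eq_bigr => k _.
by rewrite -big_split.
Qed.

(** Shifting the window exchanges the term at [-N] for the one at [N]; the summations by parts below
    rest on this. *)
Lemma zsum_shift N F : F N%:Z = 0 -> F (- N%:Z) = 0 ->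
  zsum N (fun j => F (j + 1)) = zsum N F.
Proof.
move=> FN FNN.
suff -> : zsum N (fun j => F (j + 1)) = zsum N F + F N%:Z - F (- N%:Z).
  by rewrite FN FNN addr0 subr0.
elim: N {FN FNN} => [|N IH]; first by rewrite /zsum !big_ord0 /= oppr0; ring.
rewrite !zsumS IH.
have -> : N%:Z + 1 = N.+1%:Z by lia.
have -> : - N.+1%:Z + 1 = - N%:Z by lia.
ring.
Qed.

Lemma zsum_delta N F : (0 < N)%N -> zsum N (fun j => (j == 0)%:R * F j) = F 0.
Proof.
elim: N => // N IH _; rewrite zsumS; case: N IH => [_|N ->//].
  by rewrite /zsum big_ord0 /= add0r mul1r mul0r addr0.
by rewrite !mul0r !addr0.
Qed.

Lemma zsum_le_supp N m F (c : R) : 0 <= c -> (forall j, F j <= c) ->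
  (forall j, (m <= `|j|)%N -> F j <= 0) -> zsum N F <= c * m.*2%:R.
Proof.
move=> c0 Fc Fm.
suff : zsum N F <= c * (minn N m).*2%:R.
  move/le_trans; apply; apply: ler_wpM2l => //.
  by rewrite ler_nat leq_double geq_minr.
elim: N => [|N IH]; first by rewrite /zsum big_ord0 min0n mulr0.
rewrite zsumS; have [mN|Nm] := leqP m N.
  rewrite (minn_idPr (leqW mN)); rewrite (minn_idPr mN) in IH.
  have := Fm N%:Z mN; have := Fm (- N.+1%:Z) (leqW mN); lra.
rewrite (minn_idPl Nm); rewrite (minn_idPl (ltnW Nm)) in IH.
have -> : N.+1.*2%:R = N.*2%:R + 2 :> R by rewrite doubleS -addn2 natrD.
rewrite mulrDr; have := Fc N%:Z; have := Fc (- N.+1%:Z); lra.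
Qed.

Lemma zsum_by_parts N (b u : int -> R) : u N%:Z = 0 -> u (- N%:Z) = 0 ->
  zsum N (fun j => (b (j - 1) - b j) * u j) =
  zsum N (fun j => b j * (u (j + 1) - u j)).
Proof.
move=> uN uNN.
have h := @zsum_shift N (fun j => b (j - 1) * u j).
rewrite (eq_zsum _ (G := fun j => b (j - 1) * u j - b j * u j)); last by move=> j; ring.
rewrite zsumB -h ?uN ?uNN ?mulr0// -zsumB; apply: eq_zsum => j.
by rewrite addrK; ring.
Qed.

End ZSum.

Section Chain.
Context {R : realFieldType}.
Variables (r : R) (al be : int -> R) (N : nat).
Hypotheses (r0 : 0 <= r) (r1 : r < 1).
Hypothesis al1 : forall j, `|al j| <= 1.
Implicit Types (phi chi u v p q b : int -> R).

(** Contribution of one edge to the bilinear form of [1 - r Re A]: each site shares its mass equally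
    between its two edges, so energies can be estimated edge by edge. *)
Definition eform phi u j : R :=
  (phi j * u j + phi (j + 1) * u (j + 1)) / 2
  - r * al j / 2 * (phi j * u (j + 1) + phi (j + 1) * u j).

Lemma ral_le1 j : `|r * al j| <= r.
Proof. by rewrite normrM (ger0_norm r0) -{2}[r]mulr1 ler_wpM2l. Qed.

Lemma eform_ge_mass phi j : 0 <= r * al j ->
  (1 - r * al j) * ((phi j ^+ 2 + phi (j + 1) ^+ 2) / 2) <= eform phi phi j.
Proof.
move=> a0; rewrite /eform.
have : 0 <= r * al j * (phi j - phi (j + 1)) ^+ 2 by rewrite mulr_ge0 ?sqr_ge0.
nra.
Qed.

Lemma eform_ge phi j :
  (1 - r) * ((phi j ^+ 2 + phi (j + 1) ^+ 2) / 2) <= eform phi phi j.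
Proof.
have := ral_le1 j; rewrite ler_norml => /andP[h1 h2].
have [a0|/ltW a0] := lerP 0 (r * al j).
  apply: le_trans (eform_ge_mass phi a0); apply: ler_wpM2r; last by lra.
  by rewrite divr_ge0 ?addr_ge0 ?sqr_ge0.
rewrite /eform; set a := r * al j in h1 h2 a0 *.
set x := phi j; set y := phi (j + 1).
have : 0 <= - a * (x + y) ^+ 2 by rewrite mulr_ge0 ?sqr_ge0 ?oppr_ge0.
have : 0 <= (r + a) * (x ^+ 2 + y ^+ 2).
  by apply: mulr_ge0; [lra|rewrite addr_ge0 ?sqr_ge0].
nra.
Qed.

Lemma eform_ge0 phi j : 0 <= eform phi phi j.
Proof.
apply: le_trans (eform_ge phi j).
by apply: mulr_ge0; [rewrite subr_ge0 ltW|rewrite divr_ge0 ?addr_ge0 ?sqr_ge0].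
Qed.

(** Positivity of the form at [phi - tau u]: Cauchy-Schwarz without square roots. *)
Lemma eform_AMGM phi u (tau : R) j : 0 < tau ->
  eform phi u j <= (eform phi phi j / tau + tau * eform u u j) / 2.
Proof.
move=> t0; have h := eform_ge0 (fun i => phi i - tau * u i) j.
rewrite -(ler_pM2l t0).
have -> : tau * ((eform phi phi j / tau + tau * eform u u j) / 2) =
  (eform phi phi j + tau ^+ 2 * eform u u j) / 2 by field; lra.
move: h; rewrite /eform; nra.
Qed.

(** With [a = r * al j], the form is [1 - a] times the mass of the edge plus [a / 2] times the
    squared increment. *)
Lemma eform_ge_grad phi j : 1 / 4 <= r * al j ->
  (phi (j + 1) - phi j) ^+ 2 / 8 <= eform phi phi j.
Proof.
move=> h; have := ral_le1 j; rewrite ler_norml /eform => /andP[_ h'].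
have : 0 <= (r * al j - 1 / 4) * (phi (j + 1) - phi j) ^+ 2.
  by apply: mulr_ge0; [lra|exact: sqr_ge0].
have : 0 <= (1 - r * al j) * (phi j ^+ 2 + phi (j + 1) ^+ 2).
  by apply: mulr_ge0; [have := r1; lra|rewrite addr_ge0 ?sqr_ge0].
nra.
Qed.

(* Real and imaginary parts of (1 - r A)(u + iv) = p + iq, where A is the
   symmetric nearest-neighbour operator with edge weights (al + i be) / 2. *)
Definition chain_eq u v p q : Prop := forall j,
  p j = u j - r / 2 * (al j * u (j + 1) - be j * v (j + 1)
        + al (j - 1) * u (j - 1) - be (j - 1) * v (j - 1)) /\
  q j = v j - r / 2 * (al j * v (j + 1) + be j * u (j + 1)
        + al (j - 1) * v (j - 1) + be (j - 1) * u (j - 1)).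

Lemma chain_testl u v p q phi : chain_eq u v p q ->
  phi N%:Z = 0 -> phi (- N%:Z) = 0 ->
  zsum N (fun j => eform phi u j
            + r / 2 * be j * (phi j * v (j + 1) + phi (j + 1) * v j)) =
  zsum N (fun j => phi j * p j).
Proof.
(* [G j] collects half of the mass of site [j] and what it sees of the edge on its left; shifting it
   turns the sum over sites into a sum over edges. *)
move=> E pN pNN; set G := fun j => phi j * u j / 2
  - r / 2 * phi j * (al (j - 1) * u (j - 1) - be (j - 1) * v (j - 1)).
have h := @zsum_shift _ N G.
rewrite (eq_zsum _ (G := fun j => phi j * p j - G j + G (j + 1))).
  by rewrite zsumD zsumB h ?subrK// /G ?pN ?pNN; ring.
by move=> j; rewrite (E j).1 /G /eform !addrK; field.
Qed.

Lemma chain_testr u v p q phi : chain_eq u v p q ->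
  phi N%:Z = 0 -> phi (- N%:Z) = 0 ->
  zsum N (fun j => eform phi v j
            - r / 2 * be j * (phi j * u (j + 1) + phi (j + 1) * u j)) =
  zsum N (fun j => phi j * q j).
Proof.
move=> E pN pNN; set G := fun j => phi j * v j / 2
  - r / 2 * phi j * (al (j - 1) * v (j - 1) + be (j - 1) * u (j - 1)).
have h := @zsum_shift _ N G.
rewrite (eq_zsum _ (G := fun j => phi j * q j - G j + G (j + 1))).
  by rewrite zsumD zsumB h ?subrK// /G ?pN ?pNN; ring.
by move=> j; rewrite (E j).2 /G /eform !addrK; field.
Qed.

(** Testing the real equation with [u] and the imaginary one with [v] makes the [be] terms cancel,
    because [A] is symmetric rather than Hermitian. *)
Lemma chain_energy u v p q : chain_eq u v p q ->
  u N%:Z = 0 -> u (- N%:Z) = 0 -> v N%:Z = 0 -> v (- N%:Z) = 0 ->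
  zsum N (eform u u) + zsum N (eform v v) =
  zsum N (fun j => u j * p j + v j * q j).
Proof.
move=> E uN uNN vN vNN.
rewrite [RHS]zsumD -(chain_testl E uN uNN) -(chain_testr E vN vNN) -!zsumD.
by apply: eq_zsum => j; ring.
Qed.

(** The three pieces of the coefficients are those that can be controlled: a point mass sees [u 0],
    the derivative of [b] sees the gradient of [u], and [rho] sees its mass. *)
Lemma coupling_by_parts chi u b rho (m : R) : (0 < N)%N ->
  u N%:Z = 0 -> u (- N%:Z) = 0 ->
  (forall j, r / 2 * (be (j - 1) * chi (j - 1) + be j * chi (j + 1)) =
     (j == 0)%:R * m + (b (j - 1) - b j) + rho j) ->
  zsum N (fun j => r / 2 * be j * (chi j * u (j + 1) + chi (j + 1) * u j)) =
  m * u 0 + zsum N (fun j => b j * (u (j + 1) - u j))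
  + zsum N (fun j => rho j * u j).
Proof.
move=> N0 uN uNN h; pose G j := r / 2 * be (j - 1) * chi (j - 1) * u j.
have hG := @zsum_shift _ N G.
rewrite (eq_zsum _ (G := fun j => G (j + 1) + r / 2 * be j * chi (j + 1) * u j)).
  2: by move=> j; rewrite /G !addrK; ring.
rewrite zsumD hG -?zsumD ?/G ?uN ?uNN ?mulr0//.
rewrite (eq_zsum _ (G := fun j => (j == 0)%:R * (m * u j)
    + (b (j - 1) - b j) * u j + rho j * u j)).
  by rewrite 2!zsumD zsum_delta// zsum_by_parts.
move=> j; transitivity (((j == 0)%:R * m + (b (j - 1) - b j) + rho j) * u j).
  by rewrite -h; ring.
by ring.
Qed.

(** Testing the imaginary equation with [chi] makes the coupling produce [u 0]. The other terms cost
    half of the energy of [u + iv], which is at most [u 0 + 1]; so half of [u 0] is absorbed on the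
    left. *)
Lemma chain_upper u v p q chi b : (0 < N)%N -> chain_eq u v p q ->
  (forall j, 1 / 4 <= r * al j) ->
  u N%:Z = 0 -> u (- N%:Z) = 0 -> v N%:Z = 0 -> v (- N%:Z) = 0 ->
  chi N%:Z = 0 -> chi (- N%:Z) = 0 ->
  zsum N (fun j => u j * p j + v j * q j) <= u 0 + 1 ->
  - zsum N (fun j => chi j * q j) <= (zsum N (eform chi chi) + 1) / 2 ->
  (forall j, r / 2 * (be (j - 1) * chi (j - 1) + be j * chi (j + 1)) =
     (j == 0)%:R + (b (j - 1) - b j)) ->
  u 0 <= 2 * zsum N (eform chi chi) + 8 * zsum N (fun j => b j ^+ 2) + 2.
Proof.
move=> N0 E ral uN uNN vN vNN cN cNN He Hq Hb.
have HT := chain_testr E cN cNN; rewrite zsumB in HT.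
have HC : zsum N (fun j => r / 2 * be j * (chi j * u (j + 1) + chi (j + 1) * u j))
    = u 0 + zsum N (fun j => b j * (u (j + 1) - u j)).
  rewrite (@coupling_by_parts chi u b (fun=> 0) 1)//.
    rewrite mul1r (eq_zsum _ (F := fun j => 0 * u j) (G := fun=> 0 * 0)).
      by rewrite zsumZ mul0r addr0.
    by move=> j; rewrite !mul0r.
  by move=> j; rewrite Hb mulr1 addr0.
have HE := chain_energy E uN uNN vN vNN.
have H1 : zsum N (eform chi v) <= (zsum N (eform chi chi) + zsum N (eform v v)) / 2.
  rewrite mulrC -zsumD -zsumZ; apply: ler_zsum => j.
  by have := eform_AMGM chi v j (ltr01 : 0 < 1 :> R); lra.
have H2 : - zsum N (fun j => b j * (u (j + 1) - u j)) <=
    (8 * zsum N (fun j => b j ^+ 2) + zsum N (eform u u)) / 2.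
  rewrite mulrC -zsumZ -zsumD -zsumZ -mulN1r -zsumZ; apply: ler_zsum => j.
  have := eform_ge_grad u (ral j).
  have := sqr_ge0 (b j * 8 + (u (j + 1) - u j)); nra.
rewrite {}HC in HT; lra.
Qed.

(** Discrete Agmon inequality: a square at one point is a sum of increments of squares over a
    half-line, and each increment is a product of a gradient and a value. *)
Lemma sqr_origin_le u (kap : R) : (0 < N)%N -> 0 < kap -> kap ^+ 2 = 1 - r ->
  (forall j, 1 / 4 <= r * al j) -> u N%:Z = 0 -> u (- N%:Z) = 0 ->
  kap * u 0 ^+ 2 <= 6 * zsum N (eform u u).
Proof.
move=> N0 k0 kr ral uN uNN; pose b (j : int) : R := (0 <= j)%R%:R.
have -> : u 0 ^+ 2 = - zsum N (fun j => b j * (u (j + 1) ^+ 2 - u j ^+ 2)).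
  rewrite -(@zsum_by_parts _ N b (fun j => u j ^+ 2)) ?uN ?uNN ?expr0n//.
  rewrite -[LHS](@zsum_delta _ N (fun j => u j ^+ 2))// -[RHS]mulN1r -zsumZ.
  apply: eq_zsum => j; rewrite mulrA; congr (_ * _); rewrite /b.
  have [->|j0] := eqVneq j 0; first by rewrite /=; ring.
  have -> : (0 <= j - 1) = (0 <= j) by lia.
  by rewrite subrr mulr0.
rewrite mulrN -mulNr -!zsumZ; apply: ler_zsum => j.
have h1 := eform_ge_grad u (ral j); have h2 := eform_ge u j.
have h0 := eform_ge0 u j.
rewrite -kr in h2; set h := eform u u j in h1 h2 h0 *.
have : `|kap * b j * (u (j + 1) ^+ 2 - u j ^+ 2)| <= 6 * h; last first.
  by rewrite ler_norml => /andP[+ _]; lra.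
have b1 : `|b j| <= 1 by rewrite /b; case: (0 <= j); rewrite ?normr0 ?normr1.
rewrite normrM (mulrC kap) normrM -mulrA -normrM.
apply: (@le_trans _ _ `|kap * (u (j + 1) ^+ 2 - u j ^+ 2)|).
  by rewrite -[leRHS]mul1r ler_wpM2r.
rewrite ler_norml; set x := u (j + 1) in h1 h2 *; set y := u j in h1 h2 *.
have := sqr_ge0 ((x - y) - kap * (x + y)); have := sqr_ge0 ((x - y) + kap * (x + y)).
have := sqr_ge0 (kap * (x - y)).
by move=> *; apply/andP; split; nra.
Qed.

(** Crude bound from [kap * u 0 ^+ 2 <= 6 * (u 0 + 1)]. It serves frequency 0, where there is no
    coupling to exploit. *)
Lemma chain_upper_mass u v p q (kap : R) : (0 < N)%N -> chain_eq u v p q ->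
  (forall j, 1 / 4 <= r * al j) ->
  u N%:Z = 0 -> u (- N%:Z) = 0 -> v N%:Z = 0 -> v (- N%:Z) = 0 ->
  zsum N (fun j => u j * p j + v j * q j) <= u 0 + 1 ->
  0 < kap -> kap ^+ 2 = 1 - r -> u 0 <= 12 / kap.
Proof.
move=> N0 E ral uN uNN vN vNN He k0 kr.
have h := sqr_origin_le N0 k0 kr ral uN uNN.
have hv : 0 <= zsum N (eform v v) by apply: zsum_ge0 => j; apply: eform_ge0.
have HE := chain_energy E uN uNN vN vNN.
have k1 : kap <= 1 by rewrite -(@ler_pXn2r _ 2)// ?nnegrE ?(ltW k0)// expr1n kr; have := r0; lra.
rewrite ler_pdivlMr//; have := k0; nra.
Qed.

(** The mass of a site is collected from both of its edges, so it is enough that one of them has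
    [r * al] away from 1. *)
Lemma eform_mass v (kap : R) : v N%:Z = 0 -> v (- N%:Z) = 0 ->
  (forall j, 0 <= r * al j) -> (forall j, kap <= 2 - r * al (j - 1) - r * al j) ->
  kap / 2 * zsum N (fun j => v j ^+ 2) <= zsum N (eform v v).
Proof.
move=> vN vNN ral Hk; pose G j := (1 - r * al (j - 1)) * v j ^+ 2 / 2.
have hG := @zsum_shift _ N G; rewrite /G vN vNN expr0n /= mulr0 mul0r in hG.
apply: (@le_trans _ _ (zsum N (fun j => (1 - r * al j) * v j ^+ 2 / 2 + G (j + 1)))).
  rewrite zsumD hG ?mulr0 ?mul0r// -zsumD -zsumZ; apply: ler_zsum => j.
  have := Hk j; have := sqr_ge0 (v j); rewrite /G; nra.
apply: ler_zsum => j; apply: le_trans (eform_ge_mass v (ral j)).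
by rewrite /G addrK; lra.
Qed.

(** Testing the real equation with [phi] must give at least 3/4, while every term is at most a cost
    of [phi] divided by [tau] plus a multiple of [tau] times the energy; hence the energy cannot be
    small. The coupling to [v] is paid by its gradient through [b] and by its mass through [rho]. *)
Lemma chain_lower u v p q phi b rho (kap Z : R) : (0 < N)%N -> chain_eq u v p q ->
  (forall j, 1 / 4 <= r * al j) -> 0 < kap ->
  (forall j, kap <= 2 - r * al (j - 1) - r * al j) ->
  u N%:Z = 0 -> u (- N%:Z) = 0 -> v N%:Z = 0 -> v (- N%:Z) = 0 ->
  phi N%:Z = 0 -> phi (- N%:Z) = 0 ->
  zsum N (fun j => u j * p j + v j * q j) <= u 0 + 1 ->
  3 / 4 <= zsum N (fun j => phi j * p j) ->
  (forall j, r / 2 * (be (j - 1) * phi (j - 1) + be j * phi (j + 1)) =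
     (b (j - 1) - b j) + rho j) ->
  0 < Z ->
  zsum N (eform phi phi) / 2 + 8 * zsum N (fun j => b j ^+ 2)
    + 2 / kap * zsum N (fun j => rho j ^+ 2) <= Z ->
  1 / (4 * Z) <= u 0 + 1.
Proof.
move=> N0 E ral k0 Hk uN uNN vN vNN pN pNN He Hp Hb Z0 HZ.
have HT := chain_testl E pN pNN; rewrite zsumD in HT.
rewrite (@coupling_by_parts phi v b rho 0) in HT => //; last first.
  by move=> j; rewrite Hb mulr0 add0r.
have HE := chain_energy E uN uNN vN vNN.
have Hm : kap / 2 * zsum N (fun j => v j ^+ 2) <= zsum N (eform v v).
  by apply: eform_mass => // j; have := ral j; lra.
(* With this weight the costs add up to at most 1/2 and the energies to at most [Z * (u 0 + 1)],
   which leaves 1/4 out of 3/4. *)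
pose tau := 2 * Z; have t0 : 0 < tau by rewrite mulr_gt0.
have H1 : zsum N (eform phi u) <=
    tau^-1 * (zsum N (eform phi phi) / 2) + tau / 2 * zsum N (eform u u).
  rewrite (mulrC (zsum _ _)) mulrA; apply: ler_zsum_lincomb => j.
  by have := eform_AMGM phi u j t0; rewrite (mulrC _ tau^-1); lra.
have H2 : zsum N (fun j => b j * (v (j + 1) - v j)) <=
    tau^-1 * (8 * zsum N (fun j => b j ^+ 2)) + tau / 4 * zsum N (eform v v).
  rewrite mulrA; apply: ler_zsum_lincomb => j.
  apply: (@le_trans _ _ (tau^-1 * 8 * b j ^+ 2 + tau / 4 * ((v (j + 1) - v j) ^+ 2 / 8))).
    set y := v (j + 1) - v j.
    rewrite -subr_ge0.
    have -> : tau^-1 * 8 * b j ^+ 2 + tau / 4 * (y ^+ 2 / 8) - b j * y =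
      tau^-1 * 8 * (b j - tau / 16 * y) ^+ 2 by field; lra.
    by rewrite mulr_ge0 ?sqr_ge0// mulr_ge0 ?invr_ge0 ?(ltW t0).
  rewrite lerD2l; apply: ler_wpM2l; last exact: eform_ge_grad.
  by rewrite divr_ge0// ltW.
have H3 : zsum N (fun j => rho j * v j) <=
    tau^-1 * (2 / kap * zsum N (fun j => rho j ^+ 2))
    + tau / 4 * (kap / 2 * zsum N (fun j => v j ^+ 2)).
  rewrite !mulrA; apply: ler_zsum_lincomb => j.
  rewrite -subr_ge0.
  have -> : tau^-1 * 2 / kap * rho j ^+ 2 + tau / 4 * kap / 2 * v j ^+ 2 - rho j * v j
      = tau^-1 * 2 / kap * (rho j - tau * kap / 4 * v j) ^+ 2.
    by field; apply/andP; split; apply/eqP => h; move: k0 t0; rewrite h ltxx.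
  by rewrite mulr_ge0 ?sqr_ge0// !mulr_ge0 ?invr_ge0 ?(ltW t0) ?(ltW k0).
have H4 : tau / 4 * (kap / 2 * zsum N (fun j => v j ^+ 2)) <=
    tau / 4 * zsum N (eform v v) by rewrite ler_wpM2l// divr_ge0// ltW.
have H5 : tau^-1 * (zsum N (eform phi phi) / 2 + 8 * zsum N (fun j => b j ^+ 2)
    + 2 / kap * zsum N (fun j => rho j ^+ 2)) <= 1 / 2.
  rewrite mulrC ler_pdivrMr//; move: HZ; rewrite /tau; lra.
have H6 : tau / 2 * (zsum N (eform u u) + zsum N (eform v v)) <= Z * (u 0 + 1).
  have -> : tau / 2 = Z by rewrite /tau; field.
  by rewrite HE; apply: ler_wpM2l => //; exact: ltW.
have H7 : 1 / 4 <= Z * (u 0 + 1) by rewrite mul0r add0r in HT; lra.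
have Z4 : 0 < 4 * Z by lra.
by rewrite ler_pdivrMr//; lra.
Qed.

End Chain.

(** * Green function of the truncated chain *)

Section Amplitudes.
Context {R : realFieldType}.
Variables (al be : int -> R).
Hypothesis albe : forall j, al j ^+ 2 + be j ^+ 2 = 1.

(** Real and imaginary parts of [A ^ l delta_0]. *)
Fixpoint amp (l : nat) : int -> R * R := fun j =>
  if l is l'.+1 then
    let h := amp l' in
    ((al j * (h (j + 1)).1 - be j * (h (j + 1)).2
      + al (j - 1) * (h (j - 1)).1 - be (j - 1) * (h (j - 1)).2) / 2,
     (al j * (h (j + 1)).2 + be j * (h (j + 1)).1
      + al (j - 1) * (h (j - 1)).2 + be (j - 1) * (h (j - 1)).1) / 2)
  else ((j == 0)%:R, 0).

Definition amp_sqr l j : R := (amp l j).1 ^+ 2 + (amp l j).2 ^+ 2.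

Lemma amp_supp l j : (l < `|j|)%N -> amp l j = (0, 0).
Proof.
elim: l j => [|l IH] j lj /=; first by have -> : (j == 0) = false by lia.
by rewrite !IH ?mulr0 ?subr0 ?addr0 ?mul0r//; lia.
Qed.

Lemma amp_sqr_supp l j : (l < `|j|)%N -> amp_sqr l j = 0.
Proof. by move=> lj; rewrite /amp_sqr amp_supp//= expr0n addr0. Qed.

(** Multiplication by [al + i be] is a rotation, so this is the convexity of the squared modulus. *)
Lemma amp_sqrS l j :
  amp_sqr l.+1 j <= (amp_sqr l (j + 1) + amp_sqr l (j - 1)) / 2.
Proof.
rewrite /amp_sqr /=; case: (amp l (j + 1)) => a b; case: (amp l (j - 1)) => c d /=.
have rot x y i : (al i * x - be i * y) ^+ 2 + (al i * y + be i * x) ^+ 2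
    = x ^+ 2 + y ^+ 2 by rewrite -[RHS]mul1r -(albe i); ring.
have <- := rot a b j; have <- := rot c d (j - 1).
set p := al j * a - be j * b; set q := al j * b + be j * a.
set p' := al (j - 1) * c - be (j - 1) * d; set q' := al (j - 1) * d + be (j - 1) * c.
have -> : al j * a - be j * b + al (j - 1) * c - be (j - 1) * d = p + p'.
  by rewrite /p /p'; ring.
have -> : al j * b + be j * a + al (j - 1) * d + be (j - 1) * c = q + q'.
  by rewrite /q /q'; ring.
have := sqr_ge0 (p - p'); have := sqr_ge0 (q - q'); nra.
Qed.

(* The operator is an l^2 contraction. *)
Lemma zsum_amp_sqr N l : (l < N)%N -> zsum N (amp_sqr l) <= 1.
Proof.
elim: l => [|l IH] lN.
  rewrite (eq_zsum _ (G := fun j => (j == 0)%:R * 1)) ?zsum_delta// => j.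
  by rewrite /amp_sqr /= expr0n addr0 mulr1; case: (j == 0); rewrite ?expr1n ?expr0n.
apply: le_trans (IH (ltnW lN)).
apply: (@le_trans _ _ (1 / 2 * zsum N (fun j => amp_sqr l (j + 1))
                      + 1 / 2 * zsum N (fun j => amp_sqr l (j - 1)))).
  by apply: ler_zsum_lincomb => j; have := amp_sqrS l j; lra.
rewrite zsum_shift ?amp_sqr_supp//; [|lia..].
have <- : zsum N (fun j => amp_sqr l (j + 1 - 1)) = zsum N (fun j => amp_sqr l (j - 1)).
  by rewrite (@zsum_shift _ N (fun j => amp_sqr l (j - 1))) ?amp_sqr_supp//; lia.
rewrite (eq_zsum _ (F := fun j => amp_sqr l (j + 1 - 1)) (G := amp_sqr l)).
  by lra.
by move=> j; rewrite addrK.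
Qed.

Lemma zsum_amp_dot N l n : (l < N)%N -> (n < N)%N ->
  - 1 <= zsum N (fun j => (amp l j).1 * (amp n j).1 + (amp l j).2 * (amp n j).2).
Proof.
move=> lN nN; have := zsum_amp_sqr lN; have := zsum_amp_sqr nN.
suff : zsum N (fun j => - ((amp l j).1 * (amp n j).1 + (amp l j).2 * (amp n j).2))
    <= 1 / 2 * zsum N (amp_sqr l) + 1 / 2 * zsum N (amp_sqr n).
  rewrite (eq_zsum _ (G := fun j => -1 *
    ((amp l j).1 * (amp n j).1 + (amp l j).2 * (amp n j).2))) ?zsumZ; first by lra.
  by move=> j; rewrite mulN1r.
apply: ler_zsum_lincomb => j; rewrite /amp_sqr.
have := sqr_ge0 ((amp l j).1 + (amp n j).1).
have := sqr_ge0 ((amp l j).2 + (amp n j).2); nra.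
Qed.

Lemma zsum_amp_test N n (F : int -> R) : (n < N)%N ->
  zsum N (fun j => F j * (amp n j).1) <= (zsum N (fun j => F j ^+ 2) + 1) / 2 /\
  zsum N (fun j => F j * (amp n j).2) <= (zsum N (fun j => F j ^+ 2) + 1) / 2.
Proof.
move=> nN; have := zsum_amp_sqr nN.
have H1 : zsum N (fun j => F j * (amp n j).1) <=
    1 / 2 * zsum N (fun j => F j ^+ 2) + 1 / 2 * zsum N (amp_sqr n).
  apply: ler_zsum_lincomb => j; rewrite /amp_sqr.
  have := sqr_ge0 (F j - (amp n j).1); have := sqr_ge0 (amp n j).2; nra.
have H2 : zsum N (fun j => F j * (amp n j).2) <=
    1 / 2 * zsum N (fun j => F j ^+ 2) + 1 / 2 * zsum N (amp_sqr n).
  apply: ler_zsum_lincomb => j; rewrite /amp_sqr.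
  have := sqr_ge0 (F j - (amp n j).2); have := sqr_ge0 (amp n j).1; nra.
by move=> ?; split; lra.
Qed.

Variables (r : R) (n : nat).
Hypotheses (r0 : 0 <= r) (r1 : r < 1) (rn : r ^+ n <= 1 - r).

Definition green_re j : R := \sum_(l < n) r ^+ l * (amp l j).1.
Definition green_im j : R := \sum_(l < n) r ^+ l * (amp l j).2.

(** [p + iq] is [delta_0 - r ^ n A ^ n delta_0], the image under [1 - r A] of the truncated
    series. *)
Let p j : R := (j == 0)%:R - r ^+ n * (amp n j).1.
Let q j : R := - (r ^+ n * (amp n j).2).

Lemma green_chain_eq : chain_eq r al be green_re green_im p q.
Proof.
rewrite /p /q /green_re /green_im; elim: n => [|m IH] j.
  by rewrite !big_ord0 /= expr0; split; ring.
have [h1 h2] := IH j; rewrite !big_ord_recr exprS /=; split.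
  by apply: (addrI ((j == 0)%:R - r ^+ m * (amp m j).1)); rewrite {1}h1; field.
by apply: (addrI (- (r ^+ m * (amp m j).2))); rewrite {1}h2; field.
Qed.

Lemma green_supp j : (n <= `|j|)%N -> green_re j = 0 /\ green_im j = 0.
Proof.
move=> nj; split; apply: big1 => l _; rewrite amp_supp ?mulr0//;
  exact: leq_trans (ltn_ord l) nj.
Qed.

Lemma al_norm_le1 j : `|al j| <= 1.
Proof.
have := albe j; have := sqr_ge0 (be j) => *.
by rewrite ler_norml; apply/andP; split; nra.
Qed.

Lemma sum_geometric_le : \sum_(l < n) r ^+ l <= (1 - r)^-1.
Proof.
have h : (1 - r) * \sum_(l < n) r ^+ l = 1 - r ^+ n.
  elim: n => [|m IH]; first by rewrite big_ord0; ring.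
  by rewrite big_ord_recr /= mulrDr IH exprS; ring.
rewrite -[leRHS]mul1r ler_pdivlMr; last by rewrite subr_gt0.
by rewrite mulrC h; have := exprn_ge0 n r0; lra.
Qed.

(** The truncation error pairs with the series to at most [r ^ n] times a geometric sum, hence to at
    most 1 by [r ^ n <= 1 - r]: this is the origin of the [+ 1]. *)
Lemma green_energy_le N : (n < N)%N ->
  zsum N (fun j => green_re j * p j + green_im j * q j) <= green_re 0 + 1.
Proof.
move=> nN; rewrite (eq_zsum _ (G := fun j => (j == 0)%:R * green_re j -
    r ^+ n * (green_re j * (amp n j).1 + green_im j * (amp n j).2))); last first.
  by move=> j; rewrite /p /q; ring.
rewrite zsumB zsum_delta ?(leq_ltn_trans _ nN)// zsumZ lerD2l.
rewrite (eq_zsum _ (G := fun j => \sum_(l < n) r ^+ l *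
    ((amp l j).1 * (amp n j).1 + (amp l j).2 * (amp n j).2))); last first.
  move=> j; rewrite /green_re /green_im !mulr_suml -big_split /=.
  by apply: eq_bigr => l _; ring.
rewrite (zsum_sum N n (fun l j => r ^+ l *
    ((amp l j).1 * (amp n j).1 + (amp l j).2 * (amp n j).2))) -mulrN -sumrN.
have rn0 := exprn_ge0 n r0.
apply: (@le_trans _ _ (r ^+ n * \sum_(l < n) r ^+ l)).
  apply: ler_wpM2l => //; apply: ler_sum => l _; rewrite zsumZ -mulrN.
  rewrite -[leRHS]mulr1; apply: ler_wpM2l; first exact: exprn_ge0.
  by have := zsum_amp_dot (ltn_trans (ltn_ord l) nN) nN; lra.
have s0 : 0 < 1 - r by rewrite subr_gt0.
apply: (@le_trans _ _ ((1 - r) * (1 - r)^-1)); last by rewrite divff ?gt_eqF.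
apply: ler_pM => //; last exact: sum_geometric_le.
by apply: sumr_ge0 => l _; exact: exprn_ge0.
Qed.

Lemma zsum_sqr_le N (F : int -> R) : F N%:Z = 0 -> F (- N%:Z) = 0 ->
  (1 - r) * zsum N (fun j => F j ^+ 2) <= zsum N (eform r al F F).
Proof.
move=> FN FNN; have h := @zsum_shift _ N (fun j => F j ^+ 2).
have : (1 - r) * (1 / 2 * zsum N (fun j => F j ^+ 2)
    + 1 / 2 * zsum N (fun j => F (j + 1) ^+ 2)) <= zsum N (eform r al F F).
  rewrite -!zsumZ -zsumD -zsumZ; apply: ler_zsum => j.
  by have := eform_ge r0 al_norm_le1 F j; lra.
by rewrite h ?FN ?FNN ?expr0n//; lra.
Qed.

Lemma green_upper N chi b : (n < N)%N -> (forall j, 1 / 4 <= r * al j) ->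
  chi N%:Z = 0 -> chi (- N%:Z) = 0 ->
  (forall j, r / 2 * (be (j - 1) * chi (j - 1) + be j * chi (j + 1)) =
     (j == 0)%:R + (b (j - 1) - b j)) ->
  green_re 0 <= 2 * zsum N (eform r al chi chi) + 8 * zsum N (fun j => b j ^+ 2) + 2.
Proof.
move=> nN ral cN cNN Hb.
have [uN vN] := @green_supp N%:Z (ltnW nN).
have [uNN vNN] : green_re (- N%:Z) = 0 /\ green_im (- N%:Z) = 0.
  by apply: green_supp; rewrite abszN (ltnW nN).
apply: (@chain_upper _ r al be N r0 r1 al_norm_le1 green_re green_im p q) => //.
- exact: leq_ltn_trans nN.
- exact: green_chain_eq.
- exact: green_energy_le.
(* Against [chi] the truncation error costs [r ^ n] times the squared norm of [chi], which the
   energy of [chi] dominates since it contains a mass term with factor [1 - r]. *)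
rewrite (eq_zsum _ (G := fun j => - r ^+ n * (chi j * (amp n j).2))); last first.
  by move=> j; rewrite /q; ring.
rewrite zsumZ mulNr opprK.
have rn0 := exprn_ge0 n r0.
have h1 := zsum_sqr_le cN cNN; have [_ h2] := zsum_amp_test chi nN.
have h3 : 0 <= zsum N (fun j => chi j ^+ 2) by apply: zsum_ge0 => j; exact: sqr_ge0.
have h4 : r ^+ n * zsum N (fun j => chi j * (amp n j).2) <=
  r ^+ n * ((zsum N (fun j => chi j ^+ 2) + 1) / 2) by exact: ler_wpM2l.
have h5 : r ^+ n * zsum N (fun j => chi j ^+ 2) <= (1 - r) * zsum N (fun j => chi j ^+ 2).
  by exact: ler_wpM2r.
by have := r0; have := rn; lra.
Qed.

Lemma green_upper_mass (kap : R) : (forall j, 1 / 4 <= r * al j) ->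
  0 < kap -> kap ^+ 2 = 1 - r -> green_re 0 <= 12 / kap.
Proof.
move=> ral k0 kr.
have [uN vN] := @green_supp n.+1%:Z (leqnSn n).
have [uNN vNN] := @green_supp (- n.+1%:Z) (leqnSn n).
apply: (@chain_upper_mass _ r al be n.+1 r0 r1 al_norm_le1 green_re green_im p q) => //.
- exact: green_chain_eq.
- exact: green_energy_le.
Qed.

(** The energy is nonnegative and exceeds [green_re 0] by at most 1. This covers the frequencies
    that have no better lower bound. *)
Lemma green_geN1 : -1 <= green_re 0.
Proof.
have [uN vN] := @green_supp n.+1%:Z (leqnSn n).
have [uNN vNN] := @green_supp (- n.+1%:Z) (leqnSn n).
have := chain_energy green_chain_eq uN uNN vN vNN.
have := green_energy_le (ltnSn n).
have : 0 <= zsum n.+1 (eform r al green_re green_re).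
  by apply: zsum_ge0 => j; exact: (eform_ge0 r0 r1 al_norm_le1).
have : 0 <= zsum n.+1 (eform r al green_im green_im).
  by apply: zsum_ge0 => j; exact: (eform_ge0 r0 r1 al_norm_le1).
by lra.
Qed.

Lemma green_lower N phi b rho (kap Z : R) : (n < N)%N ->
  r ^+ n <= (1 - r) / 8 ->
  (forall j, 1 / 4 <= r * al j) -> 0 < kap ->
  (forall j, kap <= 2 - r * al (j - 1) - r * al j) ->
  phi 0 = 1 -> phi N%:Z = 0 -> phi (- N%:Z) = 0 ->
  (forall j, r / 2 * (be (j - 1) * phi (j - 1) + be j * phi (j + 1)) =
     (b (j - 1) - b j) + rho j) ->
  0 < Z -> Z <= 1 ->
  zsum N (eform r al phi phi) / 2 + 8 * zsum N (fun j => b j ^+ 2)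
    + 2 / kap * zsum N (fun j => rho j ^+ 2) <= Z ->
  1 / (4 * Z) <= green_re 0 + 1.
Proof.
move=> nN rn8 ral k0 Hk p0 pN pNN Hb Z0 Z1 HZ.
have [uN vN] := @green_supp N%:Z (ltnW nN).
have [uNN vNN] : green_re (- N%:Z) = 0 /\ green_im (- N%:Z) = 0.
  by apply: green_supp; rewrite abszN (ltnW nN).
apply: (@chain_lower _ r al be N r0 r1 al_norm_le1 green_re green_im p q phi b rho kap) => //.
- exact: leq_ltn_trans nN.
- exact: green_chain_eq.
- exact: green_energy_le.
(* The sharper truncation [(1 - r) / 8] and [Z <= 1] keep the tested error below 1/4, hence the
   required 3/4. *)
rewrite (eq_zsum _ (G := fun j => (j == 0)%:R * phi j - r ^+ n * (phi j * (amp n j).1)));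
  last by move=> j; rewrite /p; ring.
rewrite zsumB zsum_delta ?(leq_ltn_trans _ nN)// zsumZ p0.
have rn0 := exprn_ge0 n r0.
have h1 := zsum_sqr_le pN pNN; have [h2 _] := zsum_amp_test phi nN.
have h3 : 0 <= zsum N (fun j => phi j ^+ 2) by apply: zsum_ge0 => j; exact: sqr_ge0.
have h4 : r ^+ n * zsum N (fun j => phi j * (amp n j).1) <=
  r ^+ n * ((zsum N (fun j => phi j ^+ 2) + 1) / 2) by exact: ler_wpM2l.
have h5 : r ^+ n * zsum N (fun j => phi j ^+ 2) <=
  (1 - r) / 8 * zsum N (fun j => phi j ^+ 2) by exact: ler_wpM2r.
have h6 : 0 <= zsum N (fun j => b j ^+ 2) by apply: zsum_ge0 => j; exact: sqr_ge0.
have h7 : 0 <= 2 / kap * zsum N (fun j => rho j ^+ 2).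
  by rewrite mulr_ge0 ?divr_ge0 ?(ltW k0)//; apply: zsum_ge0 => j; exact: sqr_ge0.
by have := r0; lra.
Qed.

End Amplitudes.

(** * Sine and cosine at small angles *)

Section Trigonometry.
Context {R : realType}.
Implicit Types x t : R.

Lemma sin_le_id x : 0 <= x -> sin x <= x.
Proof.
move=> x0; have [c _ h] := @MVT_segment R sin cos 0 x x0
  (fun y _ => is_derive_sin y) (continuous_subspaceT (@continuous_sin R)).
by move: h; rewrite sin0 !subr0 => ->; rewrite -[leRHS]mul1r ler_wpM2r ?cos_le1.
Qed.

Lemma cos_double_half x : cos x = 1 - 2 * sin (x / 2) ^+ 2.
Proof.
have -> : cos x = cos (x / 2 *+ 2) by congr cos; rewrite -mulr_natr; field.
by rewrite cos_mulr2n cos2sin2 -mulr_natr; ring.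
Qed.

Lemma cos_ge_quadratic x : 0 <= x -> 1 - x ^+ 2 / 2 <= cos x.
Proof.
move=> x0; rewrite cos_double_half.
have h : `|sin (x / 2)| <= x / 2.
  rewrite ler_norml; apply/andP; split; last by apply: sin_le_id; lra.
  rewrite lerNl -sinN; have [x4|x4] := lerP x 2; last first.
    by apply: le_trans (sin_le1 _) _; lra.
  have : 0 <= sin (x / 2).
    have [->|xn0] := eqVneq x 0; first by rewrite mul0r sin0.
    by apply/ltW/sin2_gt0; rewrite divr_gt0 ?lt_neqAle 1?eq_sym ?xn0//=; lra.
  by rewrite sinN; lra.
have : sin (x / 2) ^+ 2 <= (x / 2) ^+ 2.
  by rewrite -real_normK ?num_real// ler_pXn2r ?nnegrE//; lra.
lra.
Qed.

Lemma cos_ge_half x : 0 <= x <= 1 -> 1 / 2 <= cos x.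
Proof. by move=> /andP[x0 x1]; have := cos_ge_quadratic x0; nra. Qed.

Lemma sin_ge_half x : 0 <= x <= 1 -> x / 2 <= sin x.
Proof.
move=> /andP[x0 x1]; have [c] := @MVT_segment R sin cos 0 x x0
  (fun y _ => is_derive_sin y) (continuous_subspaceT (@continuous_sin R)).
rewrite in_itv /= => /andP[c0 cx]; rewrite sin0 !subr0 => ->.
rewrite mulrC ler_wpM2r//; have := @cos_ge_half c; rewrite c0 (le_trans cx x1).
by move=> /(_ isT); lra.
Qed.

Lemma cos_le_quadratic t : 0 <= t <= 1 -> cos t <= 1 - t ^+ 2 / 8.
Proof.
move=> /andP[t0 t1]; rewrite cos_double_half.
have : t / 2 / 2 <= sin (t / 2) by apply: sin_ge_half; lra.
nra.
Qed.

End Trigonometry.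

(** * Upper bound by a tent function *)

Section EdgePhases.
Context {R : realType}.
Variable (dir : int -> R).
Hypothesis dir_sign : forall y, dir y = -1 \/ dir y = 1.

(* Site 2y + [x + y odd] of the line encodes a vertex (x, y): the walk crosses
   edge 2y when it moves along line y, and an odd edge when it moves
   vertically. *)
Definition theta (j : int) : R := if (2 %| j)%Z then dir (j %/ 2)%Z else 0.

Lemma theta_even (y : nat) : theta y.*2%:Z = dir y%:Z.
Proof.
rewrite /theta; have -> : (2 %| y.*2%:Z)%Z by lia.
by congr dir; lia.
Qed.

Lemma theta_odd (y : nat) : theta y.*2.+1%:Z = 0.
Proof. by rewrite /theta; have -> : (2 %| y.*2.+1%:Z)%Z = false by lia. Qed.

Lemma theta_cases j :
  [\/ theta j = -1, theta j = 0 | theta j = 1].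
Proof.
rewrite /theta; case: ifP => _; last exact: Or32.
by case: (dir_sign (j %/ 2)%Z) => ->; [exact: Or31|exact: Or33].
Qed.

(** Horizontal and vertical edges alternate along the chain. *)
Lemma theta_sqr_alternate j : theta (j - 1) ^+ 2 + theta j ^+ 2 = 1.
Proof.
rewrite /theta; have -> : (2 %| j - 1)%Z = ~~ (2 %| j)%Z by lia.
case: (2 %| j)%Z => /=.
  by case: (dir_sign (j %/ 2)%Z) => ->; ring.
by case: (dir_sign ((j - 1) %/ 2)%Z) => ->; ring.
Qed.

Variable t : R.

Definition alt j : R := cos (t * theta j).
Definition bet j : R := sin (t * theta j).

Lemma alt_bet j : alt j ^+ 2 + bet j ^+ 2 = 1.
Proof. exact: cos2Dsin2. Qed.

Lemma betE j : bet j = sin t * theta j.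
Proof.
rewrite /bet; case: (theta_cases j) => ->; last by rewrite !mulr1.
  by rewrite !mulrN1 sinN.
by rewrite !mulr0 sin0.
Qed.

Lemma altE j : alt j = 1 - theta j ^+ 2 * (1 - cos t).
Proof.
rewrite /alt; case: (theta_cases j) => ->.
- by rewrite mulrN1 cosN; ring.
- by rewrite mulr0 cos0; ring.
- by rewrite mulr1; ring.
Qed.

Lemma alt_ge_cos j : cos t <= alt j.
Proof. by rewrite altE; case: (theta_cases j) => ->; have := cos_le1 t; lra. Qed.

(** [1 - r * alt j] is at most [(1 - r) + (1 - cos t)], and both parts are of order [t ^+ 2] under
    the hypothesis on the damping. *)
Lemma eform_le (r : R) (phi : int -> R) j : 0 < t <= 1 -> 1 / 2 <= r < 1 ->
  1 - r <= t ^+ 2 ->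
  eform r alt phi phi j <= (phi (j + 1) - phi j) ^+ 2 / 2
     + t ^+ 2 * (phi j ^+ 2 + phi (j + 1) ^+ 2).
Proof.
move=> /andP[t0 t1] /andP[r0 r1] rt; rewrite /eform.
have h1 := alt_ge_cos j; have h2 := cos_ge_quadratic (ltW t0).
have h3 : alt j <= 1 by exact: cos_le1.
have h4 := sqr_ge0 t.
have h5 : 1 - r * alt j <= 2 * t ^+ 2 by nra.
have h6 : r * alt j <= 1 by nra.
set x := phi j; set y := phi (j + 1); set a := r * alt j in h5 h6 *.
have : 0 <= (1 - a) * (y - x) ^+ 2 by rewrite mulr_ge0 ?sqr_ge0// subr_ge0.
have : 0 <= (2 * t ^+ 2 - (1 - a)) * (x ^+ 2 + y ^+ 2).
  by apply: mulr_ge0; [rewrite subr_ge0|rewrite addr_ge0 ?sqr_ge0].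
nra.
Qed.

Lemma alt_ge_quarter (r : R) j : 0 <= t <= 1 -> 1 / 2 <= r -> 1 / 4 <= r * alt j.
Proof. by move=> /cos_ge_half h hr; have := alt_ge_cos j; nra. Qed.

End EdgePhases.

Section NatIntFacts.

Lemma parityP k : exists y, k = y.*2 \/ k = y.*2.+1.
Proof.
by have := odd_double_half k; case: (odd k) => h; exists k./2; [right|left];
  rewrite -{1}h.
Qed.

Lemma half_double0 y : (y.*2)./2 = y. Proof. exact: doubleK. Qed.
Lemma half_double1 y : (y.*2.+1)./2 = y. Proof. exact: uphalf_double. Qed.
Lemma half_double2 y : (y.*2.+2)./2 = y.+1. Proof. by rewrite -doubleS doubleK. Qed.
Lemma half_double3 y : (y.*2.+3)./2 = y.+1. Proof. by rewrite -doubleS half_double1. Qed.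

Lemma half_step k : k.+1./2 = k./2 \/ k.+1./2 = (k./2).+1.
Proof. by lia. Qed.

Lemma half_ge m k : (m.*2 <= k)%N -> (m <= k./2)%N.
Proof. by lia. Qed.

Lemma PoszS (k : nat) : k%:Z + 1 = k.+1%:Z. Proof. by lia. Qed.
Lemma PoszSB (k : nat) : k.+1%:Z - 1 = k%:Z. Proof. by lia. Qed.
Lemma NegzB (k : nat) : Negz k - 1 = Negz k.+1. Proof. by lia. Qed.
Lemma NegzS (k : nat) : Negz k.+1 + 1 = Negz k. Proof. by lia. Qed.
Lemma Negz0S : Negz 0 + 1 = 0%:Z. Proof. by []. Qed.

End NatIntFacts.

Section TentUpperBound.
Context {R : realType}.
Variable (dir : int -> R).
Hypothesis dir_sign : forall y, dir y = -1 \/ dir y = 1.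
Variable L : nat.

(** Subtraction truncates, so the tent vanishes from [L] on as well as at 0. *)
Definition tent (y : nat) : R := (minn y (L - y))%:R.
Definition tent_sum (k : nat) : R := \sum_(i < k) tent i * dir i%:Z.

Lemma tent0 : tent 0 = 0. Proof. by rewrite /tent min0n. Qed.

Lemma tent_ge_L y : (L <= y)%N -> tent y = 0.
Proof. by rewrite /tent -subn_eq0 => /eqP ->; rewrite minn0. Qed.

Lemma tent_ge0 y : 0 <= tent y. Proof. exact: ler0n. Qed.

Lemma tent_le y : tent y <= L%:R.
Proof. by rewrite ler_nat geq_min leq_subr orbT. Qed.

Lemma tentS y : `|tent y.+1 - tent y| <= 1.
Proof.
have h1 : tent y <= tent y.+1 + 1 by rewrite /tent natr1 ler_nat; lia.
have h2 : tent y.+1 <= tent y + 1 by rewrite /tent natr1 ler_nat; lia.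
by rewrite ler_norml; apply/andP; split; lra.
Qed.

Lemma tent_sumS k : tent_sum k.+1 = tent_sum k + tent k * dir k%:Z.
Proof. by rewrite /tent_sum big_ord_recr. Qed.

Lemma tent_sum_ge k : (L <= k)%N -> tent_sum k = tent_sum L.
Proof.
elim: k => [|k IH]; first by rewrite leqn0 => /eqP ->.
rewrite leq_eqVlt => /orP[/eqP ->//|Lk].
by rewrite tent_sumS tent_ge_L// mul0r addr0 IH.
Qed.

(** A line carries two sites, so each [F y] is met at most four times. *)
Lemma sum_half_le (F : nat -> R) (m : nat) : (forall k, 0 <= F k) ->
  \sum_(k < m.*2) (F k.+1./2 + F k.+2./2) <= 4 * \sum_(y < m.+1) F y.
Proof.
move=> F0.
suff : \sum_(k < m.*2) (F k.+1./2 + F k.+2./2) <= 4 * \sum_(y < m.+1) F y - F m.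
  by have := F0 m; lra.
elim: m => [|m IH].
  by rewrite double0 big_ord0 big_ord_recr big_ord0 /=; have := F0 0%N; lra.
rewrite doubleS !big_ord_recr /= in IH *.
have -> : uphalf m.*2 = m by lia.
have -> : (m.*2)./2 = m by lia.
by have := F0 m; have := F0 m.+1; lra.
Qed.

Lemma green_tent_upper (t r : R) n : (0 < L)%N -> 0 < t <= 1 -> 1 / 2 <= r < 1 ->
  1 - r <= t ^+ 2 -> r ^+ n <= 1 - r -> tent_sum L != 0 ->
  green_re (alt dir t) (bet dir t) r n 0 <=
  2 + 32 * L%:R + (96 * L%:R / t ^+ 2 + 384 * L%:R ^+ 3
    + 32 * \sum_(y < L.+1) tent_sum y ^+ 2) / tent_sum L ^+ 2.
Proof.
move=> L0 t01 r01 rt rn m0.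
have /andP[t0 t1] := t01; have /andP[r0 r1] := r01.
set S := tent_sum L in m0 *.
have st0 : t / 2 <= sin t by apply: sin_ge_half; rewrite ltW.
(* Each of the two sites of line [y] receives the coupling coefficient [tent y * dir y / (2 S)];
   with this normalisation they sum to 1. *)
pose D := r * sin t * S.
have D0 : D != 0 by rewrite !mulf_neq0// gt_eqF//; lra.
pose chi (j : int) := if j is Posz k then tent k./2 / D else 0.
(* [b j] is the part of that total lying beyond site [j]. It jumps at site 0 to account for the
   point mass and vanishes from [2 L] on. *)
pose b (j : int) : R := if j is Posz k then
  1 - (tent_sum k.+1./2 + tent_sum k.+2./2) / (2 * S) else 0.
pose N := (n + L.*2).+1.
have nN : (n < N)%N by rewrite ltnS leq_addr.
have r0' : 0 <= r by lra.
have ral j : 1 / 4 <= r * alt dir t j by apply: alt_ge_quarter => //; rewrite ltW.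
have cN : chi N%:Z = 0.
  by rewrite /chi /N tent_ge_L ?mul0r// half_ge// leqW// leq_addl.
have Hb j : r / 2 * (bet dir t (j - 1) * chi (j - 1) + bet dir t j * chi (j + 1)) =
     (j == 0)%:R + (b (j - 1) - b j).
  rewrite !betE//; case: j => [[|k]|k].
  - rewrite add0r /b /chi /= /tent_sum !big_ord0 big_ord_recr big_ord0 /=.
    by rewrite tent0; ring.
  - rewrite PoszSB PoszS.
    have [y [->|->]] := parityP k.
    + rewrite theta_even theta_odd /b /chi.
      rewrite half_double0 half_double1 half_double2 half_double3 tent_sumS /= /D; field.
      by rewrite m0 /= !gt_eqF//; lra.
    + rewrite theta_odd -doubleS theta_even /b /chi.
      rewrite ?(half_double1, half_double2, half_double3) (tent_sumS y.+1) /= /D; field.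
      by rewrite m0 /= !gt_eqF//; lra.
  - rewrite NegzB; have h : chi (Negz k + 1) = 0.
      case: k => [|k]; first by rewrite /chi /= tent0 mul0r.
      by rewrite NegzS.
    by rewrite h /chi /b /=; ring.
have := @green_upper _ (alt dir t) (bet dir t) (alt_bet _ _) r n r0' r1 rn N chi b
  nN ral cN _ Hb.
have -> : chi (- N%:Z) = 0 by rewrite /chi /N.
move=> /(_ erefl) H.
have S2 : 0 < S ^+ 2 by rewrite exprn_even_gt0.
have D2 : t ^+ 2 * S ^+ 2 / 16 <= D ^+ 2.
  rewrite /D exprMn.
  have : t / 4 <= r * sin t by nra.
  move=> h; have : (t / 4) ^+ 2 <= (r * sin t) ^+ 2 by rewrite ler_pXn2r ?nnegrE//; lra.
  by move=> h'; have := ler_wpM2r (ltW S2) h'; lra.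
have D2_gt0 : 0 < D ^+ 2 by rewrite exprn_even_gt0.
have H1 : zsum N (eform r (alt dir t) chi chi) <=
    (1 / 2 + 2 * t ^+ 2 * L%:R ^+ 2) / D ^+ 2 * L.*2.+1.*2%:R.
  have c0 : 0 <= (1 / 2 + 2 * t ^+ 2 * L%:R ^+ 2) / D ^+ 2.
    by rewrite divr_ge0 ?ltW// addr_gt0// ?mulr_gt0 ?exprn_gt0 ?ltr0n.
  have step k : `|tent k.+1./2 - tent k./2| <= 1.
    have [->|->] := half_step k.
      by rewrite subrr normr0.
    exact: tentS.
  apply: zsum_le_supp => // j.
    apply: le_trans (eform_le dir_sign chi j t01 r01 rt) _.
    rewrite ler_pdivlMr//; case: j => [k|[|k]].
    - rewrite PoszS /chi; set x := tent k./2; set y := tent k.+1./2.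
      have -> : ((y / D - x / D) ^+ 2 / 2 + t ^+ 2 * ((x / D) ^+ 2 + (y / D) ^+ 2))
        * D ^+ 2 = (y - x) ^+ 2 / 2 + t ^+ 2 * (x ^+ 2 + y ^+ 2) by field.
      have := step k; rewrite -/x -/y ler_norml => /andP[h1 h2].
      have x2 : x ^+ 2 <= L%:R ^+ 2 by rewrite ler_pXn2r ?nnegrE ?tent_le ?ler0n.
      have y2 : y ^+ 2 <= L%:R ^+ 2 by rewrite ler_pXn2r ?nnegrE ?tent_le ?ler0n.
      have xy : (y - x) ^+ 2 <= 1 by nra.
      by have := sqr_ge0 t => ?; nra.
    - rewrite Negz0S /chi /= tent0; have := sqr_ge0 t; have := sqr_ge0 (L%:R : R) => *.
      rewrite mul0r subr0 expr0n /= mul0r addr0 mulr0 add0r mul0r; nra.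
    - rewrite NegzS /chi; have := sqr_ge0 t; have := sqr_ge0 (L%:R : R) => *.
      rewrite subr0 expr0n /= mul0r addr0 mulr0 add0r mul0r; nra.
  move=> Lj; apply: le_trans (eform_le dir_sign chi j t01 r01 rt) _.
  have [-> ->] : chi j = 0 /\ chi (j + 1) = 0.
    case: j Lj => [k|[|k]] Lk.
    - have Lk2 : (L <= k./2)%N by apply: half_ge; exact: ltnW.
      have Lk3 : (L <= k.+1./2)%N by apply: half_ge; exact/leqW/ltnW.
      by rewrite PoszS /chi !tent_ge_L ?mul0r.
    - by rewrite Negz0S /chi /= tent0 mul0r.
    by rewrite NegzS.
  by rewrite subr0 expr0n /= mul0r addr0 mulr0 addr0.
have H2 : zsum N (fun j => b j ^+ 2) <=
    4 * L%:R + 4 * (\sum_(y < L.+1) tent_sum y ^+ 2) / S ^+ 2.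
  rewrite /zsum (eq_bigr (fun k : 'I_N => b (k : nat)%:Z ^+ 2)); last first.
    by move=> k _; rewrite /b /= expr0n addr0.
  rewrite -(big_mkord xpredT (fun k : nat => b k%:Z ^+ 2)).
  rewrite (big_cat_nat (n := L.*2)) //=; last by rewrite leqW ?leq_addl.
  rewrite [X in _ + X]big1_seq ?addr0; last first.
    move=> k /=; rewrite mem_index_iota => /andP[Lk _].
    have Lk1 : (L <= k.+1./2)%N by apply: half_ge; exact: leqW.
    have Lk2 : (L <= (k./2).+1)%N by apply/leqW/half_ge.
    rewrite (tent_sum_ge Lk1) (tent_sum_ge Lk2).
    have -> : 1 - (tent_sum L + tent_sum L) / (2 * S) = 0 by rewrite -/S; field.
    by rewrite expr0n.
  rewrite big_mkord.
  apply: (@le_trans _ _ (\sum_(k < L.*2) (2 + (tent_sum k.+1./2 ^+ 2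
      + tent_sum k.+2./2 ^+ 2) / S ^+ 2))).
    apply: ler_sum => k _; set x := tent_sum _; set y := tent_sum _.
    have -> : (x ^+ 2 + y ^+ 2) / S ^+ 2 = (x / S) ^+ 2 + (y / S) ^+ 2 by field.
    have -> : (x + y) / (2 * S) = (x / S + y / S) / 2 by field.
    have := sqr_ge0 (x / S - y / S); have := sqr_ge0 (1 + (x / S + y / S) / 2); nra.
  rewrite big_split /= -mulr_suml.
  have -> : \sum_(k < L.*2) 2 = 4 * L%:R :> R.
    by rewrite sumr_const card_ord -[LHS]mulr_natr -muln2 natrM; ring.
  have := @sum_half_le (fun k => tent_sum k ^+ 2) L (fun k => sqr_ge0 _).
  rewrite -(ler_pM2r (x := (S ^+ 2)^-1)) ?invr_gt0//; lra.
apply: le_trans H _.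
have H3 : (1 / 2 + 2 * t ^+ 2 * L%:R ^+ 2) / D ^+ 2 * L.*2.+1.*2%:R <=
   (48 * L%:R / t ^+ 2 + 192 * L%:R ^+ 3) / S ^+ 2.
  have t2 : 0 < t ^+ 2 by rewrite exprn_gt0.
  have L1 : 1 <= L%:R :> R by rewrite ler1n.
  have hL : L.*2.+1.*2%:R <= 6 * L%:R :> R.
    by rewrite -natrM ler_nat -!muln2; clear -L0; lia.
  apply: (@le_trans _ _ ((1 / 2 + 2 * t ^+ 2 * L%:R ^+ 2) / D ^+ 2 * (6 * L%:R))).
    by rewrite ler_wpM2l// divr_ge0 ?ltW// addr_gt0// ?mulr_gt0 ?exprn_gt0 ?ltr0n.
  have -> : (48 * L%:R / t ^+ 2 + 192 * L%:R ^+ 3) / S ^+ 2 =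
    (1 / 2 + 2 * t ^+ 2 * L%:R ^+ 2) * (t ^+ 2 * S ^+ 2 / 16)^-1 * (6 * L%:R).
    by field; rewrite m0 (gt_eqF t0).
  apply: ler_wpM2r; first by rewrite mulr_ge0.
  apply: ler_wpM2l; first by rewrite ltW// addr_gt0// ?mulr_gt0 ?exprn_gt0 ?ltr0n.
  have ? : 0 < t ^+ 2 * S ^+ 2 / 16 by rewrite divr_gt0// mulr_gt0.
  by rewrite lef_pV2 ?posrE.
have -> : (96 * L%:R / t ^+ 2 + 384 * L%:R ^+ 3 +
   32 * \sum_(y < L.+1) tent_sum y ^+ 2) / S ^+ 2 =
   2 * ((48 * L%:R / t ^+ 2 + 192 * L%:R ^+ 3) / S ^+ 2) +
   8 * (4 * (\sum_(y < L.+1) tent_sum y ^+ 2) / S ^+ 2) by field; rewrite m0 (gt_eqF t0).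
lra.
Qed.

End TentUpperBound.

(** * Lower bound for a bounded potential *)

Section BoundedPotential.
Context {R : realType}.
Variable (dir V : int -> R) (B : R).
Hypothesis dir_sign : forall y, dir y = -1 \/ dir y = 1.
Hypothesis Vdir : forall y, V (y + 1) - V y = dir y.
Hypothesis VB : forall y, `|V y| <= B.

(** An antiderivative of [theta] along the chain, constant across vertical edges. *)
Definition site_potential (j : int) : R := V ((j + 1) %/ 2)%Z.

Lemma site_potentialS j : site_potential (j + 1) - site_potential j = theta dir j.
Proof.
rewrite /site_potential /theta; case: ifP => j2.
  have -> : ((j + 1 + 1) %/ 2)%Z = (j %/ 2)%Z + 1 by lia.
  have -> : ((j + 1) %/ 2)%Z = (j %/ 2)%Z by lia.
  exact: Vdir.
have -> : ((j + 1 + 1) %/ 2)%Z = ((j + 1) %/ 2)%Z by lia.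
exact: subrr.
Qed.

Definition hat (L : nat) (j : int) : R := (L - `|j|)%:R / L%:R.

Lemma hat_step L j : (0 < L)%N -> `|hat L (j + 1) - hat L j| <= L%:R^-1.
Proof.
move=> L0; rewrite /hat -mulrBl normrM (@ger0_norm _ L%:R^-1) ?invr_ge0//.
rewrite -[leRHS]mul1r ler_wpM2r ?invr_ge0//.
have h1 : (L - `|j|)%:R <= (L - `|(j + 1)%R|)%:R + 1 :> R by rewrite natr1 ler_nat; lia.
have h2 : (L - `|(j + 1)%R|)%:R <= (L - `|j|)%:R + 1 :> R by rewrite natr1 ler_nat; lia.
by rewrite ler_norml; apply/andP; split; lra.
Qed.

Lemma hat_ge0 L j : 0 <= hat L j. Proof. by rewrite divr_ge0. Qed.

Lemma hat_le1 L j : (0 < L)%N -> hat L j <= 1.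
Proof.
by move=> L0; rewrite ler_pdivrMr ?ltr0n// mul1r ler_nat leq_subr.
Qed.

Lemma hat_supp L (j : int) : (L <= `|j|)%N -> hat L j = 0.
Proof. by rewrite /hat -subn_eq0 => /eqP ->; rewrite mul0r. Qed.

Lemma hat_suppS L (j : int) : (L < `|j|)%N ->
  [/\ hat L (j - 1) = 0, hat L j = 0 & hat L (j + 1) = 0].
Proof. by move=> Lj; split; apply: hat_supp; lia. Qed.

Lemma hat0 L : (0 < L)%N -> hat L 0 = 1.
Proof. by move=> L0; rewrite /hat subn0 divff// pnatr_eq0 -lt0n. Qed.

Lemma inv_nat_approx (t : R) : 0 < t <= 1 ->
  exists L : nat, [/\ (0 < L)%N, L%:R^-1 <= t & L.+1%:R <= 3 / t].
Proof.
move=> /andP[t0 t1]; have ti0 : 0 <= t^-1 by rewrite invr_ge0 ltW.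
exists (Num.truncn t^-1).+1; have := truncn_itv ti0 => /andP[h1 h2]; split => //.
  by rewrite -[leRHS]invrK lef_pV2 ?posrE ?invr_gt0 ?ltr0n// ltW.
have ti1 : 1 <= t^-1 by rewrite invf_ge1.
by rewrite -addn2 natrD; lra.
Qed.

(** As [theta] is the increment of a bounded function, the coupling sums by parts into a gradient
    part [b] of size [t B] and a remainder [rho] of size [t ^+ 2 B], the hat having slope at most
    [t]. Both live on about [1 / t] sites, and dividing the cost of [rho] by the mass [t ^+ 2 / 8]
    still leaves order [B ^+ 2 * t]. The costs 15/2, 48 and 96 add up to at most 152. *)
Lemma green_hat_lower (t r : R) n : 0 < t <= 1 -> 1 / 2 <= r < 1 ->
  1 - r <= t ^+ 2 -> r ^+ n <= (1 - r) / 8 -> 1 <= B -> 152 * B ^+ 2 * t <= 1 ->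
  1 / (4 * (152 * B ^+ 2 * t)) <= green_re (alt dir t) (bet dir t) r n 0 + 1.
Proof.
move=> t01 r01 rt rn B1 Z1.
have /andP[t0 t1] := t01; have /andP[r0 r1] := r01.
have [L [L0 Lt Lt3]] := inv_nat_approx t01.
have r0' : 0 <= r by lra.
have rn1 : r ^+ n <= 1 - r by lra.
have ral j : 1 / 4 <= r * alt dir t j by apply: alt_ge_quarter => //; rewrite ltW.
have st : 0 <= sin t <= t.
  apply/andP; split; last by apply: sin_le_id; exact: ltW.
  by have := @sin_ge_half R t; rewrite ltW// t1 => /(_ isT); lra.
pose W := site_potential; pose phi := hat L.
have WB j : `|W j| <= B by exact: VB.
pose b j := - (r / 2 * sin t * (W (j + 1) * phi (j + 1) + W j * phi j)).
pose rho j := - (r / 2 * sin t * W j * (phi (j + 1) - phi (j - 1))).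
pose N := (n + L.+1).+1.
have nN : (n < N)%N by rewrite ltnS leq_addr.
have LN : (L <= N)%N by rewrite /N addnS; apply/leqW/leqW/leq_addl.
have kap0 : 0 < t ^+ 2 / 8 by rewrite divr_gt0 ?exprn_gt0.
(* One of the two edges at a site is horizontal, and its weight [cos t] already provides this
   mass. *)
have Hk j : t ^+ 2 / 8 <= 2 - r * alt dir t (j - 1) - r * alt dir t j.
  have h := theta_sqr_alternate dir_sign j; rewrite !altE//.
  have := @cos_le_quadratic R t; rewrite ltW// t1 => /(_ isT) h2.
  have h3 : 0 <= cos t by have := @cos_ge_half R t; rewrite ltW// t1 => /(_ isT); lra.
  set x := theta dir (j - 1) ^+ 2 in h *; set y := theta dir j ^+ 2 in h *.
  have -> : y = 1 - x by lra.
  have -> : 2 - r * (1 - x * (1 - cos t)) - r * (1 - (1 - x) * (1 - cos t)) =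
    (1 - r) * (1 + cos t) + (1 - cos t) by ring.
  have : 0 <= (1 - r) * (1 + cos t) by apply: mulr_ge0; lra.
  by lra.
have Hb j : r / 2 * (bet dir t (j - 1) * phi (j - 1) + bet dir t j * phi (j + 1)) =
     (b (j - 1) - b j) + rho j.
  rewrite !betE// -!site_potentialS /b /rho /W !subrK; ring.
have B0 : 0 < B by lra.
have Z0 : 0 < 152 * B ^+ 2 * t by rewrite !mulr_gt0.
have pstep j : `|phi (j + 1) - phi j| <= t.
  exact: le_trans (hat_step j L0) Lt.
have small x : `|x| <= t -> x ^+ 2 <= t ^+ 2.
  by rewrite ler_norml => /andP[*]; nra.
have cnt (c : R) : 0 <= c -> c * L.+1.*2%:R <= 6 * c / t.
  move=> c0; rewrite -muln2 natrM mulrA (mulrC _ 2) mulrA.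
  have -> : 6 * c / t = 2 * c * (3 / t) by ring.
  by rewrite ler_wpM2l// mulr_ge0.
have H1 : zsum N (eform r (alt dir t) phi phi) <= 15 * t.
  have c0 : 0 <= 5 / 2 * t ^+ 2 by rewrite mulr_ge0// sqr_ge0.
  have -> : 15 * t = 6 * (5 / 2 * t ^+ 2) / t by field; rewrite gt_eqF.
  apply: le_trans (cnt _ c0); apply: zsum_le_supp => // j.
    apply: le_trans (eform_le dir_sign phi j t01 r01 rt) _.
    have := small _ (pstep j).
    have := hat_ge0 L j; have := hat_le1 j L0; rewrite -/(phi j).
    have := hat_ge0 L (j + 1); have := hat_le1 (j + 1) L0; rewrite -/(phi (j + 1)).
    set x := phi j; set y := phi (j + 1) => y1 y0 x1 x0 h.
    have : x ^+ 2 <= 1 by nra.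
    have : y ^+ 2 <= 1 by nra.
    by have := sqr_ge0 t; nra.
  move=> Lj; apply: le_trans (eform_le dir_sign phi j t01 r01 rt) _.
  have [_ h1 h2] := hat_suppS Lj; rewrite /phi h1 h2.
  by rewrite subr0 expr0n /= mul0r addr0 mulr0 addr0.
have sqr_small x (c : R) : `|x| <= c -> x ^+ 2 <= c ^+ 2.
  by rewrite ler_norml => /andP[*]; nra.
have H2 : zsum N (fun j => b j ^+ 2) <= 6 * B ^+ 2 * t.
  have c0 : 0 <= (t * B) ^+ 2 by rewrite sqr_ge0.
  have -> : 6 * B ^+ 2 * t = 6 * (t * B) ^+ 2 / t by field; rewrite gt_eqF.
  apply: le_trans (cnt _ c0); apply: zsum_le_supp => // j.
    apply: sqr_small; rewrite /b normrN normrM.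
    have Wphi i : `|W i * phi i| <= B.
      rewrite normrM (ger0_norm (hat_ge0 L i)) -[leRHS]mulr1.
      by apply: ler_pM => //; [exact: hat_ge0|exact: hat_le1].
    have hrs : `|r / 2 * sin t| <= t / 2.
      by rewrite ger0_norm; [nra|rewrite mulr_ge0//; lra].
    have -> : t * B = t / 2 * (B + B) by field.
    apply: ler_pM => //; apply: le_trans (ler_normD _ _) _; exact: lerD.
  move=> Lj; have [_ h1 h2] := hat_suppS Lj.
  by rewrite /b /phi h1 h2 !mulr0 addr0 mulr0 oppr0 expr0n.
have H3 : zsum N (fun j => rho j ^+ 2) <= 6 * B ^+ 2 * t ^+ 3.
  have c0 : 0 <= (t ^+ 2 * B) ^+ 2 by rewrite sqr_ge0.
  have -> : 6 * B ^+ 2 * t ^+ 3 = 6 * (t ^+ 2 * B) ^+ 2 / t by field; rewrite gt_eqF.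
  apply: le_trans (cnt _ c0); apply: zsum_le_supp => // j.
    apply: sqr_small; rewrite /rho normrN.
    have -> : t ^+ 2 * B = (t / 2) * B * (t + t) by field.
    have hrs : `|r / 2 * sin t| <= t / 2.
      by rewrite ger0_norm; [nra|rewrite mulr_ge0//; lra].
    rewrite (normrM _ (_ - _)) (normrM _ (W j)).
    apply: ler_pM; rewrite ?mulr_ge0//; first exact: ler_pM.
    have -> : phi (j + 1) - phi (j - 1) =
      (phi (j + 1) - phi j) + (phi (j - 1 + 1) - phi (j - 1)) by rewrite subrK; ring.
    apply: le_trans (ler_normD _ _) _; exact: lerD.
  move=> Lj; have [h0 _ h2] := hat_suppS Lj.
  by rewrite /rho /phi h0 h2 subrr mulr0 oppr0 expr0n.
apply: (@green_lower _ (alt dir t) (bet dir t) (alt_bet _ _) r n r0' r1 rn1 N phi b rho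
  (t ^+ 2 / 8)) => //.
- exact: hat0.
- exact: hat_supp.
- by apply: hat_supp; rewrite abszN.
have H3' : 2 / (t ^+ 2 / 8) * zsum N (fun j => rho j ^+ 2) <= 96 * B ^+ 2 * t.
  have -> : 96 * B ^+ 2 * t = 2 / (t ^+ 2 / 8) * (6 * B ^+ 2 * t ^+ 3).
    by field; rewrite gt_eqF.
  by rewrite ler_wpM2l// divr_ge0// ltW.
have : t <= B ^+ 2 * t by rewrite ler_peMl ?(ltW t0)// expr_ge1//; lra.
by lra.
Qed.

End BoundedPotential.

(** * From the lattice to the chain *)

Section Expectation.
Context {R : realType}.
Variable (dir : int -> R).
Hypothesis dir_sign : forall y, dir y = -1 \/ dir y = 1.
Implicit Types (u v : vertex) (phi psi : vertex -> R).

Definition odd_vertex v : bool := ~~ (2 %| v.1 + v.2)%Z.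
Definition hmove v : vertex := (v.1 + (if dir v.2 == 1 then 1 else -1), v.2).
Definition vmove v : vertex := (v.1, v.2 + (if odd_vertex v then 1 else -1)).
Definition site v : int := v.2 *+ 2 + (odd_vertex v : nat)%:Z.

(** Expectation of [phi] after [l] steps from [v], as a recursion over the two moves, so that the
    analysis needs no probability space. *)
Fixpoint expect (l : nat) phi v : R :=
  if l is l'.+1 then (expect l' phi (hmove v) + expect l' phi (vmove v)) / 2
  else phi v.

Lemma honeycombE u v : honeycomb dir u v = (v == hmove u) || (v == vmove u).
Proof.
rewrite /honeycomb /horizontal_arc /vertical_arc /vertical_edge_above /hmove /vmove
  /odd_vertex; case: u v => [a b] [c d] /=; rewrite !xpair_eqE; congr orb.
  rewrite [b == d]eq_sym andbC; congr andb.
  have N11 : (-1 == 1 :> R) = false by apply/negbTE; rewrite lt_eqF//; lra.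
  have N11' : (1 == -1 :> R) = false by rewrite eq_sym.
  by case: (dir_sign b) => ->; rewrite eqxx ?N11 ?N11' /= ?orbF.
rewrite [a == c]eq_sym; case: eqP => //= ->; case: ifP => h; lia.
Qed.

Lemma hmove_neq_vmove u : (hmove u == vmove u) = false.
Proof. by rewrite xpair_eqE; apply/negbTE; case: ifP; lia. Qed.

(** The abscissa moves by at most [l] in [l] steps; this excludes aliasing when roots of unity
    replace the integral over t. *)
Lemma expect_local l phi psi u :
  (forall v, (`|v.1 - u.1| <= l)%N -> phi v <= psi v) ->
  expect l phi u <= expect l psi u.
Proof.
elim: l u => [|l IH] u h /=; first by apply: h; rewrite subrr.
apply: ler_wpM2r; first by rewrite invr_ge0.
apply: lerD; apply: IH => v hv; apply: h; move: hv; rewrite /=; last by lia.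
by case: ifP => _; lia.
Qed.

Lemma expect_ge0 l phi u : (forall v, 0 <= phi v) -> 0 <= expect l phi u.
Proof.
move=> h; elim: l u => [|l IH] u //=.
by rewrite divr_ge0 ?addr_ge0.
Qed.

Lemma expect_sum l (I : finType) (c : R) (phi : I -> vertex -> R) u :
  expect l (fun v => c * \sum_i phi i v) u = c * \sum_i expect l (phi i) u.
Proof.
elim: l u => [//|l IH] u /=.
by rewrite !IH -mulrDr -big_split -mulrA mulr_suml.
Qed.

Lemma site_hmove u : theta dir (if odd_vertex u then site u - 1 else site u) = dir u.2
  /\ site (hmove u) = if odd_vertex u then site u - 1 else site u + 1.
Proof.
have h : odd_vertex (hmove u) = ~~ odd_vertex u.
  by rewrite /odd_vertex /hmove /=; case: ifP => _; lia.
split; last by rewrite /site h /=; case: (odd_vertex u) => /=; lia.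
rewrite /theta /site; case: (odd_vertex u) => /=.
  have -> : (2 %| u.2 *+ 2 + 1%:Z - 1)%Z by lia.
  by congr dir; lia.
have -> : (2 %| u.2 *+ 2 + 0%:Z)%Z by lia.
by congr dir; lia.
Qed.

Lemma site_vmove u : theta dir (if odd_vertex u then site u else site u - 1) = 0
  /\ site (vmove u) = if odd_vertex u then site u + 1 else site u - 1.
Proof.
have h : odd_vertex (vmove u) = ~~ odd_vertex u.
  rewrite [in RHS]/odd_vertex /vmove; move: (odd_vertex u) => s.
  by rewrite /odd_vertex /=; case: s; lia.
split; last by rewrite /site h /=; case: (odd_vertex u) => /=; lia.
rewrite /theta /site; case: (odd_vertex u) => /=.
  by have -> : (2 %| u.2 *+ 2 + 1%:Z)%Z = false by lia.
by have -> : (2 %| u.2 *+ 2 + 0%:Z - 1)%Z = false by lia.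
Qed.

Lemma site_origin v : (v == origin) = (v.1 == 0) && (site v == 0).
Proof.
case: v => [a b]; rewrite /site /odd_vertex /origin xpair_eqE /=.
by case: eqP => //= ->; case E: (2 %| _)%Z => /=; lia.
Qed.

Definition wave (t : R) v : R := (site v == 0)%:R * cos (t * v.1%:~R).

(** The abscissa enters only as a phase: the value is the real part of [e^{i t x}] times
    [A ^ l delta_0] at the site of [u]. A horizontal move multiplies the phase by the weight of the
    edge it crosses, and a vertical move crosses an edge of weight 1. *)
Lemma expect_wave t l u :
  let h := amp (alt dir t) (bet dir t) l (site u) in
  expect l (wave t) u = h.1 * cos (t * u.1%:~R) - h.2 * sin (t * u.1%:~R).
Proof.
elim: l u => [|l IH] u /=; first by rewrite /wave mul0r subr0.
have [th hs] := site_hmove u; have [tv vs] := site_vmove u.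
rewrite !IH {}hs {}vs /=.
have -> : cos (t * (u.1 + (if dir u.2 == 1 then 1 else -1))%:~R) =
    cos t * cos (t * u.1%:~R) - dir u.2 * sin t * sin (t * u.1%:~R).
  case: (dir_sign u.2) => ->; last first.
    by rewrite eqxx intrD mulrDr mulr1 cosD; ring.
  have -> : (-1 == 1 :> R) = false by apply/negbTE; rewrite lt_eqF//; lra.
  by rewrite intrD mulrDr mulrN1 cosB; ring.
have -> : sin (t * (u.1 + (if dir u.2 == 1 then 1 else -1))%:~R) =
    cos t * sin (t * u.1%:~R) + dir u.2 * sin t * cos (t * u.1%:~R).
  case: (dir_sign u.2) => ->; last first.
    by rewrite eqxx intrD mulrDr mulr1 sinD; ring.
  have -> : (-1 == 1 :> R) = false by apply/negbTE; rewrite lt_eqF//; lra.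
  by rewrite intrD mulrDr mulrN1 sinB; ring.
have d2 : dir u.2 ^+ 2 = 1 by case: (dir_sign u.2) => ->; ring.
move: th tv; case: (odd_vertex u) => th tv.
  rewrite !(altE dir_sign) !(betE dir_sign) th tv d2.
  by move: (amp _ _ _ _) (amp _ _ _ _) => [a b] [c d] /=; field.
rewrite !(altE dir_sign) !(betE dir_sign) th tv d2.
by move: (amp _ _ _ _) (amp _ _ _ _) => [a b] [c d] /=; field.
Qed.

Lemma expect_wave_origin t l :
  expect l (wave t) origin = (amp (alt dir t) (bet dir t) l 0).1.
Proof. by rewrite expect_wave mulr0 cos0 sin0 mulr0 mulr1 subr0. Qed.

Definition return_prob l : R := expect l (fun v => (v == origin)%:R) origin.

Lemma return_prob_ge0 l : 0 <= return_prob l.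
Proof. by apply: expect_ge0. Qed.

End Expectation.

Section Kernels.
Context {R : realType}.

(** Squared modulus of the sum of the [e^{i k x}], hence a nonnegative kernel. *)
Lemma fejer_sum (N : nat) (x : R) :
  \sum_(k < N) \sum_(k' < N) cos ((k%:R - k'%:R) * x) =
  (\sum_(k < N) cos (k%:R * x)) ^+ 2 + (\sum_(k < N) sin (k%:R * x)) ^+ 2.
Proof.
rewrite !expr2 !mulr_suml -big_split; apply: eq_bigr => k _ /=.
rewrite !mulr_sumr -big_split; apply: eq_bigr => k' _ /=.
by rewrite mulrBl cosB.
Qed.

Lemma cos_distn (k k' : nat) (x : R) :
  cos ((k%:R - k'%:R) * x) = cos (`|k - k'|%N%:R * x).
Proof.
have [h|h] := leqP k k'.
  by rewrite distnEr// natrB// -cosN -mulNr opprB.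
by rewrite distnEl ?natrB// ltnW.
Qed.

Lemma cos_periodz (m : int) : cos (m%:~R * (pi *+ 2)) = 1 :> R /\
   sin (m%:~R * (pi *+ 2)) = 0 :> R.
Proof.
have nat_case (k : nat) : cos (k%:R * (pi *+ 2)) = 1 :> R /\ sin (k%:R * (pi *+ 2)) = 0 :> R.
  elim: k => [|k [h1 h2]]; first by rewrite mul0r cos0 sin0.
  rewrite -natr1 mulrDl mul1r; set z := pi *+ 2 in h1 h2 *.
  by rewrite (cosD _ z) (sinD _ z) h1 h2 /z cos2pi sin2pi; split; ring.
case: m => k; first exact: nat_case.
rewrite NegzE rmorphN /= mulNr cosN sinN; have [-> ->] := nat_case k.+1.
by rewrite oppr0.
Qed.

(* If e^{i th} is an N-th root of unity other than 1, multiplication by e^{i th}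
   permutes the summands, so the geometric sum vanishes. *)
Lemma sum_cos_roots_le (N : nat) (th : R) : (0 < N)%N -> cos th != 1 ->
  cos (N%:R * th) = 1 -> sin (N%:R * th) = 0 -> \sum_(k < N) cos (k%:R * th) = 0.
Proof.
move=> N0 th1 cN sN.
set Cs := \sum_(k < N) cos (k%:R * th); pose Ss := \sum_(k < N) sin (k%:R * th).
have shift (F : nat -> R) : F N = F 0%N -> \sum_(k < N) F k.+1 = \sum_(k < N) F k.
  move=> FN; rewrite -(big_mkord xpredT (fun k => F k.+1)) -(big_mkord xpredT F).
  apply/eqP; rewrite -subr_eq0 -sumrB telescope_sumr// FN subrr //.
have E1 : Cs = cos th * Cs - sin th * Ss.
  rewrite {1}/Cs -(shift (fun k => cos (k%:R * th))) ?cN ?mul0r ?cos0//.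
  rewrite /Cs /Ss !mulr_sumr -sumrB; apply: eq_bigr => k _.
  by rewrite -natr1 mulrDl mul1r addrC cosD.
have E2 : Ss = sin th * Cs + cos th * Ss.
  rewrite {1}/Ss -(shift (fun k => sin (k%:R * th))) ?sN ?mul0r ?sin0//.
  rewrite /Cs /Ss !mulr_sumr -big_split; apply: eq_bigr => k _.
  by rewrite -natr1 mulrDl mul1r addrC sinD.
have sq := cos2Dsin2 th.
have : (2 - 2 * cos th) * Cs = 0.
  transitivity ((1 - 2 * cos th + (cos th ^+ 2 + sin th ^+ 2)) * Cs).
    by rewrite sq; ring.
  transitivity ((1 - cos th) * (Cs - (cos th * Cs - sin th * Ss))
     - sin th * (Ss - (sin th * Cs + cos th * Ss))); first by ring.
  by rewrite -E1 -E2; ring.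
move/eqP; rewrite mulf_eq0 => /orP[|/eqP//]; rewrite subr_eq0 => /eqP h.
by move: th1; rewrite (_ : cos th = 1) ?eqxx//; lra.
Qed.

End Kernels.

(** * Law of the walk *)

Section RealProbability.
Context {R : realType} d (T : measurableType d) (P : probability T R).
Implicit Types A B : set T.

Definition pr A : R := fine (P A).

Lemma prE A : measurable A -> P A = (pr A)%:E.
Proof. by move=> mA; rewrite /pr fineK// fin_num_measure. Qed.

Lemma pr_ge0 A : 0 <= pr A. Proof. exact: fine_ge0. Qed.

Lemma pr_split A B : measurable A -> measurable B ->
  pr A = pr (A `&` B) + pr (A `\` B).
Proof.
move=> mA mB; have mI := measurableI _ _ mA mB; have mD := measurableD mA mB.
by apply: EFin_inj; rewrite EFinD -!prE// (measureDI P mA mB) addeC.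
Qed.

Lemma pr_le A B : measurable A -> measurable B -> A `<=` B -> pr A <= pr B.
Proof.
by move=> mA mB AB; rewrite -lee_fin -!prE//; apply: le_measure; rewrite ?inE.
Qed.

Lemma pr_set0 : pr set0 = 0. Proof. by rewrite /pr measure0. Qed.

Lemma pr_setT : pr setT = 1. Proof. by rewrite /pr probability_setT. Qed.

End RealProbability.

Section WalkLaw.
Context {R : realType}.
Variable (dir : int -> R).
Hypothesis dir_sign : forall y, dir y = -1 \/ dir y = 1.
Context d (T : measurableType d) (P : probability T R) (M : nat -> T -> vertex).
Hypothesis walk : simple_random_walk (honeycomb dir) P M.

Let mM n v : measurable (M n @^-1` [set v]).
Proof. by have [] := walk. Qed.

Lemma historyS x n : history M x n.+1 = history M x n `&` M n.+1 @^-1` [set x n.+1].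
Proof.
apply/seteqP; split=> w /=.
  by move=> h; split; [move=> i /leqW; apply: h|apply: h].
by move=> [h1 h2] i; rewrite leq_eqVlt => /orP[/eqP -> //|]; apply: h1.
Qed.

Lemma measurable_history x n : measurable (history M x n).
Proof.
elim: n => [|n IH]; last by rewrite historyS; exact: measurableI.
have -> : history M x 0 = M 0%N @^-1` [set x 0%N]; last exact: mM.
by apply/seteqP; split=> w /= h; [apply: h|move=> i; rewrite leqn0 => /eqP ->].
Qed.

Lemma history_ext x x' n : (forall i, (i <= n)%N -> x i = x' i) ->
  history M x n = history M x' n.
Proof.
by move=> h; apply/seteqP; split=> w /= hw i ni; rewrite hw// h.
Qed.

Lemma history_next x n u : pr P (history M x n `&` M n.+1 @^-1` [set u]) =
  pr P (history M x n) * step_prob R (honeycomb dir) (x n) u.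
Proof.
pose x' i := if (i <= n)%N then x i else u.
have x'n i : (i <= n)%N -> x' i = x i by rewrite /x' => ->.
have x'S : x' n.+1 = u by rewrite /x' ltnn.
have [_ _ /(_ x' n)] := walk.
rewrite historyS x'S (history_ext x'n) x'n// => h.
have mH := measurable_history x n.
by apply: EFin_inj; rewrite EFinM -!prE//; apply: measurableI.
Qed.

Lemma step_prob_move u v : v = hmove dir u \/ v = vmove u ->
  step_prob R (honeycomb dir) u v = 2^-1.
Proof.
by rewrite /step_prob honeycombE// => -[] ->; rewrite eqxx ?orbT.
Qed.

(** Conditioning on the next step: each of the two out-neighbours takes half of the mass of the
    history, so any other continuation is a null event. *)
Lemma history_expect x n k v :
  pr P (history M x n `&` M (n + k)%N @^-1` [set v]) =
  pr P (history M x n) * expect dir k (fun u => (u == v)%:R) (x n).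
Proof.
elim: k x n => [|k IH] x n.
  rewrite addn0 /=; have [<-|xv] := eqVneq (x n) v.
    rewrite mulr1 setIidl// => w /= h; exact: h.
  rewrite mulr0 (_ : _ `&` _ = set0) ?pr_set0//.
  apply/seteqP; split=> // w /= [h1 h2]; move: xv.
  by rewrite -h2 h1// eqxx.
have mA := measurable_history x n; have mE := mM (n + k.+1)%N v.
set A := history M x n in mA *; set E := M (n + k.+1)%N @^-1` [set v] in mE *.
have mv u : measurable (M n.+1 @^-1` [set u]) by exact: mM.
pose H := M n.+1 @^-1` [set hmove dir (x n)].
pose V := M n.+1 @^-1` [set vmove (x n)].
have mH : measurable H by exact: mM.
have mV : measurable V by exact: mM.
have next u : pr P (A `&` M n.+1 @^-1` [set u] `&` E) =
    pr P (A `&` M n.+1 @^-1` [set u]) * expect dir k (fun u => (u == v)%:R) u.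
  pose x' i := if (i <= n)%N then x i else u.
  have x'n i : (i <= n)%N -> x' i = x i by rewrite /x' => ->.
  have x'S : x' n.+1 = u by rewrite /x' ltnn.
  by have := IH x' n.+1; rewrite historyS x'S (history_ext x'n) addSnnS.
have HV w : H w -> ~ V w.
  by rewrite /H /V /= => -> /eqP; rewrite hmove_neq_vmove.
have PH : pr P (A `&` H) = pr P A / 2.
  by rewrite history_next step_prob_move; last by left.
have PV : pr P (A `&` V) = pr P A / 2.
  by rewrite history_next step_prob_move; last by right.
have AV : (A `\` H) `&` V = A `&` V.
  apply/seteqP; split=> w; first by move=> [[]].
  by move=> [Aw Vw]; split=> //; split=> // Hw; exact: HV Hw Vw.
have rest0 : pr P ((A `\` H) `\` V) = 0.
  have := pr_split P mA mH; have := pr_split P (measurableD mA mH) mV.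
  by rewrite AV PH PV; lra.
have mAE : measurable (A `&` E) by exact: measurableI.
have := pr_split P mAE mH; have := pr_split P (measurableD mAE mH) mV.
have -> : ((A `&` E) `\` H) `&` V = A `&` V `&` E.
  rewrite -AV; apply/seteqP; split=> w.
    by move=> [[[]]].
  by move=> [[[]]].
have -> : A `&` E `&` H = A `&` H `&` E by rewrite setIAC.
have -> : pr P (((A `&` E) `\` H) `\` V) = 0.
  apply/eqP; rewrite eq_le pr_ge0 andbT -rest0; apply: pr_le.
  - by do 2 apply: measurableD => //.
  - by do 2 apply: measurableD => //.
  - by move=> w [[[Aw _] Hw] Vw].
by rewrite !next PH PV => -> ->; rewrite /=; field.
Qed.

Lemma return_probP l : P (M l @^-1` [set origin]) = (return_prob dir l)%:E.
Proof.
rewrite prE//; congr EFin; have := history_expect (fun=> origin) 0 l origin.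
have -> : history M (fun=> origin) 0 = setT.
  apply/seteqP; split=> // w _ i; rewrite leqn0 => /eqP ->.
  by have [_ h _] := walk.
by rewrite setTI pr_setT mul1r.
Qed.

End WalkLaw.

Section RecurrenceCriteria.
Context {R : realType}.
Variable (dir : int -> R).
Hypothesis dir_sign : forall y, dir y = -1 \/ dir y = 1.

Lemma transient_of_bounded (C : R) :
  (forall n, \sum_(l < n) return_prob dir l <= C) -> transient R (honeycomb dir).
Proof.
move=> h d T P M walk.
apply: (@le_lt_trans _ _ C%:E); last exact: ltry.
apply: lime_le; first by apply: is_cvg_nneseries => n _ _.
apply: nearW => n; under eq_bigr do rewrite (return_probP dir_sign walk).
by rewrite sumEFin lee_fin big_mkord.
Qed.

Lemma recurrent_of_unbounded :
  (forall C : R, exists n, C <= \sum_(l < n) return_prob dir l) ->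
  recurrent R (honeycomb dir).
Proof.
move=> h d T P M walk; apply: eq_infty => C; have [n Cn] := h C.
apply: (@le_trans _ _ (\sum_(0 <= l < n) P (M l @^-1` [set origin]))%E).
  under eq_bigr do rewrite (return_probP dir_sign walk).
  by rewrite sumEFin lee_fin big_mkord.
by apply: nneseries_lim_ge => l _ _.
Qed.

End RecurrenceCriteria.

(** * Criteria for the orientation *)

Section Limits.
Context {R : realType}.

Lemma exprn_small (r e : R) n0 : 0 <= r < 1 -> 0 < e ->
  exists2 n, (n0 <= n)%N & r ^+ n <= e.
Proof.
move=> /andP[r0 r1] e0; have rn : `|r| < 1 by rewrite ger0_norm.
have /cvgrPdist_le /(_ e e0) [m _ /(_ (m + n0)%N (leq_addr _ _))] := cvg_expr rn.
rewrite /= sub0r normrN ger0_norm ?exprn_ge0// => h.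
by exists (m + n0)%N => //; exact: leq_addl.
Qed.

Lemma bernoulli_le (x : R) n : 0 <= x <= 1 -> 1 - n%:R * x <= (1 - x) ^+ n.
Proof.
move=> /andP[x0 x1]; elim: n => [|n IH]; first by rewrite mul0r subr0 expr0.
rewrite exprS -natr1.
have h : (1 - x) * (1 - n%:R * x) <= (1 - x) * (1 - x) ^+ n.
  by rewrite ler_wpM2l// subr_ge0.
have : 0 <= n%:R * x ^+ 2 by rewrite mulr_ge0 ?sqr_ge0.
by lra.
Qed.

(** Each distance occurs at most twice, once on either side of [k]. *)
Lemma sum_distn_le (g : nat -> R) N k : (forall m, 0 <= g m) -> (k < N)%N ->
  \sum_(k' < N) g `|k - k'|%N <= 2 * \sum_(m < N) g m.
Proof.
move=> g0 kN; rewrite -(big_mkord xpredT (fun k' => g `|k - k'|%N)).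
rewrite -(big_mkord xpredT g) (big_cat_nat (n := k)) ?(ltnW kN)//=.
have part a b : (a <= b)%N -> \sum_(0 <= m < a) g m <= \sum_(0 <= m < b) g m.
  move=> ab; rewrite [leRHS](big_cat_nat (n := a))//= lerDl.
  by apply: sumr_ge0.
have h1 : \sum_(0 <= k' < k) g `|k - k'|%N <= \sum_(0 <= m < N) g m.
  rewrite big_nat_rev /= add0n; apply: le_trans (part _ _ kN).
  rewrite [leRHS]big_nat_recl// ler_wpDl//.
  apply: ler_sum_nat => i /andP[_ ik]; rewrite distnEl ?leq_subr//.
  by have -> : (k - (k - i.+1))%N = i.+1 by lia.
have h2 : \sum_(k <= k' < N) g `|k - k'|%N <= \sum_(0 <= m < N) g m.
  rewrite -{1}[k]add0n big_addn; apply: le_trans (part _ _ (leq_subr k N)).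
  by apply: ler_sum_nat => i _; rewrite distnEr ?leq_addl// addnK.
lra.
Qed.

End Limits.

(** * Unbounded returns from averages over roots of unity *)

Section Recurrence.
Context {R : realType}.
Variable (dir V : int -> R) (B : R).
Hypothesis dir_sign : forall y, dir y = -1 \/ dir y = 1.
Hypothesis Vdir : forall y, V (y + 1) - V y = dir y.
Hypothesis VB : forall y, `|V y| <= B.

Lemma discounted_returns_roots r n N : (0 <= r) -> (n <= N)%N -> (0 < N)%N ->
  N%:R^-1 * \sum_(k < N) green_re (alt dir (k%:R * (pi *+ 2 / N%:R)))
     (bet dir (k%:R * (pi *+ 2 / N%:R))) r n 0 <=
  \sum_(l < n) r ^+ l * return_prob dir l :> R.
Proof.
move=> r0 nN N0.
rewrite /green_re exchange_big /= mulr_sumr; apply: ler_sum => l _.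
rewrite -mulr_sumr mulrCA ler_wpM2l ?exprn_ge0//.
under eq_bigr do rewrite -expect_wave_origin//.
rewrite -expect_sum; apply: expect_local => v; rewrite subr0 => vl.
rewrite /wave -mulr_sumr site_origin; have [v0|v0] := eqVneq v.1 0.
  rewrite v0 (eq_bigr (fun=> 1)); last by move=> k _; rewrite mulr0 cos0.
  rewrite sumr_const card_ord -[X in _ * (_ * X)]mulr_natr mul1r mulrCA mulVf.
    by rewrite mulr1.
  by rewrite pnatr_eq0 -lt0n.
have vN : (`|v.1| < N)%N by apply: leq_ltn_trans vl _; exact: leq_trans (ltn_ord l) nN.
have N0' : 0 < N%:R :> R by rewrite ltr0n.
rewrite (eq_bigr (fun k : 'I_N => cos (k%:R * (v.1%:~R * (pi *+ 2) / N%:R)))); last first.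
  by move=> k _; congr cos; field; rewrite gt_eqF.
rewrite sum_cos_roots_le ?mulr0//=.
(* Half of [|th|] is [pi |x| / N], strictly between 0 and [pi], so its sine cannot vanish. *)
- set th := _ / _; apply/eqP => th1.
  have : cos `|th| = 1 by rewrite cos_norm.
  rewrite cos_double_half => h.
  have : 0 < sin (`|th| / 2).
    have pi0 := @pi_gt0 R.
    have pi20 : 0 <= pi *+ 2 :> R by rewrite mulr2n addr_ge0// ltW.
    have -> : `|th| / 2 = `|v.1|%N%:R / N%:R * pi.
      rewrite /th normrM normrM (ger0_norm (x := N%:R^-1)) ?invr_ge0//.
      rewrite (ger0_norm pi20).
      rewrite -intr_norm -[`|v.1| in LHS]abszE -mulr_natr pmulrn.
      by field; rewrite gt_eqF.
    apply: sin_gt0_pi; rewrite mulr_gt0 ?divr_gt0 ?ltr0n ?absz_gt0//=.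
    by rewrite gtr_pMl// ltr_pdivrMr// mul1r ltr_nat.
  by move=> hs; nra.
- have -> : N%:R * (v.1%:~R * (pi *+ 2) / N%:R) = v.1%:~R * (pi *+ 2) :> R.
    by field; rewrite gt_eqF.
  by have [] := @cos_periodz R v.1.
- have -> : N%:R * (v.1%:~R * (pi *+ 2) / N%:R) = v.1%:~R * (pi *+ 2) :> R.
    by field; rewrite gt_eqF.
  by have [] := @cos_periodz R v.1.
Qed.

Lemma harmonic_dyadic N' s : (0 < N')%N ->
  s%:R / 2 <= \sum_(N' <= k < 2 ^ s * N') k%:R^-1 :> R.
Proof.
move=> N0; elim: s => [|s IH].
  by rewrite mul0r expn0 mul1n big_geq.
have h1 : (N' <= 2 ^ s * N')%N by rewrite leq_pmull// expn_gt0.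
have h2 : (2 ^ s * N' <= 2 ^ s.+1 * N')%N by rewrite leq_mul2r leq_exp2l// leqnSn orbT.
rewrite (big_cat_nat h1 h2) /= -natr1.
suff : 1 / 2 <= \sum_(2 ^ s * N' <= k < 2 ^ s.+1 * N') k%:R^-1 :> R by lra.
set m := (2 ^ s * N')%N in h1 h2 *.
have m0 : (0 < m)%N by exact: leq_trans h1.
have -> : (2 ^ s.+1 * N' = m + m)%N by rewrite /m expnS -mulnA mul2n addnn.
apply: (@le_trans _ _ (\sum_(m <= k < m + m) (m + m)%:R^-1)).
  rewrite sumr_const_nat addnK -[leRHS]mulr_natr natrD.
  have m1 : 0 < m%:R :> R by rewrite ltr0n.
  rewrite (_ : (m%:R + m%:R)^-1 * m%:R = 1 / 2)//.
  by field; lra.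
apply: ler_sum_nat => k /andP[mk km].
by rewrite lef_pV2 ?posrE ?ltr0n ?ler_nat ?addn_gt0 ?m0// ?(ltnW km)//; exact: leq_trans mk.
Qed.

Lemma pi_le4 : pi <= 4 :> R.
Proof. by have /andP[_ +] := (@pihalf_02_cos_pihalf R).1; lra. Qed.

Lemma nat_ge_exists (x : R) : exists q : nat, x <= (2 ^ q)%:R.
Proof.
exists (Num.truncn `|x|).+1; apply: le_trans (ler_norm x) _.
have /andP[_ /ltW h] := truncn_itv (normr_ge0 x).
by apply: le_trans h _; rewrite ler_nat; apply/ltnW/ltn_expl.
Qed.

Lemma returns_unbounded (C : R) : 1 <= B ->
  exists n, C <= \sum_(l < n) return_prob dir l.
Proof.
move=> B1; pose D := 152 * B ^+ 2.
have D0 : 1 <= D by rewrite /D; have := @exprn_ege1 _ 2 _ B1; lra.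
(* [q] makes the frequencies small enough for the hat bound; [2 ^ s] is the number of dyadic blocks
   whose harmonic sum beats [C]. *)
have [q Dq] := nat_ge_exists (8 * D).
have [s Cs] := nat_ge_exists (64 * D * (`|C| + 1)).
pose p := (q + 2 ^ s)%N.
have q0 : (0 < q)%N.
  by case: q Dq {p} => // ; rewrite expn0 => ?; lra.
have p0 : (0 < p)%N by rewrite addn_gt0 q0.
pose h : R := (2 ^ p)%:R^-1; pose r := 1 - h ^+ 2.
have P0 : 0 < (2 ^ p)%:R :> R by rewrite ltr0n expn_gt0.
have h0 : 0 < h by rewrite invr_gt0.
have h1 : h <= 1 / 2.
  rewrite /h mul1r lef_pV2 ?posrE// (_ : 2 = (2 ^ 1)%:R) ?ler_nat ?leq_exp2l//.
have r1 : r < 1 by rewrite /r; have := exprn_gt0 2 h0; lra.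
have r2 : 1 / 2 <= r by rewrite /r; nra.
have r0 : 0 <= r by lra.
have e0 : 0 < (1 - r) / 8 by lra.
have [n _ rn] := @exprn_small _ r _ 0 (introT andP (conj r0 r1)) e0.
have rn1 : r ^+ n <= 1 - r by lra.
exists n; apply: (@le_trans _ _ (\sum_(l < n) r ^+ l * return_prob dir l)); last first.
  apply: ler_sum => l _; rewrite -[leRHS]mul1r ler_wpM2r ?return_prob_ge0//.
  by rewrite exprn_ile1// ltW.
(* The grid has more than [n] points, indices from [N'] on have frequency at least [h], and those up
   to [2 ^ (2 ^ s) * N'] are at most [N / 2 ^ q]. *)
pose N' := n.+1; pose N := (2 ^ p * N')%N.
have N0 : (0 < N)%N by rewrite muln_gt0 expn_gt0.
have nN : (n <= N)%N by apply: leq_trans (leqnSn n) _; rewrite leq_pmull// expn_gt0.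
apply: le_trans (discounted_returns_roots r0 nN N0).
have NR0 : 0 < N%:R :> R by rewrite ltr0n.
pose g (k : nat) : R := green_re (alt dir (k%:R * (pi *+ 2 / N%:R)))
   (bet dir (k%:R * (pi *+ 2 / N%:R))) r n 0.
rewrite -(big_mkord xpredT g).
have gN1 k : -1 <= g k by apply: green_geN1 => //; exact: alt_bet.
have glow k : (N' <= k < 2 ^ (2 ^ s) * N')%N -> N%:R / (32 * D) * k%:R^-1 - 1 <= g k.
  move=> /andP[k1 k2].
  have k0 : 0 < k%:R :> R by rewrite ltr0n; exact: leq_trans k1.
  pose t : R := k%:R * (pi *+ 2 / N%:R).
  have tlow : h <= t.
    rewrite /t /h /N natrM.
    have M0 : 0 < (2 ^ p)%:R * N'%:R :> R by apply: mulr_gt0; [exact: P0|rewrite ltr0n].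
    have -> : (2 ^ p)%:R^-1 = N'%:R * ((2 ^ p)%:R * N'%:R)^-1 :> R.
      by field; rewrite (gt_eqF P0) andbT pnatr_eq0.
    apply: ler_pM; rewrite ?invr_ge0 ?(ltW M0) ?ler_nat//.
    rewrite -[leLHS]mul1r ler_wpM2r ?invr_ge0 ?(ltW M0)//.
    by rewrite -mulr_natr; have := @pi_ge2 R; lra.
  have thigh : t <= 8 * (k%:R / N%:R).
    have -> : t = pi *+ 2 * (k%:R / N%:R) by rewrite /t mulrCA.
    by rewrite ler_wpM2r ?divr_ge0// -mulr_natr; have := pi_le4; lra.
  have kN : k%:R / N%:R <= (2 ^ q)%:R^-1 :> R.
    rewrite ler_pdivrMr// mulrC ler_pdivlMr ?ltr0n ?expn_gt0// -natrM ler_nat.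
    by rewrite /N /p expnD mulnC -mulnA leq_mul2l (ltnW k2) orbT.
  have DtN : D * t <= 32 * D * (k%:R / N%:R) / 4.
    by have := ler_wpM2l (le_trans ler01 D0) thigh; lra.
  have Dt1 : D * t <= 1.
    apply: le_trans DtN _.
    have : 8 * D * (k%:R / N%:R) <= (2 ^ q)%:R * (2 ^ q)%:R^-1 by apply: ler_pM => //; lra.
    by rewrite divff ?pnatr_eq0 ?expn_eq0//; lra.
  have t0 : 0 < t by exact: lt_le_trans tlow.
  have t1 : t <= 1 by nra.
  have rt : 1 - r <= t ^+ 2.
    by rewrite /r opprB addrC subrK ler_pXn2r ?nnegrE// ltW.
  have := green_hat_lower dir_sign Vdir VB (introT andP (conj t0 t1))
    (introT andP (conj r2 r1)) rt rn B1 Dt1.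
  rewrite -/D.
  have : N%:R / (32 * D) * k%:R^-1 <= 1 / (4 * (D * t)).
    have -> : N%:R / (32 * D) * k%:R^-1 = 1 / (32 * D * (k%:R / N%:R)).
      by field; rewrite !gt_eqF//; lra.
    have x0 : 0 < D * t by apply: mulr_gt0 => //; exact: lt_le_trans D0.
    have x1 : 4 * (D * t) <= 32 * D * (k%:R / N%:R) by lra.
    by rewrite !mul1r lef_pV2 ?posrE//; lra.
  by rewrite /g -/t; lra.
have N'N : (N' <= 2 ^ (2 ^ s) * N')%N by rewrite leq_pmull// expn_gt0.
have NN : (2 ^ (2 ^ s) * N' <= N)%N.
  by rewrite /N leq_mul2r leq_exp2l// leq_addl orbT.
(* Indices outside the harmonic range contribute only the trivial bound -1. *)
have : N%:R / (32 * D) * ((2 ^ s)%:R / 2) - N%:R <= \sum_(0 <= k < N) g k.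
  apply: (@le_trans _ _ (\sum_(0 <= k < N)
     ((N%:R / (32 * D) * (if (N' <= k < 2 ^ (2 ^ s) * N')%N then k%:R^-1 else 0)) - 1))).
    rewrite sumrB -mulr_sumr sumr_const_nat subn0 lerD2r.
    apply: ler_wpM2l; first by rewrite divr_ge0//; lra.
    rewrite -big_mkcond /=.
    rewrite (big_cat_nat (n := N')) ?(leq_trans N'N)//= ler_wpDl ?sumr_ge0//.
    rewrite (big_cat_nat (n := (2 ^ (2 ^ s) * N')%N))//= ler_wpDr ?sumr_ge0//.
    apply: le_trans (harmonic_dyadic _ (ltn0Sn n)) _.
    by rewrite [leLHS]big_nat.
  apply: ler_sum => k _; case: ifP => [|_]; first exact: glow.
  by rewrite mulr0 sub0r.
set S := \sum_(0 <= k < N) g k => HS.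
have : C <= (2 ^ s)%:R / (64 * D) - 1.
  have := ler_norm C.
  have : `|C| + 1 <= (2 ^ s)%:R / (64 * D) by rewrite ler_pdivlMr; lra.
  lra.
move=> HC; apply: le_trans HC _.
rewrite [leRHS]mulrC ler_pdivlMr//; apply: le_trans HS.
by rewrite le_eqVlt; apply/orP; left; apply/eqP; field; lra.
Qed.

End Recurrence.

(** * Bounded returns from a Fejer majorant *)

Section Transience.
Context {R : realType}.
Variable (dir : int -> R).
Hypothesis dir_sign : forall y, dir y = -1 \/ dir y = 1.

Definition green_at (r : R) n (t : R) : R := green_re (alt dir t) (bet dir t) r n 0.

(** The Fejer kernel divided by [N ^ 2] is nonnegative and equals 1 at abscissa 0, so it dominates
    the indicator for every grid step [h]. *)
Lemma discounted_returns_fejer (r h : R) n N : 0 <= r -> (0 < N)%N ->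
  \sum_(l < n) r ^+ l * return_prob dir l <=
  (N%:R ^+ 2)^-1 * \sum_(k < N) \sum_(k' < N) green_at r n (`|k - k'|%N%:R * h).
Proof.
move=> r0 N0.
have -> : \sum_(k < N) \sum_(k' < N) green_at r n (`|k - k'|%N%:R * h) =
  \sum_(l < n) r ^+ l * \sum_(k < N) \sum_(k' < N)
     (amp (alt dir (`|k - k'|%N%:R * h)) (bet dir (`|k - k'|%N%:R * h)) l 0).1.
  rewrite /green_at /green_re; under eq_bigr do rewrite exchange_big /=.
  rewrite exchange_big /=; apply: eq_bigr => l _; rewrite mulr_sumr.
  by apply: eq_bigr => k _; rewrite mulr_sumr.
rewrite mulr_sumr; apply: ler_sum => l _.
rewrite mulrCA ler_wpM2l ?exprn_ge0//.
rewrite pair_big /=; under [X in _ * X]eq_bigr do rewrite -expect_wave_origin//.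
rewrite -expect_sum; apply: expect_local => v _.
rewrite -(pair_big xpredT xpredT (fun k k' : 'I_N => wave (`|k - k'|%N%:R * h) v)) /=.
rewrite /wave; under [X in _ * X]eq_bigr => k _.
  under eq_bigr => k' _ do rewrite -mulrA -cos_distn.
  rewrite -mulr_sumr; over.
rewrite /= -mulr_sumr fejer_sum site_origin mulrCA.
have [v0|v0] := eqVneq v.1 0; last first.
  by rewrite mulr_ge0// mulr_ge0 ?invr_ge0 ?sqr_ge0// addr_ge0 ?sqr_ge0.
rewrite v0 mulr0 /=.
under eq_bigr do rewrite mulr0 cos0.
under [X in _ + X ^+ 2]eq_bigr do rewrite mulr0 sin0.
rewrite !sumr_const card_ord mul0rn expr0n addr0 mulVf ?mulr1//.
by rewrite expf_neq0// pnatr_eq0 -lt0n.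
Qed.

(** The frequencies between [K ^ -(j + 1)] and [K ^ -j] have total length at most [K ^ -j], so they
    contribute at most [A / 2 ^ j]. *)
Lemma returns_bounded (K j0 : nat) (A : R) : (1 < K)%N -> (0 < j0)%N -> 0 <= A ->
  (forall (j n : nat) (r t : R), (j0 <= j)%N ->
     (K ^ j.+1)%:R^-1 <= t <= (K ^ j)%:R^-1 ->
     1 / 2 <= r < 1 -> 1 - r <= t ^+ 2 -> r ^+ n <= 1 - r ->
     green_at r n t <= A * (K%:R / 2) ^+ j) ->
  exists C, forall n, \sum_(l < n) return_prob dir l <= C.
Proof.
move=> K1 j00 A0 H; exists (4 * (12 + 2 * A) * (K ^ j0)%:R) => n0.
have K0 : 0 < K%:R :> R by rewrite ltr0n ltnW.
have K2 : 2 <= K%:R :> R by rewrite ler_nat.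
(* The step [h = K ^ -q] is so small that [r ^ l >= 1/2] for [l < n0], and the [N = K ^ p] grid
   points stay below [K ^ -j0], where the hypothesis applies. *)
pose p := (2 * n0).+1; pose q := (p + j0)%N.
have Kq0 m : 0 < (K ^ m)%:R :> R by rewrite ltr0n expn_gt0 ltnW.
pose h : R := (K ^ q)%:R^-1; pose r := 1 - h ^+ 2; pose N := (K ^ p)%N.
have h0 : 0 < h by rewrite invr_gt0.
have hq : (2 * n0).+1%:R * h <= 1.
  rewrite ler_pdivrMr// mul1r ler_nat /q /p; apply: leq_trans (ltnW (ltn_expl _ K1)) _.
  by rewrite leq_exp2l// leq_addr.
have hK : h <= 1 / 2.
  apply: (@le_trans _ _ (2 ^- 1)); last by rewrite expr1 mul1r.
  rewrite /h expr1 lef_pV2 ?posrE// ler_nat; apply: (leq_trans K1).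
  by rewrite -[leqLHS]expn1 leq_exp2l.
have r1 : r < 1 by rewrite /r; have := exprn_gt0 2 h0; lra.
have r2 : 1 / 2 <= r by rewrite /r; nra.
have r0 : 0 <= r by lra.
have [n n0n rn] := @exprn_small _ r (1 - r) n0 (introT andP (conj r0 r1))
  (ltac:(by rewrite subr_gt0)).
have rl l : (l < n0)%N -> 1 / 2 <= r ^+ l.
  move=> ln; have h2 : 0 <= h ^+ 2 <= 1 by rewrite sqr_ge0 /=; nra.
  apply: le_trans (bernoulli_le l h2).
  have ll : l%:R <= n0%:R :> R by rewrite ler_nat ltnW.
  have : 2 * n0%:R * h <= 1.
    by apply: le_trans hq; rewrite ler_wpM2r ?(ltW h0)// -(natr1 (2 * n0)%N) natrM lerDl.
  have : l%:R * h ^+ 2 <= n0%:R * h ^+ 2 by rewrite ler_wpM2r ?sqr_ge0.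
  have : 0 <= n0%:R * h by rewrite mulr_ge0// ltW.
  nra.
apply: (@le_trans _ _ (2 * \sum_(l < n) r ^+ l * return_prob dir l)).
  rewrite -(big_mkord xpredT (return_prob dir)).
  rewrite -(big_mkord xpredT (fun l => r ^+ l * return_prob dir l)).
  rewrite [X in _ <= _ * X](big_cat_nat (n := n0))//= mulrDr ler_wpDr//.
    rewrite mulr_ge0// sumr_ge0// => l _.
    by rewrite mulr_ge0 ?exprn_ge0 ?return_prob_ge0.
  rewrite mulr_sumr; apply: ler_sum_nat => l /andP[_ ln].
  have := rl _ ln; have := return_prob_ge0 dir l; nra.
have N0 : (0 < N)%N by rewrite expn_gt0 ltnW.
have NR0 : 0 < N%:R :> R by rewrite ltr0n.
pose g (m : nat) := Num.max 0 (green_at r n (m%:R * h)).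
have g0 m : 0 <= g m by rewrite le_max lexx.
have gle m : green_at r n (m%:R * h) <= g m by rewrite le_max lexx orbT.
have H1 : \sum_(l < n) r ^+ l * return_prob dir l <= 2 * (\sum_(m < N) g m) / N%:R.
  apply: le_trans (discounted_returns_fejer h n r0 N0) _.
  apply: (@le_trans _ _ ((N%:R ^+ 2)^-1 * \sum_(k < N) 2 * \sum_(m < N) g m)).
    rewrite ler_wpM2l ?invr_ge0 ?sqr_ge0//; apply: ler_sum => k _.
    apply: le_trans (sum_distn_le g0 (ltn_ord k)).
    by apply: ler_sum => k' _; exact: gle.
  rewrite sumr_const card_ord -[X in _ * X <= _]mulr_natr.
  by rewrite le_eqVlt; apply/orP; left; apply/eqP; field; rewrite gt_eqF.
(* At frequency 0 only the crude bound is available; divided by [N] it is the constant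
   [12 * K ^ j0]. *)
have G0 : g 0%N <= 12 / h.
  rewrite ge_max divr_ge0 ?(ltW h0)//=; rewrite /green_at.
  apply: green_upper_mass => //; first exact: alt_bet.
    by move=> j; apply: alt_ge_quarter => //; rewrite mul0r lexx ler01.
  by rewrite /r opprB addrC subrK.
(* Indices from [K ^ i] to [K ^ i.+1] lie at scale [j = q - i.+1] and sum to at most
   [A * K ^ q / 2 ^ j]. These bounds double with [i], so the total is at most twice the last one. *)
have Gi i : (i <= p)%N -> \sum_(1 <= m < K ^ i) g m <=
    2 * A * (K ^ q)%:R * (2 ^ i)%:R / (2 ^ p)%:R.
  elim: i => [|i IH] ip.
    rewrite expn0 big_geq// !mulr_ge0//.
  have h1 : (1 <= K ^ i)%N by rewrite expn_gt0 ltnW.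
  have h2 : (K ^ i <= K ^ i.+1)%N by rewrite leq_exp2l.
  rewrite (big_cat_nat h1 h2) /=.
  have -> : 2 * A * (K ^ q)%:R * (2 ^ i.+1)%:R / (2 ^ p)%:R =
     2 * A * (K ^ q)%:R * (2 ^ i)%:R / (2 ^ p)%:R
     + A * (K ^ q)%:R * (2 ^ i.+1)%:R / (2 ^ p)%:R :> R.
    by rewrite expnS natrM; field; rewrite pnatr_eq0 expn_eq0.
  apply: lerD; first exact: IH (ltnW ip).
  pose j := (q - i.+1)%N.
  have qj : (q = i.+1 + j)%N by rewrite /j subnKC// /q ltn_addr.
  have jj0 : (j0 <= j)%N by rewrite /j /q addnC -addnBA// leq_addr.
  apply: (@le_trans _ _ (\sum_(K ^ i <= m < K ^ i.+1) A * (K%:R / 2) ^+ j)).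
    apply: ler_sum_nat => m /andP[m1 m2].
    rewrite ge_max mulr_ge0 ?exprn_ge0 ?divr_ge0//=; apply: H => //.
    - have hE1 : m%:R * h = m%:R / (K ^ i)%:R * (K ^ j.+1)%:R^-1.
        by rewrite /h qj addSnnS expnD natrM invfM mulrA.
      have hE2 : m%:R * h = m%:R / (K ^ i.+1)%:R * (K ^ j)%:R^-1.
        by rewrite /h qj expnD natrM invfM mulrA.
      apply/andP; split.
        rewrite hE1 -[leLHS]mul1r ler_wpM2r ?invr_ge0 ?(ltW (Kq0 _))//.
        by rewrite ler_pdivlMr// mul1r ler_nat.
      rewrite hE2 -[leRHS]mul1r ler_wpM2r ?invr_ge0 ?(ltW (Kq0 _))//.
      by rewrite ler_pdivrMr// mul1r ler_nat ltnW.
    - by rewrite r2.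
    - have m0 : 1 <= m%:R :> R by rewrite ler1n; exact: leq_trans m1.
      rewrite /r opprB addrC subrK exprMn ler_peMl ?sqr_ge0//.
      by rewrite exprn_ege1.
  rewrite sumr_const_nat -[leLHS]mulr_natr -[leRHS]mulrA -[leRHS]mulrA -[leLHS]mulrA.
  rewrite ler_wpM2l// natrB//.
  apply: (@le_trans _ _ ((K%:R / 2) ^+ j * (K ^ i.+1)%:R)).
    by rewrite ler_wpM2l ?exprn_ge0 ?divr_ge0// lerBlDr lerDl.
  have -> : (K%:R / 2) ^+ j * (K ^ i.+1)%:R = (K ^ q)%:R * (2 ^ j)%:R^-1 :> R.
    by rewrite expr_div_n qj expnD natrM !natrX; ring.
  rewrite ler_wpM2l// ler_pdivlMr ?ltr0n ?expn_gt0// mulrC ler_pdivrMr ?ltr0n ?expn_gt0//.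
  by rewrite -natrM -expnD ler_nat leq_exp2l// -qj /q leq_addr.
have H2 : \sum_(m < N) g m <= 12 / h + 2 * A * (K ^ q)%:R.
  rewrite -(big_mkord xpredT g) big_ltn//; apply: lerD => //.
  apply: le_trans (Gi p (leqnn p)) _.
  by rewrite mulfK// pnatr_eq0 expn_eq0.
have -> : 4 * (12 + 2 * A) * (K ^ j0)%:R = 2 * (2 * (12 / h + 2 * A * (K ^ q)%:R) / N%:R).
  rewrite /h invrK /q /N expnD natrM; field.
  by rewrite gt_eqF.
rewrite ler_wpM2l//; apply: le_trans H1 _.
by rewrite ler_wpM2r ?invr_ge0// ler_wpM2l.
Qed.

End Transience.

(** * Periodic sums and independent bits *)

Section PeriodicSums.
Context {R : realType}.
Variables (Q : nat) (f : int -> R).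
Hypothesis f_sign : forall y, f y = -1 \/ f y = 1.
Hypothesis f_periodic : forall y, f (y + Q%:Z) = f y.
Hypothesis f_sum : \sum_(0 <= k < Q) f k%:Z = 0.

Lemma periodic_sum0 (a : int) : \sum_(k < Q) f (a + k%:Z) = 0.
Proof.
pose S (a : int) := \sum_(k < Q) f (a + k%:Z).
have shift b : S (b + 1) = S b.
  apply/eqP; rewrite -subr_eq0 /S -sumrB.
  rewrite -(big_mkord xpredT (fun k => f (b + 1 + k%:Z) - f (b + k%:Z))).
  rewrite (eq_bigr (fun k => f (b + k.+1%:Z) - f (b + k%:Z))); last first.
    by move=> k _; congr (f _ - _); lia.
  by rewrite telescope_sumr// f_periodic addr0 subrr.
have S0 : S 0 = 0.
  by have := f_sum; rewrite big_mkord => <-; apply: eq_bigr => k _; rewrite add0r.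
have Sn (n : nat) : S n%:Z = 0 /\ S (- n%:Z) = 0.
  elim: n => [|n [h1 h2]]; first by rewrite oppr0.
  split; first by rewrite -h1 -(shift n%:Z); congr S; lia.
  by rewrite -h2 -(shift (- n.+1%:Z)); congr S; lia.
by case: a => n; [have [] := Sn n|rewrite NegzE; have [] := Sn n.+1].
Qed.

Lemma f_norm y : `|f y| = 1.
Proof. by case: (f_sign y) => ->; rewrite ?normrN normr1. Qed.

Lemma periodic_sum_le (a : int) n : (0 < Q)%N ->
  `|\sum_(k < n) f (a + k%:Z)| <= Q%:R.
Proof.
move=> Q0; elim/ltn_ind: n a => n IH a; have [nQ|Qn] := ltnP n Q.
  apply: le_trans (ler_norm_sum _ _ _) _.
  rewrite (eq_bigr (fun=> 1)); last by move=> k _; exact: f_norm.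
  by rewrite sumr_const card_ord ler_nat ltnW.
have -> : \sum_(k < n) f (a + k%:Z) = \sum_(k < n - Q) f (a + Q%:Z + k%:Z).
  rewrite -(big_mkord xpredT (fun k => f (a + k%:Z))) (big_cat_nat (n := Q))//=.
  rewrite [X in X + _]big_mkord periodic_sum0 add0r.
  rewrite -{1}[Q]add0n big_addn big_mkord.
  by apply: eq_bigr => k _; congr f; rewrite PoszD; ring.
by apply: IH; rewrite ltn_subrL Q0; exact: leq_trans Qn.
Qed.

(** Abel summation: whole periods cancel, so the partial sums of [f] are at most [Q]. *)
Lemma periodic_abel_le (g : nat -> R) n : (0 < Q)%N ->
  `|\sum_(i < n) f i%:Z * g i| <=
  Q%:R * (`|g n| + \sum_(i < n) `|g i.+1 - g i|).
Proof.
move=> Q0; pose F m := \sum_(i < m) f i%:Z.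
have FQ m : `|F m| <= Q%:R.
  have := periodic_sum_le 0 m Q0.
  by under eq_bigr do rewrite add0r.
have -> : \sum_(i < n) f i%:Z * g i = F n * g n - \sum_(i < n) F i.+1 * (g i.+1 - g i).
  elim: n => [|m IH]; first by rewrite /F !big_ord0 mul0r subrr.
  have FS : F m.+1 = F m + f m%:Z by rewrite /F big_ord_recr.
  by rewrite !big_ord_recr IH /= FS; ring.
apply: le_trans (ler_normB _ _) _; rewrite mulrDr; apply: lerD.
  by rewrite normrM ler_wpM2r.
apply: le_trans (ler_norm_sum _ _ _) _; rewrite mulr_sumr.
by apply: ler_sum => i _; rewrite normrM ler_wpM2r.
Qed.

End PeriodicSums.

(** * Sums of independent signs: second moment, characteristic function, small balls *)

Section BernoulliExpectation.
Context {R : realType}.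
Variable q : nat -> R.
Hypothesis q01 : forall i, 0 <= q i <= 1 / 2.
Implicit Types (s : seq bool) (c : nat -> R) (G : seq bool -> R).

(* Expectation of G when the word s is continued by n independent bits, bit
   number i being true with probability q i. *)
Fixpoint bexp n s G : R :=
  if n is m.+1 then
    (1 - q (size s)) * bexp m (rcons s false) G + q (size s) * bexp m (rcons s true) G
  else G s.

Lemma ler_bexp n s G1 G2 :
  (forall s', size s' = (size s + n)%N -> G1 s' <= G2 s') -> bexp n s G1 <= bexp n s G2.
Proof.
elim: n s => [|n IH] s h /=; first by apply: h; rewrite addn0.
have := q01 (size s); set x := q _ => hx.
have h1 : bexp n (rcons s false) G1 <= bexp n (rcons s false) G2.
  by apply: IH => s' hs; apply: h; rewrite hs size_rcons addSnnS.
have h2 : bexp n (rcons s true) G1 <= bexp n (rcons s true) G2.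
  by apply: IH => s' hs; apply: h; rewrite hs size_rcons addSnnS.
by apply: lerD; apply: ler_wpM2l => //; lra.
Qed.

Lemma bexp_sum n s (I : finType) (a : R) (G : I -> seq bool -> R) :
  bexp n s (fun s' => a * \sum_i G i s') = a * \sum_i bexp n s (G i).
Proof.
elim: n s => [//|n IH] s /=.
by rewrite !IH big_split /= -!mulr_sumr; ring.
Qed.

Definition zval c s : R := \sum_(i < size s) c i * (if nth false s i then -1 else 1).

Lemma zval_rcons c s b :
  zval c (rcons s b) = zval c s + c (size s) * (if b then -1 else 1).
Proof.
rewrite /zval size_rcons big_ord_recr /= nth_rcons ltnn eqxx; congr (_ + _).
by apply: eq_bigr => i _; rewrite nth_rcons ltn_ord.
Qed.

(** Squared mean plus variance: a sign flipped with probability [q] has mean [1 - 2 q] and variance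
    [4 q (1 - q)]. *)
Lemma bexp_sqr n s c : bexp n s (fun s' => zval c s' ^+ 2) =
  (zval c s + \sum_(size s <= i < size s + n) c i * (1 - 2 * q i)) ^+ 2
  + \sum_(size s <= i < size s + n) 4 * q i * (1 - q i) * c i ^+ 2.
Proof.
elim: n s => [|n IH] s /=; first by rewrite addn0 !big_geq// !addr0.
rewrite !IH !size_rcons !zval_rcons addSnnS.
have sn : (size s < size s + n.+1)%N by rewrite addnS ltnS leq_addr.
have e F : \sum_(size s <= i < size s + n.+1) F i = F (size s)
    + \sum_((size s).+1 <= i < size s + n.+1) F i :> R by rewrite big_ltn.
rewrite !e.
by set M := \sum_(_ <= _ < _) _; set V := \sum_(_ <= _ < _) _; ring.
Qed.

(** [A + iB] is the characteristic function of the bits still to come, a product of factors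
    [cos + i (1 - 2 q) sin]. One pair serves all words of length [m], as the induction requires. *)
Lemma bexp_char n m c (th : R) : exists A B,
  A ^+ 2 + B ^+ 2 = \prod_(m <= i < m + n)
        (1 - 4 * q i * (1 - q i) * sin (th * c i) ^+ 2) /\
  forall s, size s = m ->
    bexp n s (fun s' => cos (th * zval c s')) =
      A * cos (th * zval c s) - B * sin (th * zval c s) /\
    bexp n s (fun s' => sin (th * zval c s')) =
      A * sin (th * zval c s) + B * cos (th * zval c s).
Proof.
elim: n m => [|n IH] m /=.
  by exists 1, 0; rewrite addn0 big_geq//; split=> [|s _]; [ring|split; ring].
have [A [B [hAB h]]] := IH m.+1.
have sq := cos2Dsin2 (th * c m); set C := cos (th * c m) in sq *.
set S := sin (th * c m) in sq *.
exists (A * C - (1 - 2 * q m) * B * S), (A * (1 - 2 * q m) * S + B * C); split.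
  rewrite big_ltn ?addnS ?ltnS ?leq_addr// -addSn -hAB -/S.
  transitivity ((A ^+ 2 + B ^+ 2) * (C ^+ 2 + (1 - 2 * q m) ^+ 2 * S ^+ 2)); first by ring.
  have C2 : C ^+ 2 = 1 - S ^+ 2 by lra.
  by rewrite C2; ring.
move=> s sm; have [h1 h2] := h (rcons s false) (ltac:(by rewrite size_rcons sm)).
have [h3 h4] := h (rcons s true) (ltac:(by rewrite size_rcons sm)).
rewrite h1 h2 h3 h4 !zval_rcons sm mulr1 mulrN1 (mulrDr th _ (c m)) (mulrBr th _ (c m)) cosD cosB sinD sinB -/C -/S.
by split; ring.
Qed.

(** Induction on [(1 - x) (1 + x + s) <= 1 + s]; this decay is enough and needs no exponential. *)
Lemma prod_1B_le (I : Type) (r : seq I) (x : I -> R) : (forall i, 0 <= x i <= 1) ->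
  \prod_(i <- r) (1 - x i) <= (1 + \sum_(i <- r) x i)^-1.
Proof.
move=> x01.
suff [h0 h1] : 0 <= \prod_(i <- r) (1 - x i) /\
    \prod_(i <- r) (1 - x i) * (1 + \sum_(i <- r) x i) <= 1.
  have s0 : 0 < 1 + \sum_(i <- r) x i.
    by rewrite ltr_wpDr// sumr_ge0// => i _; have /andP[] := x01 i.
  by rewrite -[leRHS]mul1r ler_pdivlMr.
elim: r => [|i r [IH0 IH]]; first by rewrite !big_nil addr0 mulr1.
rewrite !big_cons; have /andP[xi0 xi1] := x01 i.
set p := \prod_(_ <- _) _ in IH0 IH *; set s := \sum_(_ <- _) _ in IH *.
have s0 : 0 <= s by rewrite sumr_ge0// => k _; have /andP[] := x01 k.
split; first by rewrite mulr_ge0// subr_ge0.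
have : 0 <= p * x i * (s + x i).
  by rewrite !mulr_ge0// addr_ge0.
have -> : (1 - x i) * p * (1 + (x i + s)) = p * (1 + s) - p * x i * (s + x i) by ring.
lra.
Qed.

(** [A <= (eps + A ^ 2 / eps) / 2] avoids the square root of the product, and [4 q (1 - q) >= 2 q]
    since [q <= 1/2]. *)
Lemma bexp_char_le n c (th eps : R) : 0 < eps ->
  bexp n [::] (fun s => cos (th * zval c s)) <=
  (eps + eps^-1 * (1 + \sum_(i < n) 2 * q i * sin (th * c i) ^+ 2)^-1) / 2.
Proof.
move=> e0; have [A [B [hAB /(_ [::] erefl) [-> _]]]] := bexp_char n 0 c th.
rewrite /zval big_ord0 mulr0 cos0 sin0 mulr1 mulr0 subr0.
have hx i : 0 <= 4 * q i * (1 - q i) * sin (th * c i) ^+ 2 <= 1.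
  have /andP[q0 q1] := q01 i; have h1 := sin2cos2 (th * c i).
  have := sqr_ge0 (sin (th * c i)); have := sqr_ge0 (cos (th * c i)).
  set x := sin _ ^+ 2 in h1 *; move=> h2 h3; have x1 : x <= 1 by lra.
  have h4 : 0 <= 4 * q i * (1 - q i) by apply: mulr_ge0; lra.
  have h5 : 4 * q i * (1 - q i) <= 1 by have := sqr_ge0 (1 - 2 * q i); lra.
  apply/andP; split; first exact: mulr_ge0.
  by have := ler_wpM2r h3 h5; lra.
have A2 : A ^+ 2 <= (1 + \sum_(i < n) 2 * q i * sin (th * c i) ^+ 2)^-1.
  apply: (@le_trans _ _ (A ^+ 2 + B ^+ 2)); first by rewrite lerDl sqr_ge0.
  rewrite hAB add0n; apply: le_trans (prod_1B_le _ hx) _.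
  have pos (F : nat -> R) : (forall i, 0 <= F i) -> 0 < 1 + \sum_(i < n) F i.
    by move=> F0; rewrite ltr_wpDr// sumr_ge0.
  have p1 := pos (fun i => 4 * q i * (1 - q i) * sin (th * c i) ^+ 2)
    (fun i => proj1 (elimT andP (hx i))).
  have p2 : 0 < 1 + \sum_(i < n) 2 * q i * sin (th * c i) ^+ 2.
    apply: (pos (fun i => 2 * q i * sin (th * c i) ^+ 2)) => i.
    by have /andP[q0 _] := q01 i; apply: mulr_ge0; [lra|exact: sqr_ge0].
  rewrite big_mkord lef_pV2 ?posrE// lerD2l; apply: ler_sum => i _.
  apply: ler_wpM2r; first exact: sqr_ge0.
  by have /andP[q0 q1] := q01 i; nra.
have : eps^-1 * A ^+ 2 <= eps^-1 * (1 + \sum_(i < n) 2 * q i * sin (th * c i) ^+ 2)^-1.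
  by rewrite ler_wpM2l// invr_ge0 ltW.
suff : A <= (eps + eps^-1 * A ^+ 2) / 2 by lra.
rewrite -subr_ge0.
have -> : (eps + eps^-1 * A ^+ 2) / 2 - A = eps^-1 * (A - eps) ^+ 2 / 2.
  by field; rewrite gt_eqF.
by rewrite divr_ge0// mulr_ge0 ?sqr_ge0// invr_ge0 ltW.
Qed.

(* Esseen's inequality with the Fejer kernel: on the event the kernel is at
   least 1/4. *)
Lemma small_ball n c (h s : R) N (a : nat -> R) : (0 < N)%N -> 0 <= s ->
  N%:R * s * h <= 1 -> (forall m, 0 <= a m) ->
  (forall m, (m < N)%N -> bexp n [::] (fun w => cos (m%:R * s * zval c w)) <= a m) ->
  bexp n [::] (fun w => (`|zval c w| <= h)%R%:R) <= 8 / N%:R * \sum_(m < N) a m.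
Proof.
move=> N0 s0 Nsh a0 ha; have NR : 0 < N%:R :> R by rewrite ltr0n.
apply: (@le_trans _ _ (4 / N%:R ^+ 2 * \sum_(k < N) \sum_(k' < N)
   bexp n [::] (fun w => cos (`|k - k'|%N%:R * s * zval c w)))).
  rewrite pair_big /= -bexp_sum; apply: ler_bexp => w _.
  rewrite -(pair_big xpredT xpredT
    (fun k k' : 'I_N => cos (`|k - k'|%N%:R * s * zval c w))) /=.
  under eq_bigr => k _ do under eq_bigr => k' _ do rewrite -mulrA -cos_distn.
  rewrite fejer_sum; set S1 := \sum_(_ < _) _; set S2 := \sum_(_ < _) _.
  have N4 : 0 <= 4 / N%:R ^+ 2 :> R by rewrite divr_ge0// sqr_ge0.
  have [zh|_] := lerP `|zval c w| h; last by rewrite mulr0n mulr_ge0// addr_ge0 ?sqr_ge0.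
  have hS : N%:R / 2 <= S1.
    rewrite -[N in N%:R]card_ord -sumr_const mulr_suml; apply: ler_sum => k _.
    rewrite -cos_norm; apply: cos_ge_half; rewrite normr_ge0 /=.
    rewrite mulrA normrM (@ger0_norm _ (_ * _)) ?mulr_ge0//; apply: le_trans Nsh.
    apply: ler_pM; rewrite ?mulr_ge0//.
    by rewrite ler_wpM2r// ler_nat ltnW.
  have : 4 / N%:R ^+ 2 * (N%:R / 2) ^+ 2 <= 4 / N%:R ^+ 2 * (S1 ^+ 2 + S2 ^+ 2).
    apply: ler_wpM2l => //; apply: ler_wpDr; first exact: sqr_ge0.
    by rewrite ler_pXn2r ?nnegrE ?divr_ge0// (le_trans _ hS) ?divr_ge0.
  apply: le_trans; rewrite le_eqVlt; apply/orP; left; apply/eqP.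
  by rewrite (_ : true%:R = 1)//; field; rewrite gt_eqF.
have -> : 8 / N%:R * \sum_(m < N) a m =
    4 / N%:R ^+ 2 * \sum_(k < N) (2 * \sum_(m < N) a m).
  rewrite sumr_const card_ord -(mulr_natl (2 * _) N); field.
  by rewrite gt_eqF.
rewrite ler_wpM2l ?divr_ge0 ?sqr_ge0//; apply: ler_sum => k _.
apply: le_trans (sum_distn_le a0 (ltn_ord k)); apply: ler_sum => k' _; apply: ha.
have [h1|h1] := leqP k k'.
  by rewrite distnEr//; apply: leq_ltn_trans (leq_subr _ _) (ltn_ord _).
by rewrite distnEl ?(ltnW h1)//; apply: leq_ltn_trans (leq_subr _ _) (ltn_ord _).
Qed.

End BernoulliExpectation.

(** * Estimates at one scale *)

Section Scales.
Context {R : realType}.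
Variables (Q : nat) (f : int -> R) (q : nat -> R) (M4 : nat) (sig c : R).
Hypothesis Q0 : (0 < Q)%N.
Hypothesis f_sign : forall y, f y = -1 \/ f y = 1.
Hypothesis f_periodic : forall y, f (y + Q%:Z) = f y.
Hypothesis f_sum : \sum_(0 <= k < Q) f k%:Z = 0.
Hypothesis q01 : forall i, 0 <= q i <= 1 / 2.
Hypothesis q_noninc : forall i, (0 < i)%N -> q i.+1 <= q i.
Hypothesis M40 : (0 < M4)%N.
Hypothesis sig64 : 64 <= sig.
Hypothesis c0 : 0 < c.
Local Notation M := (4 * M4)%N.
(** In the application [sig ^ 2] is [M^(1 - beta)]: both bounds say that [q i] behaves like [c / 2]
    times [i^(-beta)], compared at powers of [M]. *)
Hypothesis q_low : forall j i, (0 < i <= M ^ j)%N ->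
  c / 2 * sig ^+ (2 * j) <= q i * (M ^ j)%:R.
Hypothesis q_up : forall j i, (M ^ j <= i)%N ->
  q i * (M ^ j)%:R <= c / 2 * sig ^+ (2 * j).

Lemma M_gt1 : (1 < M)%N. Proof. exact: leq_trans (leq_pmulr 4 M40). Qed.

Lemma Mj_gt0 j : (0 < M ^ j)%N. Proof. by rewrite expn_gt0 muln_gt0 M40. Qed.

Lemma sig_ge1 n : 1 <= sig ^+ n.
Proof. by rewrite exprn_ege1//; move: sig64; lra. Qed.

(** Over the scales the expected number of flips grows at least by a factor 2, so the last scale
    dominates. *)
Lemma sum_q_le j : \sum_(1 <= i < M ^ j) q i <= c / 2 * M%:R * sig ^+ (2 * j).
Proof.
have M0 : 0 <= c / 2 * M%:R by rewrite mulr_ge0// divr_ge0// ltW.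
elim: j => [|j IH].
  by rewrite expn0 big_geq// muln0 expr0 mulr1.
have h1 : (1 <= M ^ j)%N by exact: Mj_gt0.
have h2 : (M ^ j <= M ^ j.+1)%N by rewrite leq_exp2l ?M_gt1.
rewrite (big_cat_nat h1 h2) /=.
have h3 : \sum_(M ^ j <= i < M ^ j.+1) q i <= c / 2 * M%:R * sig ^+ (2 * j).
  have Mj : 0 < (M ^ j)%:R :> R by rewrite ltr0n Mj_gt0.
  apply: (@le_trans _ _ (\sum_(M ^ j <= i < M ^ j.+1) (c / 2 * sig ^+ (2 * j) / (M ^ j)%:R))).
    by apply: ler_sum_nat => i /andP[hi _]; rewrite ler_pdivlMr// q_up.
  have x0 : 0 <= c / 2 * sig ^+ (2 * j) / (M ^ j)%:R.
    by rewrite !mulr_ge0 ?invr_ge0 ?(ltW c0) ?exprn_ge0//; move: sig64; lra.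
  rewrite sumr_const_nat -[leLHS]mulr_natr.
  apply: (@le_trans _ _ (c / 2 * sig ^+ (2 * j) / (M ^ j)%:R * (M ^ j.+1)%:R)).
    by rewrite ler_wpM2l// ler_nat leq_subr.
  rewrite expnS (natrM _ M); move: (M%:R) => m.
  by rewrite le_eqVlt; apply/orP; left; apply/eqP; field; rewrite gt_eqF.
have h4 : 2 * sig ^+ (2 * j) <= sig ^+ (2 * j.+1).
  rewrite mulnS exprD; apply: ler_wpM2r; last by move: sig64; nra.
  by rewrite (le_trans ler01)// sig_ge1.
have := ler_wpM2l M0 h4; lra.
Qed.

Variable j : nat.
Local Notation L := (M ^ j)%N.

(** Coefficients of [tent_sum] at [y] as a linear form in the flip signs. *)
Definition prefix_weight (y i : nat) : R := (i < y)%N%:R * (tent L i * f i%:Z).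

Lemma f_sqr i : f i ^+ 2 = 1.
Proof. by case: (f_sign i) => ->; ring. Qed.

Lemma prefix_weight_sqr y i : prefix_weight y i ^+ 2 <= L%:R ^+ 2.
Proof.
rewrite /prefix_weight !exprMn f_sqr mulr1.
have h : tent L i ^+ 2 <= L%:R ^+ 2 :> R.
  by rewrite ler_pXn2r ?nnegrE ?tent_ge0 ?tent_le.
case: (i < y)%N; first by rewrite expr1n mul1r.
by rewrite expr0n mul0r sqr_ge0.
Qed.

(** By Abel summation the mean costs only the last value and the total variation of
    [tent * (1 - 2 q)]: the value, the slopes of the tent and the decrease of [q] contribute at most
    [L] each. *)
Lemma prefix_mean_le y : (y <= L)%N ->
  `|\sum_(i < L) prefix_weight y i * (1 - 2 * q i)| <= 3 * Q%:R * L%:R.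
Proof.
move=> yL; pose g i := tent L i * (1 - 2 * q i).
have -> : \sum_(i < L) prefix_weight y i * (1 - 2 * q i) = \sum_(i < y) f i%:Z * g i.
  rewrite (big_ord_widen L (fun i => f i%:Z * g i) yL) [RHS]big_mkcond /=.
  apply: eq_bigr => i _; rewrite /prefix_weight /g.
  by case: (i < y)%N => /=; rewrite ?mul1r ?mul0r; ring.
apply: le_trans (periodic_abel_le f_sign f_periodic f_sum g y Q0) _.
have -> : 3 * Q%:R * L%:R = Q%:R * (L%:R + (L%:R + L%:R)) :> R by ring.
have q1 i : 0 <= 1 - 2 * q i <= 1 by have /andP[? ?] := q01 i; apply/andP; split; lra.
rewrite ler_wpM2l//; apply: lerD.
  have /andP[h1 h2] := q1 y.
  rewrite /g normrM !ger0_norm ?tent_ge0// -[leRHS]mulr1.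
  by apply: ler_pM => //; exact: tent_le.
(* Monotonicity of [q] is known from index 1 on only; at index 0 the tent vanishes. *)
have step i : `|g i.+1 - g i| <= 1 + L%:R * (if i == 0%N then 0 else 2 * (q i - q i.+1)).
  have -> : g i.+1 - g i = (tent L i.+1 - tent L i) * (1 - 2 * q i.+1)
      + tent L i * (2 * (q i - q i.+1)) by rewrite /g; ring.
  apply: le_trans (ler_normD _ _) _; apply: lerD.
    have /andP[h1 h2] := q1 i.+1; rewrite normrM -[leRHS]mulr1.
    by apply: ler_pM => //; [exact: tentS|rewrite ger0_norm].
  case: i => [|i] /=; first by rewrite tent0 mul0r normr0 mulr0.
  have qd : 0 <= 2 * (q i.+1 - q i.+2) by have := @q_noninc i.+1 isT; lra.
  rewrite normrM (ger0_norm (tent_ge0 _ _)) (ger0_norm qd).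
  by rewrite ler_wpM2r ?tent_le.
apply: (@le_trans _ _ (\sum_(i < y) (1 + L%:R * (if i == 0%N :> nat then 0 else 2 * (q i - q i.+1))))).
  by apply: ler_sum => i _; exact: step.
rewrite big_split /= sumr_const card_ord -mulr_sumr; apply: lerD; first by rewrite ler_nat.
rewrite -[leRHS]mulr1 ler_wpM2l//.
suff : \sum_(i < y) (if i == 0%N :> nat then 0 else 2 * (q i - q i.+1)) <=
    1 - 2 * q y + (if y == 0%N then 2 * q y else 0).
  case: (y == 0%N); have /andP[? ?] := q01 y; lra.
elim: (y) => [|m IH]; first by rewrite big_ord0 eqxx; lra.
rewrite big_ord_recr /=; case: m IH => [|m] /= IH; last by lra.
by rewrite big_ord0 /=; have /andP[? ?] := q01 1%N; lra.
Qed.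

Definition moment_const : R := 9 * Q%:R ^+ 2 + 2 + 2 * c * M%:R.

Lemma prefix_second_moment y : (y <= L)%N ->
  bexp q L [::] (fun s => zval (prefix_weight y) s ^+ 2) <=
  moment_const * (L%:R ^+ 2 * sig ^+ (2 * j)).
Proof.
move=> yL; rewrite bexp_sqr /= add0n /zval big_ord0 add0r big_mkord.
have L2 : 0 <= L%:R ^+ 2 :> R by exact: sqr_ge0.
have s1 := sig_ge1 (2 * j).
have h1 : (\sum_(i < L) prefix_weight y i * (1 - 2 * q i)) ^+ 2 <=
    9 * Q%:R ^+ 2 * L%:R ^+ 2.
  have := prefix_mean_le yL; rewrite ler_norml => /andP[h h'].
  set x := \sum_(_ < _) _ in h h' *; set b := 3 * Q%:R * L%:R in h h'.
  have -> : 9 * Q%:R ^+ 2 * L%:R ^+ 2 = b ^+ 2 by rewrite /b; ring.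
  nra.
have h2 : \sum_(0 <= i < L) 4 * q i * (1 - q i) * prefix_weight y i ^+ 2 <=
    4 * L%:R ^+ 2 * (1 / 2 + c / 2 * M%:R * sig ^+ (2 * j)).
  apply: (@le_trans _ _ (\sum_(0 <= i < L) 4 * L%:R ^+ 2 * q i)).
    apply: ler_sum => i _; have /andP[q0 q1] := q01 i.
    have := prefix_weight_sqr y i; have := sqr_ge0 (prefix_weight y i).
    set x := prefix_weight y i ^+ 2 => x0 xL.
    have e1 : q i * (1 - q i) <= q i by nra.
    have e2 : 0 <= q i * (1 - q i) by nra.
    by have := ler_pM e2 x0 e1 xL; lra.
  rewrite -mulr_sumr ler_wpM2l ?mulr_ge0//.
  rewrite big_ltn ?Mj_gt0//; apply: lerD; last exact: sum_q_le.
  by have /andP[_] := q01 0%N.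
have h3 : L%:R ^+ 2 <= L%:R ^+ 2 * sig ^+ (2 * j) :> R by rewrite ler_peMr.
have h4 : 9 * Q%:R ^+ 2 * L%:R ^+ 2 <= 9 * Q%:R ^+ 2 * (L%:R ^+ 2 * sig ^+ (2 * j)).
  by rewrite ler_wpM2l// mulr_ge0// sqr_ge0.
by rewrite /moment_const; lra.
Qed.

Definition energy_bad (s : seq bool) : bool :=
  L%:R ^+ 3 * sig ^+ (2 * j) * 2 ^+ j <
  \sum_(y < L.+1) zval (prefix_weight y) s ^+ 2.

(** Markov's inequality, the expected sum over the [L.+1] prefixes being at most
    [2 * moment_const * L ^ 3 * sig ^ (2 j)]. *)
Lemma energy_bad_prob :
  bexp q L [::] (fun s => (energy_bad s)%:R) <= 2 * moment_const / 2 ^+ j.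
Proof.
have L0 : 0 < L%:R :> R by rewrite ltr0n Mj_gt0.
have s0 : 0 < sig ^+ (2 * j) by apply: lt_le_trans (sig_ge1 _).
have p0 : 0 < 2 ^+ j :> R by rewrite exprn_gt0.
pose thr := L%:R ^+ 3 * sig ^+ (2 * j) * 2 ^+ j.
have t0 : 0 < thr by rewrite !mulr_gt0// exprn_gt0.
have mc0 : 0 <= moment_const.
  rewrite /moment_const; have := sqr_ge0 (Q%:R : R).
  have : 0 <= 2 * c * M%:R by rewrite mulr_ge0// mulr_ge0// ltW.
  by lra.
apply: (@le_trans _ _ (bexp q L [::] (fun s => thr^-1 *
    \sum_(y < L.+1) zval (prefix_weight y) s ^+ 2))).
  apply: (ler_bexp q01) => s _.
  have S0 : 0 <= \sum_(y < L.+1) zval (prefix_weight y) s ^+ 2.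
    by apply: sumr_ge0 => y _; exact: sqr_ge0.
  case bad : (energy_bad s); last by rewrite mulr_ge0// invr_ge0 ltW.
  by rewrite mulrC ler_pdivlMr// mul1r ltW.
rewrite bexp_sum.
apply: (@le_trans _ _ (thr^-1 * \sum_(y < L.+1) moment_const * (L%:R ^+ 2 * sig ^+ (2 * j)))).
  rewrite ler_wpM2l ?invr_ge0 ?(ltW t0)//; apply: ler_sum => y _.
  by apply: prefix_second_moment; rewrite -ltnS.
rewrite sumr_const card_ord -[X in _ * X <= _]mulr_natr.
have hL : L.+1%:R <= 2 * L%:R :> R.
  have L1 : 1 <= L%:R :> R by rewrite ler1n Mj_gt0.
  by rewrite -natr1; lra.
apply: (@le_trans _ _ (thr^-1 * (moment_const * (L%:R ^+ 2 * sig ^+ (2 * j)) * (2 * L%:R)))).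
  rewrite ler_wpM2l ?invr_ge0 ?(ltW t0)// ler_wpM2l//.
  by rewrite mulr_ge0// mulr_ge0 ?sqr_ge0// ltW.
rewrite /thr le_eqVlt; apply/orP; left; apply/eqP; field.
by rewrite !gt_eqF.
Qed.

(** About [sig ^ (2 j)] flips with weights of order [L] give the sum the natural size [L * sig ^ j];
    the factor [4 ^ -j] makes the event rare enough to be summable. *)
Definition mass_bad (s : seq bool) : bool :=
  `|zval (prefix_weight L) s| <= L%:R * sig ^+ j / 4 ^+ j.

(** Comparison with the telescoping [2 / (b x (x + 1))], as [x (x + 1) <= 2 x ^ 2] for [x >= 1]. *)
Lemma sum_inv_sqr_le (b : R) n : 0 < b ->
  \sum_(m < n) (1 + b * m%:R ^+ 2)^-1 <= 1 + 2 / b.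
Proof.
move=> b0; case: n => [|n]; first by rewrite big_ord0 addr_ge0// divr_ge0// ltW.
suff : \sum_(m < n.+1) (1 + b * m%:R ^+ 2)^-1 <= 1 + 2 / b - 2 / b / n.+1%:R.
  by move/le_trans; apply; rewrite gerBl !divr_ge0// ltW.
elim: n => [|n IH].
  by rewrite big_ord_recr big_ord0 /= expr0n mulr0 addr0 invr1; lra.
rewrite big_ord_recr /=.
suff h : (1 + b * n.+1%:R ^+ 2)^-1 <= 2 / b / n.+1%:R - 2 / b / n.+2%:R.
  by apply: le_trans (lerD IH h) _; rewrite addrA subrK.
have n1 : 1 <= n.+1%:R :> R by rewrite ler1n.
rewrite -[n.+2%:R]natr1; set x := n.+1%:R in n1 *.
have x0 : 0 < x by lra.
have -> : 2 / b / x - 2 / b / (x + 1) = (b * x * (x + 1) / 2)^-1.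
  by field; rewrite !gt_eqF//; lra.
rewrite lef_pV2 ?posrE.
- have : 0 <= b * (x * (x - 1)) by rewrite !mulr_ge0 ?(ltW b0) ?(ltW x0)//; lra.
  by lra.
- by apply: ltr_wpDr => //; rewrite mulr_ge0 ?sqr_ge0 ?(ltW b0).
- by rewrite divr_gt0// !mulr_gt0//; lra.
Qed.

(** Only the middle half is kept, where the tent is at least [L / 4]; its ends are integers because
    4 divides [M]. The arguments stay in [[-1, 1]], where the sine is at least half of its argument
    in absolute value. *)
Lemma mid_sin_sum (s : R) (m : nat) : (0 < j)%N -> 0 <= s -> m%:R * s * L%:R <= 1 ->
  c * sig ^+ (2 * j) * (m%:R * s * L%:R) ^+ 2 / 128 <=
  \sum_(i < L) 2 * q i * sin (m%:R * s * prefix_weight L i) ^+ 2.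
Proof.
move=> j0 s0 ms1.
pose L4 := (M ^ j.-1 * M4)%N.
have LE : L = (4 * L4)%N.
  by rewrite /L4 -{1}(prednK j0) expnS -mulnA (mulnC M4).
have L40 : (0 < L4)%N by rewrite muln_gt0 Mj_gt0.
have LR : L%:R = 4 * L4%:R :> R by rewrite LE natrM.
have L0 : 0 < L%:R :> R by rewrite ltr0n Mj_gt0.
have sg0 : 0 <= sig ^+ (2 * j) by apply: le_trans (sig_ge1 _).
set x := m%:R * s.
have x0 : 0 <= x by rewrite mulr_ge0.
pose low := c * sig ^+ (2 * j) / L%:R * (x * L4%:R / 2) ^+ 2.
have low0 : 0 <= low.
  by apply: mulr_ge0; [rewrite divr_ge0// mulr_ge0// ltW|exact: sqr_ge0].
have term i : (L4 <= i < 3 * L4)%N ->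
   low <= 2 * q i * sin (x * prefix_weight L i) ^+ 2.
  move=> /andP[h1 h2].
  have i0 : (0 < i)%N by exact: leq_trans L40 h1.
  have iL : (i < L)%N by rewrite LE; apply: leq_trans h2 _; rewrite leq_mul2r orbT.
  have -> : sin (x * prefix_weight L i) ^+ 2 = sin (x * tent L i) ^+ 2.
    rewrite /prefix_weight iL mul1r.
    by case: (f_sign i) => ->; rewrite ?mulrN1 ?mulr1// mulrN sinN sqrrN.
  have tlow : L4%:R <= tent L i :> R.
    by rewrite /tent ler_nat leq_min h1 /= LE; move: h2; clear; lia.
  have xt : x * L4%:R <= x * tent L i by rewrite ler_wpM2l.
  have xt0 : 0 <= x * L4%:R by rewrite mulr_ge0.
  have xt1 : x * tent L i <= 1.
    by apply: le_trans ms1; rewrite ler_wpM2l// tent_le.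
  have : x * tent L i / 2 <= sin (x * tent L i).
    by apply: sin_ge_half; rewrite xt1 (le_trans xt0 xt).
  move=> hs; have hs2 : (x * L4%:R / 2) ^+ 2 <= sin (x * tent L i) ^+ 2.
    by rewrite ler_pXn2r ?nnegrE//; lra.
  have ql : c * sig ^+ (2 * j) / L%:R <= 2 * q i.
    have := q_low (ltac:(by rewrite i0 ltnW) : (0 < i <= M ^ j)%N).
    by rewrite ler_pdivrMr//; lra.
  apply: ler_pM => //; [by rewrite divr_ge0// mulr_ge0// ltW|exact: sqr_ge0].
have t0 i : 0 <= 2 * q i * sin (x * prefix_weight L i) ^+ 2.
  by have /andP[? _] := q01 i; apply: mulr_ge0; [lra|exact: sqr_ge0].
rewrite -(big_mkord xpredT (fun i => 2 * q i * sin (x * prefix_weight L i) ^+ 2)).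
have h1 : (L4 <= 3 * L4)%N by rewrite leq_pmull.
have h2 : (3 * L4 <= L)%N by rewrite LE leq_mul2r orbT.
rewrite (big_cat_nat (n := L4)) ?(leq_trans h1 h2)//= ler_wpDl ?sumr_ge0//.
rewrite (big_cat_nat h1 h2) /= ler_wpDr ?sumr_ge0//.
apply: (@le_trans _ _ (\sum_(L4 <= i < 3 * L4) low)); last by apply: ler_sum_nat.
rewrite sumr_const_nat -[leRHS]mulr_natr.
have -> : (3 * L4 - L4 = 2 * L4)%N by clear; lia.
rewrite natrM /low LR le_eqVlt; apply/orP; left; apply/eqP; field.
by rewrite pnatr_eq0 -lt0n.
Qed.

Lemma mass_bad_prob : (0 < j)%N ->
  bexp q L [::] (fun s => (mass_bad s)%:R) <= (12 + 2048 / c) / 2 ^+ j.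
Proof.
move=> j0; have L0 : 0 < L%:R :> R by rewrite ltr0n Mj_gt0.
have sg1 := sig_ge1 j; have sg0 : 0 < sig ^+ j by exact: lt_le_trans sg1.
(* [N] is [4 ^ j / 2]: then [N * s] times the threshold is 1/2, and [N <= sig ^ j] keeps the
   arguments of the sine at most 1. *)
pose N := (2 * 4 ^ j.-1)%N; pose s := (L%:R * sig ^+ j)^-1.
have s0 : 0 < s by rewrite invr_gt0 mulr_gt0.
have NE : N%:R = 4 ^+ j / 2 :> R.
  by rewrite /N -{2}(prednK j0) exprS natrM natrX; field.
have N0 : (0 < N)%N by rewrite muln_gt0 expn_gt0.
have p4 : 0 < 4 ^+ j :> R by rewrite exprn_gt0.
have p2 : 0 < 2 ^+ j :> R by rewrite exprn_gt0.
have p42 : 4 ^+ j = 2 ^+ j * 2 ^+ j :> R by rewrite -exprMn; congr (_ ^+ _); ring.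
have b0 : 0 < c / 128 by rewrite divr_gt0.
(* This is [eps = 2 ^ -j]. Averaged over [N], of order [4 ^ j], the summable second term is also of
   order [2 ^ -j]. *)
pose a (m : nat) := ((2 ^+ j)^-1 + 2 ^+ j * (1 + c / 128 * m%:R ^+ 2)^-1) / 2.
have den0 m : 0 < 1 + c / 128 * m%:R ^+ 2.
  by apply: ltr_wpDr => //; rewrite mulr_ge0 ?sqr_ge0 ?(ltW b0).
have a0 m : 0 <= a m.
  by rewrite divr_ge0// addr_ge0 ?invr_ge0 ?(ltW p2)// mulr_ge0 ?invr_ge0 ?(ltW (den0 m)) ?(ltW p2).
have Nsh : N%:R * s * (L%:R * sig ^+ j / 4 ^+ j) <= 1.
  rewrite NE (_ : _ * _ = 1 / 2); first by lra.
  by rewrite /s; field; rewrite !gt_eqF.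
have N_le : N%:R <= sig ^+ j.
  rewrite NE; apply: (@le_trans _ _ (4 ^+ j)); first by lra.
  by rewrite ler_pXn2r ?nnegrE//; move: sig64; lra.
have ha m : (m < N)%N ->
    bexp q L [::] (fun w => cos (m%:R * s * zval (prefix_weight L) w)) <= a m.
  move=> mN; have e0 : 0 < (2 ^+ j)^-1 :> R by rewrite invr_gt0.
  apply: le_trans (bexp_char_le q01 _ _ _ e0) _; rewrite invrK /a.
  rewrite ler_wpM2r// lerD2l; apply: ler_wpM2l; first exact: ltW.
  have mR : m%:R <= N%:R :> R by rewrite ler_nat ltnW.
  have ms1 : m%:R * s * L%:R <= 1.
    have -> : m%:R * s * L%:R = m%:R / sig ^+ j by rewrite /s; field; rewrite !gt_eqF.
    by rewrite ler_pdivrMr// mul1r (le_trans mR).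
  have := mid_sin_sum j0 (ltW s0) ms1.
  have -> : c * sig ^+ (2 * j) * (m%:R * s * L%:R) ^+ 2 / 128 = c / 128 * m%:R ^+ 2.
    by rewrite /s mulnC exprM; field; rewrite !gt_eqF.
  move=> h; rewrite lef_pV2 ?posrE ?lerD2l//; apply: lt_le_trans (den0 m) _.
  by rewrite lerD2l.
apply: le_trans (small_ball q01 N0 (ltW s0) Nsh a0 ha) _.
rewrite /a -mulr_suml big_split /= sumr_const card_ord -mulr_sumr.
rewrite -[X in _ * ((X + _) / _)]mulr_natr.
have h := sum_inv_sqr_le N b0; set S := \sum_(_ < _) _ in h *.
have NR0 : 0 < N%:R :> R by rewrite ltr0n.
apply: (@le_trans _ _ (8 / N%:R * (((2 ^+ j)^-1 * N%:R + 2 ^+ j * (1 + 2 / (c / 128))) / 2))).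
  rewrite ler_wpM2l ?divr_ge0 ?(ltW NR0)// ler_wpM2r// lerD2l.
  by rewrite ler_wpM2l// ltW.
rewrite NE p42 le_eqVlt; apply/orP; left; apply/eqP; field.
by rewrite !gt_eqF.
Qed.

End Scales.

Lemma scale_ratio_le (R : realFieldType) (m S : R) : 0 < m -> 64 ^+ 2 <= S ->
  (64 * m) ^+ 2 * 16 / (m * S) <= 32 * m.
Proof.
move=> m0 S0; have S1 : 0 < S by apply: lt_le_trans S0; exact: exprn_gt0.
rewrite ler_pdivrMr ?mulr_gt0//.
have m2 : 0 <= m ^+ 2 by exact: sqr_ge0.
have -> : (64 * m) ^+ 2 * 16 = 64 ^+ 2 * (16 * m ^+ 2) by rewrite exprMn; ring.
have -> : 32 * m * (m * S) = S * (32 * m ^+ 2) by ring.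
by apply: ler_pM => //; [rewrite mulr_ge0|lra].
Qed.

(** * The frequency bound outside the two bad events *)

Section GoodEnvironment.
Context {R : realType}.
Variables (f dir : int -> R) (bit : nat -> bool) (M4 : nat) (sig : R) (j : nat).
Hypothesis dir_sign : forall y, dir y = -1 \/ dir y = 1.
Hypothesis dirE : forall i : nat, dir i%:Z = f i%:Z * (if bit i then -1 else 1).
Hypothesis M40 : (0 < M4)%N.
Hypothesis sig64 : 64 <= sig.
Local Notation M := (4 * M4)%N.
Local Notation L := (M ^ j)%N.
Local Notation K := (64 * M)%N.

Lemma tent_sum_zval y : (y <= L)%N ->
  tent_sum dir L y = zval (prefix_weight f M4 j y) (mkseq bit L).
Proof.
move=> yL; rewrite /tent_sum /zval size_mkseq.
rewrite (big_ord_widen L (fun i => tent L i * dir i%:Z) yL) big_mkcond /=.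
apply: eq_bigr => i _; rewrite /prefix_weight nth_mkseq// dirE.
by case: (i < y)%N => /=; rewrite ?mul1r ?mul0r// mulrA.
Qed.

(** The tent length [M ^ j] is shorter than [K ^ j] by [64 ^ j]. Dividing by the squared mass costs
    [16 ^ j]; with the [2 ^ j] of the second moment the last term becomes [32 ^ j * L], which is
    [(K / 2) ^ j]. The terms in [L / t ^ 2] and [L ^ 3] are absorbed by [sig >= 64]. *)
Lemma good_green_upper (r t : R) n :
  ~~ energy_bad f M4 sig j (mkseq bit L) -> ~~ mass_bad f M4 sig j (mkseq bit L) ->
  (K ^ j.+1)%:R^-1 <= t <= (K ^ j)%:R^-1 ->
  1 / 2 <= r < 1 -> 1 - r <= t ^+ 2 -> r ^+ n <= 1 - r ->
  green_at dir r n t <= (450 + 96 * K%:R ^+ 2) * (K%:R / 2) ^+ j.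
Proof.
rewrite /energy_bad /mass_bad -leNgt -ltNge -tent_sum_zval// => hE hm /andP[t1 t2] hr rt rn.
have {}hE : \sum_(y < L.+1) tent_sum dir L y ^+ 2 <= L%:R ^+ 3 * sig ^+ (2 * j) * 2 ^+ j.
  apply: le_trans hE; apply: ler_sum => y _.
  by rewrite tent_sum_zval// -ltnS.
have L0 : (0 < L)%N by rewrite Mj_gt0.
have LR : 1 <= L%:R :> R by rewrite ler1n.
have K0 m : 0 < (K ^ m)%:R :> R by rewrite ltr0n expn_gt0 !muln_gt0 M40.
have t0 : 0 < t by apply: lt_le_trans t1; rewrite invr_gt0.
have tle1 : t <= 1.
  apply: le_trans t2 _; rewrite invf_le1// ler1n expn_gt0 !muln_gt0 M40 //.
have s0 : 0 < sig ^+ j by apply: lt_le_trans (sig_ge1 sig64 j).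
have p4 : 0 < 4 ^+ j :> R by rewrite exprn_gt0.
set m0 := tent_sum dir L L in hm.
have b0 : 0 < L%:R * sig ^+ j / 4 ^+ j by rewrite divr_gt0// mulr_gt0// ltr0n.
have m0n : m0 != 0 by rewrite -normr_gt0; exact: lt_trans hm.
have := green_tent_upper dir_sign L0 (introT andP (conj t0 tle1)) hr rt rn m0n.
move=> /le_trans; apply; rewrite -/m0.
pose w := (L%:R * sig ^+ j / 4 ^+ j) ^+ 2.
have w0 : 0 < w by rewrite exprn_gt0.
have wm : w <= m0 ^+ 2.
  by rewrite -(real_normK (num_real m0)) ler_pXn2r ?nnegrE ?(ltW b0)// ltW.
have tK : (t ^+ 2)^-1 <= (K ^ j.+1)%:R ^+ 2.
  rewrite -exprVn ler_pXn2r ?nnegrE ?invr_ge0 ?(ltW t0) ?(ltW (K0 _))//.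
  by rewrite -[leRHS]invrK lef_pV2 ?posrE ?invr_gt0.
set S := \sum_(y < L.+1) _ in hE *.
have S0 : 0 <= S by apply: sumr_ge0 => y _; exact: sqr_ge0.
pose num := 96 * L%:R * (K ^ j.+1)%:R ^+ 2 + 384 * L%:R ^+ 3
   + 32 * (L%:R ^+ 3 * sig ^+ (2 * j) * 2 ^+ j).
have hnum : (96 * L%:R / t ^+ 2 + 384 * L%:R ^+ 3 + 32 * S) / m0 ^+ 2 <= num / w.
  apply: ler_pM.
  - apply: addr_ge0; last by rewrite mulr_ge0.
    apply: addr_ge0; last by apply: mulr_ge0; [exact: ler0n|exact: exprn_ge0].
    by apply: divr_ge0; [apply: mulr_ge0; exact: ler0n|exact: sqr_ge0].
  - by rewrite invr_ge0 sqr_ge0.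
  - rewrite /num; apply: lerD; last by rewrite ler_wpM2l.
    by rewrite lerD2r ler_wpM2l ?mulr_ge0.
  - by rewrite lef_pV2 ?posrE// (lt_le_trans w0 wm).
have -> : (450 + 96 * K%:R ^+ 2) * (K%:R / 2) ^+ j =
  34 * (32 * M%:R) ^+ j + (96 * K%:R ^+ 2 * (32 * M%:R) ^+ j + 384 * (32 * M%:R) ^+ j
     + 32 * (32 * M%:R) ^+ j) :> R.
  by rewrite (_ : K%:R / 2 = 32 * M%:R :> R); [ring|rewrite (natrM _ 64); field].
have MX : M%:R ^+ j = L%:R :> R by rewrite natrX.
have le32 (x : R) : 1 <= x -> x <= 32 -> x ^+ j * L%:R <= (32 * M%:R) ^+ j.
  move=> x1 x32; have x0 : 0 <= x by lra.
  rewrite -MX -exprMn; apply: lerXn2r; rewrite ?nnegrE ?mulr_ge0//.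
  by rewrite ler_wpM2r.
have h1 : L%:R <= (32 * M%:R) ^+ j :> R.
  by have := le32 1 (lexx _) (ltac:(lra)); rewrite expr1n mul1r.
have s2 : (sig ^+ j) ^+ 2 = (sig ^+ 2) ^+ j by rewrite -!exprM mulnC.
have s2j : sig ^+ (2 * j) = (sig ^+ 2) ^+ j by rewrite exprM.
have p16 : (4 ^+ j) ^+ 2 = 16 ^+ j :> R.
  by rewrite -exprM mulnC exprM; congr (_ ^+ _); ring.
have wE : w = L%:R ^+ 2 * (sig ^+ 2) ^+ j / 16 ^+ j.
  by rewrite /w expr_div_n exprMn s2 p16.
have q0 : 0 < 16 ^+ j :> R by rewrite exprn_gt0.
have sg0 : 0 < sig by exact: lt_le_trans sig64.
have S2 : 64 ^+ 2 <= sig ^+ 2.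
  by apply: lerXn2r => //; rewrite nnegrE ltW.
have SS0 : 0 < (sig ^+ 2) ^+ j by rewrite !exprn_gt0.
have e1 : 96 * L%:R * (K ^ j.+1)%:R ^+ 2 / w <= 96 * K%:R ^+ 2 * (32 * M%:R) ^+ j.
  have -> : 96 * L%:R * (K ^ j.+1)%:R ^+ 2 / w =
     96 * K%:R ^+ 2 * ((K%:R ^+ 2 * 16 / (M%:R * sig ^+ 2)) ^+ j).
    rewrite wE !natrX exprS expr_div_n !exprMn expr1 !(exprS K%:R j).
    have M0 : M%:R != 0 :> R by rewrite pnatr_eq0 -lt0n muln_gt0.
    have sgn0 : sig != 0 by rewrite gt_eqF.
    by field; rewrite !expf_neq0.
  apply: ler_wpM2l; first by apply: mulr_ge0; [exact: ler0n|exact: sqr_ge0].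
  apply: lerXn2r; rewrite ?nnegrE.
  - apply: divr_ge0; first by apply: mulr_ge0; [exact: sqr_ge0|exact: ler0n].
    by apply: mulr_ge0; [exact: ler0n|exact: sqr_ge0].
  - by apply: mulr_ge0; exact: ler0n.
  - by rewrite (natrM _ 64); apply: scale_ratio_le; rewrite ?ltr0n ?muln_gt0.
have e2 : 384 * L%:R ^+ 3 / w <= 384 * (32 * M%:R) ^+ j.
  have -> : 384 * L%:R ^+ 3 / w = 384 * ((16 / sig ^+ 2) ^+ j * L%:R).
    rewrite wE expr_div_n; field.
    by rewrite !gt_eqF ?exprn_gt0 ?ltr0n.
  apply: ler_wpM2l; first exact: ler0n.
  apply: le_trans h1; rewrite ler_piMl//.
  rewrite exprn_ile1 ?divr_ge0 ?sqr_ge0// ler_pdivrMr ?exprn_gt0// mul1r.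
  by apply: le_trans S2; rewrite expr2; lra.
have e3 : 32 * (L%:R ^+ 3 * sig ^+ (2 * j) * 2 ^+ j) / w <= 32 * (32 * M%:R) ^+ j.
  have -> : 32 * (L%:R ^+ 3 * sig ^+ (2 * j) * 2 ^+ j) / w = 32 * (32 ^+ j * L%:R).
    have -> : 32 ^+ j = 2 ^+ j * 16 ^+ j :> R by rewrite -exprMn; congr (_ ^+ _); ring.
    rewrite wE s2j; field.
    by rewrite !gt_eqF ?exprn_gt0 ?ltr0n.
  apply: ler_wpM2l; first exact: ler0n.
  by apply: le32 => //; lra.
apply: lerD; first by lra.
apply: (le_trans hnum); rewrite /num 2!mulrDl.
exact: lerD (lerD e1 e2) e3.
Qed.

End GoodEnvironment.

(** * Almost sure statements *)

Section BorelCantelli.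
Context {R : realType} d (T : measurableType d) (P : probability T R).

(** First Borel-Cantelli lemma; the null set is the limsup of [F]. *)
Lemma ae_of_eventually_not (F : nat -> set T) (C : R) (S : T -> Prop) :
  (forall k, measurable (F k)) -> (forall n, \sum_(k < n) pr P (F k) <= C) ->
  (forall w n, (forall k, (n <= k)%N -> ~ F k w) -> S w) -> {ae P, forall w, S w}.
Proof.
move=> mF hC hS; exists (lim_sup_set F); split.
- by apply: bigcapT_measurable => n; apply: bigcup_measurable.
- apply: lim_sup_set_cvg0 => //.
  apply: (@le_lt_trans _ _ C%:E); last exact: ltry.
  apply: lime_le; first by apply: is_cvg_nneseries => n _ _.
  apply: nearW => n; rewrite (eq_bigr (fun k => (pr P (F k))%:E)); last first.
    by move=> k _; exact: (prE P (mF k)).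
  by rewrite sumEFin lee_fin big_mkord.
move=> w /= nS n _ /=.
have [k nk Fk] : exists2 k, (n <= k)%N & F k w.
  apply: contrapT => h; apply: nS; apply: (hS w n) => k nk Fk; apply: h.
  by exists k.
by exists k.
Qed.

End BorelCantelli.

Section BernoulliSets.
Context {R : realType} d (T : measurableType d) (P : probability T R).
Variables (B : nat -> set T) (q : nat -> R).
Hypothesis mB : forall i, measurable (B i).

Definition all_in (J : seq nat) : set T := [set w | forall i, i \in J -> B i w].

Hypothesis B_indep : forall J, uniq J -> pr P (all_in J) = \prod_(i <- J) q i.

Definition bits (n : nat) (w : T) : seq bool := mkseq (fun i => `[< B i w >]) n.

Definition cylinder (s : seq bool) : set T := [set w | bits (size s) w = s].

Lemma cylinder_rcons s b :
  cylinder (rcons s b) = cylinder s `&` (if b then B (size s) else ~` B (size s)).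
Proof.
rewrite /cylinder size_rcons; apply/seteqP; split=> w /=.
  rewrite /bits mkseqS => /eqP; rewrite eqseq_rcons => /andP[/eqP h /eqP h2].
  by split=> //; case: b h2 => /asboolP.
move=> [h hb]; rewrite /bits mkseqS -/(bits (size s) w) h; congr rcons.
by case: b hb => hb; apply/asboolP.
Qed.

Lemma measurable_cylinder s : measurable (cylinder s).
Proof.
elim/last_ind: s => [|s b IH].
  have -> : cylinder [::] = setT by apply/seteqP; split.
  exact: measurableT.
rewrite cylinder_rcons; apply: measurableI => //.
by case: b => //; exact: measurableC.
Qed.

Lemma measurable_all_in J : measurable (all_in J).
Proof.
elim: J => [|i J IH].
  have -> : all_in [::] = setT by apply/seteqP; split.
  exact: measurableT.
have -> : all_in (i :: J) = B i `&` all_in J; last exact: measurableI.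
apply/seteqP; split=> w /=.
  move=> h; split; first by apply: h; rewrite mem_head.
  by move=> k kJ; apply: h; rewrite in_cons kJ orbT.
by move=> [h1 h2] k; rewrite in_cons => /orP[/eqP ->//|]; exact: h2.
Qed.

(** Independence is given for intersections of the [B i] only. Induction on the word reaches
    complements: a true last bit joins [J], and a false one is obtained by subtraction. *)
Lemma cylinder_all_in s J : uniq J -> (forall i, i \in J -> (size s <= i)%N) ->
  pr P (cylinder s `&` all_in J) = pr P (cylinder s) * \prod_(i <- J) q i.
Proof.
elim/last_ind: s J => [|s b IH] J uJ hJ.
  have -> : cylinder [::] = setT by apply/seteqP; split.
  by rewrite setTI pr_setT mul1r B_indep.
have uJ' : uniq (size s :: J).
  rewrite /= uJ andbT; apply/negP => /hJ; rewrite size_rcons ltnn //.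
have hJ' i : i \in size s :: J -> (size s <= i)%N.
  rewrite in_cons => /orP[/eqP ->//|/hJ]; rewrite size_rcons; exact: ltnW.
have hJ1 i : i \in J -> (size s <= i)%N.
  by move=> iJ; apply: hJ'; rewrite in_cons iJ orbT.
have AS K' : all_in (size s :: K') = B (size s) `&` all_in K'.
  apply/seteqP; split=> w /=.
    move=> h; split; first by apply: h; rewrite mem_head.
    by move=> k kJ; apply: h; rewrite in_cons kJ orbT.
  by move=> [h1 h2] k; rewrite in_cons => /orP[/eqP ->//|]; exact: h2.
have e1 := IH _ uJ' hJ'; have e2 := IH _ uJ hJ1.
have e3 : pr P (cylinder s `&` B (size s)) = pr P (cylinder s) * q (size s).
  have := IH [:: size s] isT; rewrite big_seq1 AS.
  have -> : all_in [::] = setT by apply/seteqP; split.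
  rewrite setIT; apply => i; rewrite inE => /eqP -> //.
rewrite AS big_cons in e1; rewrite cylinder_rcons.
have mC := measurable_cylinder s; have mJ := measurable_all_in J.
case: b {hJ}; first by rewrite -setIA e1 e3 mulrA.
have mCJ : measurable (cylinder s `&` all_in J) by exact: measurableI.
have := pr_split P mC (mB (size s)); rewrite setDE e3.
have := pr_split P mCJ (mB (size s)); rewrite setDE e2.
have -> : cylinder s `&` all_in J `&` B (size s) = cylinder s `&` (B (size s) `&` all_in J).
  by rewrite -setIA (setIC (all_in J)).
have -> : cylinder s `&` all_in J `&` ~` B (size s) =
    cylinder s `&` ~` B (size s) `&` all_in J by rewrite setIAC.
rewrite e1 => h1 h2.
have -> : pr P (cylinder s `&` ~` B (size s)) = pr P (cylinder s) - pr P (cylinder s) * q (size s).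
  by rewrite {1}h2; ring.
have -> : pr P (cylinder s `&` ~` B (size s) `&` all_in J) =
  pr P (cylinder s) * \prod_(i <- J) q i -
  pr P (cylinder s) * (q (size s) * \prod_(i <- J) q i) by rewrite {1}h1; ring.
by ring.
Qed.

Lemma cylinder_true s :
  pr P (cylinder (rcons s true)) = pr P (cylinder s) * q (size s).
Proof.
rewrite cylinder_rcons; have := @cylinder_all_in s [:: size s] isT.
rewrite big_seq1 => <-; last by move=> i; rewrite inE => /eqP ->.
congr (pr P (_ `&` _)); apply/seteqP; split=> w /=.
  by move=> h i; rewrite inE => /eqP ->.
by apply; rewrite mem_head.
Qed.

Lemma cylinder_false s :
  pr P (cylinder (rcons s false)) = pr P (cylinder s) * (1 - q (size s)).
Proof.
have := pr_split P (measurable_cylinder s) (mB (size s)).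
have := cylinder_true s; have := cylinder_rcons s true => /= <- ->.
have := cylinder_rcons s false; rewrite /= -setDE => <-.
by move=> h; lra.
Qed.

Lemma bits_law n s (Phi : pred (seq bool)) :
  measurable (cylinder s `&` [set w | Phi (bits (size s + n) w)]) /\
  pr P (cylinder s `&` [set w | Phi (bits (size s + n) w)]) =
  pr P (cylinder s) * bexp q n s (fun s' => (Phi s')%:R).
Proof.
elim: n s => [|n IH] s /=.
  rewrite addn0; case Phis : (Phi s).
    have -> : cylinder s `&` [set w | Phi (bits (size s) w)] = cylinder s.
      by apply/seteqP; split=> w /=; [case|move=> h; split; rewrite ?h].
    by split; [exact: measurable_cylinder|rewrite mulr1].
  have -> : cylinder s `&` [set w | Phi (bits (size s) w)] = set0.
    by apply/seteqP; split=> // w /= [h]; rewrite h Phis.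
  by rewrite pr_set0 mulr0; split.
have [m1 h1] := IH (rcons s true); have [m0 h0] := IH (rcons s false).
rewrite size_rcons addSnnS in m1 h1.
rewrite size_rcons addSnnS in m0 h0.
set X := [set w | Phi (bits (size s + n.+1) w)] in m1 h1 m0 h0 *.
have XE : cylinder s `&` X = (cylinder (rcons s true) `&` X) `|` (cylinder (rcons s false) `&` X).
  rewrite !cylinder_rcons -setIUl -setIUr; congr (_ `&` _).
  by rewrite setUv setIT.
have mX : measurable (cylinder s `&` X) by rewrite XE; exact: measurableU.
split=> //.
have := pr_split P mX (mB (size s)).
have -> : cylinder s `&` X `&` B (size s) = cylinder (rcons s true) `&` X.
  by rewrite cylinder_rcons setIAC.
have -> : cylinder s `&` X `\` B (size s) = cylinder (rcons s false) `&` X.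
  by rewrite cylinder_rcons setDE setIAC.
by rewrite h1 h0 cylinder_true cylinder_false => ->; ring.
Qed.

Lemma bits_prob n (Phi : pred (seq bool)) :
  measurable [set w | Phi (bits n w)] /\
  pr P [set w | Phi (bits n w)] = bexp q n [::] (fun s' => (Phi s')%:R).
Proof.
have := bits_law n [::] Phi.
have -> : cylinder [::] = setT by apply/seteqP; split.
by rewrite setTI pr_setT mul1r.
Qed.

End BernoulliSets.

Section Potential.
Context {R : realType}.
Variables (Q : nat) (f dir : int -> R) (n : nat).
Hypothesis Q0 : (0 < Q)%N.
Hypothesis f_sign : forall y, f y = -1 \/ f y = 1.
Hypothesis f_periodic : forall y, f (y + Q%:Z) = f y.
Hypothesis f_sum : \sum_(0 <= k < Q) f k%:Z = 0.
Hypothesis dir_sign : forall y, dir y = -1 \/ dir y = 1.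
Hypothesis dir_far : forall y : int, (n < `|y|)%N -> dir y = f y.

Definition potential (y : int) : R :=
  match y with
  | Posz m => \sum_(k < m) dir k%:Z
  | Negz m => - \sum_(k < m.+1) dir (Negz k)
  end.

Lemma potentialS y : potential (y + 1) - potential y = dir y.
Proof.
case: y => [m|[|m]].
- by rewrite PoszS /= big_ord_recr /=; ring.
- by rewrite Negz0S /= big_ord_recr !big_ord0 /=; ring.
- by rewrite NegzS /= [in X in _ - X]big_ord_recr /=; ring.
Qed.

(** At most [n.+1] terms differ, each by at most 2. *)
Lemma sum_defects_le (g h : nat -> R) m :
  (forall k, g k = -1 \/ g k = 1) -> (forall k, h k = -1 \/ h k = 1) ->
  (forall k, (n < k)%N -> g k = h k) ->
  `|\sum_(k < m) g k - \sum_(k < m) h k| <= 2 * n.+1%:R.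
Proof.
move=> g1 h1 gh; rewrite -sumrB; apply: le_trans (ler_norm_sum _ _ _) _.
suff : \sum_(k < m) `|g k - h k| <= 2 * (minn m n.+1)%:R.
  by move/le_trans; apply; rewrite ler_wpM2l// ler_nat geq_minr.
elim: m => [|m IH]; first by rewrite big_ord0 min0n mulr0.
rewrite big_ord_recr /=; have [nm|mn] := ltnP n m.
  rewrite gh// subrr normr0 addr0 (minn_idPr (leqW nm)).
  by rewrite (minn_idPr nm) in IH.
rewrite (minn_idPl (_ : m.+1 <= n.+1)%N)//; rewrite (minn_idPl (leqW mn)) in IH.
rewrite -(natr1 m) mulrDr mulr1; apply: lerD => //.
by case: (g1 m) => ->; case: (h1 m) => ->; rewrite ler_norml; apply/andP; split; lra.
Qed.

Lemma potential_le y : `|potential y| <= Q%:R + 2 * n.+2%:R.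
Proof.
have tri (a b e1 e2 : R) : `|a - b| <= e1 -> `|b| <= e2 -> `|a| <= e2 + e1.
  by move=> h1 h2; rewrite -(subrK b a) addrC; apply: le_trans (ler_normD _ _) _; exact: lerD.
have n2 : 2 * n.+1%:R <= 2 * n.+2%:R :> R by rewrite ler_wpM2l// ler_nat.
case: y => m /=.
  apply: (tri _ (\sum_(k < m) f k%:Z)).
    apply: le_trans (sum_defects_le (g := fun k => dir k%:Z) (h := fun k => f k%:Z)
      m _ _ _) n2 => // k nk; exact: dir_far.
  have := periodic_sum_le f_sign f_periodic f_sum 0 m Q0.
  by under eq_bigr do rewrite add0r.
rewrite normrN; apply: (tri _ (\sum_(k < m.+1) f (Negz k))).
  apply: le_trans (sum_defects_le (g := fun k => dir (Negz k)) (h := fun k => f (Negz k))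
      m.+1 _ _ _) n2 => // k nk; apply: dir_far; exact: ltnW.
rewrite (reindex_inj rev_ord_inj) /=.
have := periodic_sum_le f_sign f_periodic f_sum (- m.+1%:Z) m.+1 Q0.
congr (_ <= _); congr `|_|; apply: eq_bigr => k _; congr f.
by have := ltn_ord k; move: (k : nat) => i; lia.
Qed.

End Potential.

Section PowerSums.
Context {R : realType}.

Lemma powR_natX (a x : R) (i : nat) : 0 <= a -> (a ^+ i) `^ x = (a `^ x) ^+ i.
Proof.
by move=> a0; rewrite -(powR_mulrn i a0) -(powR_mulrn i (powR_ge0 a x)) powRAC.
Qed.

Lemma powR_gt1 (a x : R) : 1 < a -> 0 < x -> 1 < a `^ x.
Proof.
move=> a1 x0; have a0 : 0 <= a by exact/ltW/(lt_trans ltr01).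
have := gt0_ltr_powR x0 (x := 1) (y := a); rewrite powR1; apply => //;
  by rewrite nnegrE.
Qed.

(** Cauchy condensation with ratio [rho = 2^(1 - beta)]. *)
Lemma sum_powR_le (beta : R) : 1 < beta -> exists C : R,
  forall n, \sum_(k < n) (k.+1%:R `^ beta)^-1 <= C.
Proof.
move=> b1; pose rho : R := (2 `^ (beta - 1))^-1.
have b0 : 0 < beta by exact: lt_trans b1.
have p1 : 1 < 2 `^ (beta - 1) :> R by rewrite powR_gt1 ?subr_gt0// ltr1n.
have p0 : 0 < 2 `^ (beta - 1) :> R by exact: powR_gt0.
have rho0 : 0 <= rho by rewrite invr_ge0 ltW.
have rho1 : rho < 1 by rewrite invf_lt1.
exists (1 - rho)^-1 => n.
have block i : \sum_(2 ^ i <= m < 2 ^ i.+1) (m%:R `^ beta)^-1 <= rho ^+ i.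
  have e0 : 0 < (2 ^+ i) `^ beta :> R by rewrite powR_gt0 ?exprn_gt0.
  apply: (@le_trans _ _ (\sum_(2 ^ i <= m < 2 ^ i.+1) ((2 ^+ i) `^ beta)^-1)).
    apply: ler_sum_nat => m /andP[im _].
    have m0 : 0 < m%:R :> R by rewrite ltr0n (leq_trans _ im)// expn_gt0.
    rewrite lef_pV2 ?posrE ?powR_gt0//; apply: ge0_ler_powR; rewrite ?nnegrE ?exprn_ge0 ?(ltW b0)//.
    by rewrite -natrX ler_nat.
  rewrite sumr_const_nat expnS mul2n -addnn addnK -[leLHS]mulr_natr natrX.
  rewrite powR_natX// /rho -exprVn -exprMn exprVn -(mulr_powRB1 (ler0n _ 2) b0).
  by rewrite invfM mulrAC mulVf ?pnatr_eq0// mul1r exprVn.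
have dyadic i : \sum_(1 <= m < 2 ^ i) (m%:R `^ beta)^-1 <= \sum_(l < i) rho ^+ l.
  elim: i => [|i IH]; first by rewrite expn0 big_geq// big_ord0.
  have h1 : (1 <= 2 ^ i)%N by rewrite expn_gt0.
  have h2 : (2 ^ i <= 2 ^ i.+1)%N by rewrite leq_exp2l.
  by rewrite (big_cat_nat h1 h2) big_ord_recr /=; exact: lerD.
apply: le_trans (sum_geometric_le n rho0 rho1); apply: le_trans (dyadic n).
rewrite -(big_mkord xpredT (fun k => (k.+1%:R `^ beta)^-1)).
have h : (n.+1 <= 2 ^ n)%N by exact: ltn_expl.
rewrite (big_cat_nat (n := n.+1) _ h)//= ler_wpDr//.
  by apply: sumr_ge0 => m _; rewrite invr_ge0 powR_ge0.
by rewrite big_add1.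
Qed.

Lemma powR_ge_exists (a b : R) : 0 < a -> 1 <= b ->
  exists2 m : nat, (0 < m)%N & b <= (4 * m)%:R `^ a.
Proof.
move=> a0 b1; have [k hk] := nat_ge_exists (b `^ a^-1).
exists (2 ^ k)%N; first by rewrite expn_gt0.
have b0 : 0 <= b by exact: le_trans b1.
have -> : b = (b `^ a^-1) `^ a by rewrite -powRrM mulVf ?powRr1// lt0r_neq0.
apply: ge0_ler_powR; rewrite ?nnegrE ?powR_ge0 ?(ltW a0)//.
by apply: le_trans hk _; rewrite ler_nat leq_pmull.
Qed.

End PowerSums.

(** * The random environment as independent flips of a periodic orientation *)

Section Environment.
Context {R : realType} d (T : measurableType d) (P : probability T R).
Variables (eps lam : int -> {RV P >-> R}) (f : int -> R).
Hypothesis eps_rademacher : forall y, rademacher (eps y).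
Hypothesis eps_indep : mutually_independent eps.
Hypothesis f_sign : forall y, f y = -1 \/ f y = 1.
Hypothesis lam01 : forall y w, lam y w = 0 \/ lam y w = 1.
Hypothesis lam_indep : mutually_independent lam.
Hypothesis lam_eps_indep : independent_families lam eps.

Local Notation env w := (perturbed_orientation f (eps ^~ w) (lam ^~ w)).

Lemma env_sign w y : env w y = -1 \/ env w y = 1.
Proof.
rewrite /perturbed_orientation; have [/(_ w) h _ _] := eps_rademacher y.
case: (lam01 y w) => ->; last by case: h => ->; [left|right]; ring.
by case: (f_sign y) => ->; [left|right]; ring.
Qed.

(** A line departs from [f] exactly when [lam] selects it and [eps] opposes [f], which halves the
    probability of selection. Nonnegative ordinates suffice since the tent lives on [[0, L]]. *)
Definition flip (i : nat) : set T :=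
  lam i%:Z @^-1` [set 1] `&` eps i%:Z @^-1` [set - f i%:Z].

Definition flip_rate (i : nat) : R := pr P (lam i%:Z @^-1` [set 1]) / 2.

Lemma measurable_level (X : {RV P >-> R}) (x : R) : measurable (X @^-1` [set x]).
Proof. by rewrite -[_ @^-1` _]setTI; apply: measurable_funP. Qed.

Lemma measurable_flip i : measurable (flip i).
Proof. by apply: measurableI; exact: measurable_level. Qed.

Lemma pr_le1 (A : set T) : measurable A -> pr P A <= 1.
Proof. by move=> mA; rewrite -(pr_setT P); exact: pr_le. Qed.

Lemma flip_rate01 i : 0 <= flip_rate i <= 1 / 2.
Proof.
have h1 := pr_ge0 P (lam i%:Z @^-1` [set 1]).
have h2 := pr_le1 (measurable_level (lam i%:Z) 1).
by rewrite /flip_rate; apply/andP; split; lra.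
Qed.

Lemma env_flip w (i : nat) : env w i%:Z = f i%:Z * (if `[< flip i w >] then -1 else 1).
Proof.
rewrite /perturbed_orientation; case: asboolP => [[/= -> ->]|nflip]; first by ring.
case: (lam01 i%:Z w) => hl; first by rewrite hl; ring.
have [/(_ w) he _ _] := eps_rademacher i%:Z.
have : eps i%:Z w = f i%:Z.
  apply: contrapT => h; apply: nflip; split => //=.
  by move: h; case: he => ->; case: (f_sign i%:Z) => ->; rewrite ?opprK.
by rewrite hl => ->; ring.
Qed.

Lemma sigma_of_family_bigcap (X : int -> {RV P >-> R}) (J : seq int) (x : int -> R) :
  sigma_of_family X (\bigcap_(i in [set` J]) X i @^-1` [set x i]).
Proof.
rewrite /sigma_of_family; set G := [set E | _].
have : @measurable _ (g_sigma_algebraType G) (\bigcap_(i in [set` J]) X i @^-1` [set x i]).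
  apply: fin_bigcap_measurable; first exact: finite_seq.
  by move=> i _; apply: sub_sigma_algebra; exists i, [set x i].
by [].
Qed.

Lemma pr_flips (J : seq nat) : uniq J -> pr P (all_in flip J) = \prod_(i <- J) flip_rate i.
Proof.
move=> uJ; pose J' := map Posz J.
have uJ' : uniq J' by rewrite map_inj_uniq// => a b [].
pose El := \bigcap_(i in [set` J']) lam i @^-1` [set 1].
pose Ee := \bigcap_(i in [set` J']) eps i @^-1` [set - f i].
have -> : all_in flip J = El `&` Ee.
  apply/seteqP; split=> w /=.
    by move=> h; split=> i /mapP[k kJ ->]; have [] := h k kJ.
  by move=> [h1 h2] i iJ; split; [apply: h1|apply: h2]; exact: map_f.
have := lam_eps_indep (@sigma_of_family_bigcap lam J' (fun=> 1))
  (@sigma_of_family_bigcap eps J' (fun i => - f i)).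
rewrite -/El -/Ee => PEE.
have := @lam_indep J' (fun=> [set 1]) uJ' (fun=> measurable_set1 _).
have := @eps_indep J' (fun i => [set - f i]) uJ' (fun=> measurable_set1 _).
rewrite -/El -/Ee => PEe PEl.
have half i : P (eps i @^-1` [set - f i]) = (2^-1)%:E.
  by have [_ h1 h2] := eps_rademacher i; case: (f_sign i) => ->; rewrite ?opprK.
rewrite /pr PEE PEl PEe !big_map.
rewrite (eq_bigr (fun i : nat => (pr P (lam i%:Z @^-1` [set 1]))%:E)); last first.
  by move=> i _; apply: prE; exact: measurable_level.
rewrite [X in (_ * X)%E](eq_bigr (fun i : nat => (2^-1)%:E)); last by move=> i _; exact: half.
by rewrite !prodEFin -EFinM /= -big_split.
Qed.

Lemma prU_le (A B : set T) : measurable A -> measurable B ->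
  pr P (A `|` B) <= pr P A + pr P B.
Proof.
move=> mA mB; have mU := measurableU _ _ mA mB.
rewrite (pr_split P mU mA).
have -> : (A `|` B) `&` A = A by apply/seteqP; split=> w; [case|move=> ?; split=> //; left].
rewrite lerD2l.
apply: pr_le => //; first exact: measurableD.
by move=> w [[]].
Qed.

Variables (Q : nat) (c beta : R).
Hypothesis Q_gt1 : (1 < Q)%N.
Hypothesis f_periodic : forall y, f (y + Q%:Z) = f y.
Hypothesis f_sum : \sum_(0 <= k < Q) f k%:Z = 0.
Hypothesis c_gt0 : 0 < c.
Hypothesis c_range : forall y : int, y != 0 -> 0 <= c / (`|y|%:~R `^ beta) <= 1.
Hypothesis lam_law : forall y : int, y != 0 ->
  P (lam y @^-1` [set 1]) = (c / (`|y|%:~R `^ beta))%:E.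

(** For negative [beta] the prescribed probability would exceed 1 at large [|y|]. Monotonicity of
    the flip rates depends on this. *)
Lemma exponent_ge0 : 0 <= beta.
Proof.
rewrite leNgt; apply/negP => b0.
have nb0 : 0 < - beta by rewrite oppr_gt0.
have ci0 : 0 < c^-1 by rewrite invr_gt0.
have b1 : 1 <= c^-1 + 1 by rewrite lerDr ltW.
have [m m0 hm] := powR_ge_exists nb0 b1.
have y0 : (4 * m)%N%:Z != 0 :> int by rewrite eqz_nat muln_eq0 /= -lt0n.
have /andP[_] := c_range y0; rewrite -powRN => h.
have : c * (c^-1 + 1) <= 1 by apply: le_trans h; rewrite ler_pM2l.
by rewrite mulrDr divff ?gt_eqF// mulr1; move: c_gt0; lra.
Qed.

Lemma pr_lam (y : int) : y != 0 -> pr P (lam y @^-1` [set 1]) = c / (`|y|%:~R `^ beta).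
Proof. by move=> y0; rewrite /pr lam_law. Qed.

Lemma flip_rateE i : (0 < i)%N -> flip_rate i = c / 2 * (i%:R `^ beta)^-1.
Proof.
move=> i0; rewrite /flip_rate pr_lam; last by rewrite eqz_nat -lt0n.
by rewrite mulrAC.
Qed.

Lemma ae_transient : beta < 1 -> {ae P, forall w, transient R (honeycomb (env w))}.
Proof.
move=> b1; have b0 := exponent_ge0.
have a0 : 0 < (1 - beta) / 2 by rewrite divr_gt0 ?subr_gt0.
have h64 : 1 <= 64 :> R by rewrite ler1n.
have [M4 M40 hM] := powR_ge_exists a0 h64.
pose M := (4 * M4)%N; pose sig : R := M%:R `^ ((1 - beta) / 2).
have M0 : 0 < M%:R :> R by rewrite ltr0n muln_gt0.
have sigE j : sig ^+ (2 * j) = (M ^ j)%:R * ((M ^ j)%:R `^ beta)^-1.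
  rewrite exprM natrX powR_natX ?ltW// -exprVn -exprMn; congr (_ ^+ _).
  rewrite /sig -powR_mulrn ?powR_ge0// -powRrM divfK ?pnatr_eq0//.
  by rewrite powRB ?powRr1 ?ltW// gt_eqF ?implybT.
have mono (x y : nat) : (0 < x <= y)%N -> (y%:R `^ beta)^-1 <= (x%:R `^ beta)^-1 :> R.
  move=> /andP[x0 xy]; have y0 := leq_trans x0 xy.
  rewrite lef_pV2 ?posrE ?powR_gt0 ?ltr0n//.
  by apply: ge0_ler_powR; rewrite ?nnegrE ?ler_nat.
have c2 : 0 <= c / 2 by rewrite divr_ge0// ltW.
have Mj0 j : (0 < M ^ j)%N by rewrite expn_gt0 muln_gt0 M40.
have q_noninc i : (0 < i)%N -> flip_rate i.+1 <= flip_rate i.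
  by move=> i0; rewrite !flip_rateE// ler_wpM2l// mono// i0 leqnSn.
have q_low j i : (0 < i <= M ^ j)%N -> c / 2 * sig ^+ (2 * j) <= flip_rate i * (M ^ j)%:R.
  move=> hi; have /andP[i0 _] := hi; rewrite flip_rateE// sigE -[leRHS]mulrA ler_wpM2l//.
  by rewrite [leRHS]mulrC ler_wpM2l// mono.
have q_up j i : (M ^ j <= i)%N -> flip_rate i * (M ^ j)%:R <= c / 2 * sig ^+ (2 * j).
  move=> hi; have i0 := leq_trans (Mj0 j) hi; rewrite flip_rateE// sigE -[leLHS]mulrA.
  by rewrite ler_wpM2l// [leLHS]mulrC ler_wpM2l// mono// Mj0.
pose bw j w := bits flip (M ^ j) w.
(* Scales start at 1, as the small ball estimate requires [0 < j]. *)
pose Bad k := [set w | energy_bad f M4 sig k.+1 (bw k.+1 w)] `|`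
              [set w | mass_bad f M4 sig k.+1 (bw k.+1 w)].
have Q0 : (0 < Q)%N by exact: ltnW.
have mE k := bits_prob measurable_flip pr_flips (M ^ k.+1) (energy_bad f M4 sig k.+1).
have mM k := bits_prob measurable_flip pr_flips (M ^ k.+1) (mass_bad f M4 sig k.+1).
pose C := 2 * moment_const Q M4 c + (12 + 2048 / c).
have bad_le k : pr P (Bad k) <= C / 2 ^+ k.+1.
  apply: le_trans (prU_le (mE k).1 (mM k).1) _.
  rewrite (mE k).2 (mM k).2 /C mulrDl; apply: lerD.
    exact: (energy_bad_prob Q0 f_sign f_periodic f_sum flip_rate01 q_noninc M40 hM c_gt0 q_up).
  exact: (mass_bad_prob f_sign flip_rate01 M40 hM c_gt0 q_low).
apply: (@ae_of_eventually_not _ _ _ P Bad C).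
- by move=> k; apply: measurableU; [exact: (mE k).1|exact: (mM k).1].
- move=> n; apply: (@le_trans _ _ (C * (1 - (2 ^+ n)^-1))).
    elim: n => [|n IH]; first by rewrite big_ord0 expr0 invr1 subrr mulr0.
    rewrite big_ord_recr /=; apply: le_trans (lerD IH (bad_le n)) _.
    rewrite -mulrDr le_eqVlt; apply/orP; left; apply/eqP; congr (_ * _).
    by rewrite exprS; field; rewrite expf_neq0// pnatr_eq0.
  have C0 : 0 <= C.
    have := le_trans (pr_ge0 P (Bad 0%N)) (bad_le 0%N).
    by rewrite pmulr_lge0// invr_gt0 exprn_gt0.
  by rewrite -[leRHS]mulr1 ler_wpM2l// gerBl invr_ge0 exprn_ge0.
move=> w n good; have ws := env_sign w.
have [C' hC'] : exists C', forall m, \sum_(l < m) return_prob (env w) l <= C'.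
  have K1 : (1 < 64 * M)%N by rewrite (leq_trans (M_gt1 M40))// leq_pmull.
  have A0 : 0 <= 450 + 96 * (64 * M)%N%:R ^+ 2 :> R.
    by apply: addr_ge0; [exact: ler0n|apply: mulr_ge0; [exact: ler0n|exact: sqr_ge0]].
  apply: (returns_bounded ws K1 (ltn0Sn n) A0).
  move=> j m r t nj ht hr rt rm.
  case: j nj ht => // k nk ht; have gk := good k nk.
  apply: (@good_green_upper _ f (env w) (fun i => `[< flip i w >]) M4 sig k.+1) => //.
  - by move=> i; exact: env_flip.
  - by apply/negP => h; apply: gk; left.
  - by apply/negP => h; apply: gk; right.
exact: (transient_of_bounded ws hC').
Qed.

Lemma ae_recurrent : 1 < beta -> {ae P, forall w, recurrent R (honeycomb (env w))}.
Proof.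
move=> b1; have [C hC] := sum_powR_le b1.
pose F k := lam k.+1%:Z @^-1` [set 1] `|` lam (- k.+1%:Z) @^-1` [set 1].
have mlam y : measurable (lam y @^-1` [set 1]) by exact: measurable_level.
apply: (@ae_of_eventually_not _ _ _ P F (2 * c * C)).
- by move=> k; exact: measurableU.
- move=> n; apply: (@le_trans _ _ (\sum_(k < n) 2 * c * (k.+1%:R `^ beta)^-1)).
    apply: ler_sum => k _; apply: le_trans (prU_le (mlam _) (mlam _)) _.
    rewrite !pr_lam ?oppr_eq0//; rewrite normrN.
    by have -> : `|k.+1%:Z| = k.+1%:Z :> int by []; rewrite -mulrA mulr_natl mulr2n.
  by rewrite -mulr_sumr ler_wpM2l// mulr_ge0// ltW.
move=> w n far; have ws := env_sign w.
have env_far (y : int) : (n < `|y|)%N -> env w y = f y.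
  move=> ny; have lam0 : lam y w = 0.
    case: (lam01 y w) => // l1; exfalso.
    have nk : (n <= `|y|.-1)%N by move: ny; case: `|y|%N.
    apply: (far _ nk); rewrite /F prednK ?(leq_ltn_trans _ ny)//.
    by case: (y) l1 => m l1; [left|right].
  by rewrite /perturbed_orientation lam0; ring.
have Q0 : (0 < Q)%N by exact: ltnW.
have B1 : 1 <= Q%:R + 2 * n.+2%:R :> R by rewrite ler_wpDr// ler1n.
apply: (recurrent_of_unbounded ws) => A.
exact: (returns_unbounded ws (potentialS (env w))
  (potential_le Q0 f_sign f_periodic f_sum ws env_far) A B1).
Qed.

End Environment.

Unset Implicit Arguments.
Set Strict Implicit.
Set Printing Implicit Defensive.

Theorem theorem1p3 (R : realType) (d : measure_display) (T : measurableType d)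
    (P : probability T R)
    (eps lam : int -> {RV P >-> R})
    (Q : nat) (f : int -> R) (c beta : R)
    (eps_rademacher : forall y, rademacher (eps y))
    (eps_indep : mutually_independent eps)
    (Q_gt1 : (1 < Q)%N) (Q_even : ~~ odd Q)
    (f_sign : forall y, f y = -1 \/ f y = 1)
    (f_periodic : forall y, f (y + Q%:Z) = f y)
    (f_sum : \sum_(0 <= k < Q) f k%:Z = 0)
    (lam01 : forall y w, lam y w = 0 \/ lam y w = 1)
    (lam_indep : mutually_independent lam)
    (lam_eps_indep : independent_families lam eps)
    (c_gt0 : 0 < c)
    (c_range : forall y : int, y != 0 ->
       0 <= c / (`|y|%:~R `^ beta) <= 1)
    (lam_law : forall y : int, y != 0 ->
       P (lam y @^-1` [set 1]) = (c / (`|y|%:~R `^ beta))%:E) :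
  (beta < 1 ->
     {ae P, forall w, transient R
       (honeycomb (perturbed_orientation f (eps ^~ w) (lam ^~ w)))}) /\
  (1 < beta ->
     {ae P, forall w, recurrent R
       (honeycomb (perturbed_orientation f (eps ^~ w) (lam ^~ w)))}).
Proof.
split.
  exact: (ae_transient eps_rademacher eps_indep f_sign lam01 lam_indep lam_eps_indep
    Q_gt1 f_periodic f_sum c_gt0 c_range lam_law).
exact: (ae_recurrent eps_rademacher f_sign lam01 Q_gt1 f_periodic f_sum c_gt0 lam_law).
Qed.
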